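(* Let $n\geqslant 1$ and let $F(x,y_0,y_1,\ldots,y_n)$ be holomorphic in a neighbourhood of $0\in\mathbb{C}^{n+2}$. Consider the ordinary differential equation $$F(x,y,\delta y,\ldots,\delta^n y)=0,\qquad \delta=x\frac{d}{dx}.$$ Let $\gamma\in\mathbb{R}\setminus\{0\}$ and let $$\varphi=\sum_{k=1}^{\infty}\alpha_k(x^{{\rm i}\gamma})\,x^k$$ be an exotic formal series, where each $\alpha_k(t)=t^{-r_k}\sum_{\ell\geqslant 0}\alpha_{k\ell}t^\ell$ ($r_k\in\mathbb{Z}$, $\alpha_{k\ell}\in\mathbb{C}$) is meromorphic at $t=0$, all $\alpha_k$ being holomorphic in a common punctured disc $\{0<|t|\leqslant R\}$. Suppose $\varphi$ is a formal solution, i.e. $F(x,\Phi)=0$ as an exotic formal series, where $\Phi=(\varphi,\delta\varphi,\ldots,\delta^n\varphi)$, and that $\frac{\partial F}{\partial y_n}(x,\Phi)\not\equiv 0$. Suppose further that there is an integer $m$ such that for every $j=0,1,\ldots,n$, $$\frac{\partial F}{\partial y_j}(x,\Phi)=a_j(x^{{\rm i}\gamma})x^m+b_j(x^{{\rm i}\gamma})x^{m+1}+\ldots,$$ with $a_j,b_j,\ldots$ meromorphic at $0$, where $a_n\not\equiv 0$ and ${\rm ord}_0\,a_j\geqslant {\rm ord}_0\,a_n$ for all $j=0,1,\ldots,n$. Then in any open sector $S$ with vertex at the origin, of opening less than $2\pi$ and of sufficiently small radius, such that $S\subset\{\arg x>(-1/\gamma)\ln R\}$ if $\gamma>0$ (respectively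 $S\subset\{\arg x<(-1/\gamma)\ln R\}$ if $\gamma<0$), the series $\varphi$ converges uniformly in $S$, and thus represents there a branch of a holomorphic function.
   Context: Here $x^{{\rm i}\gamma}=e^{{\rm i}\gamma\ln x}$ for a branch of $\ln x$ on the sector, so $|x^{{\rm i}\gamma}|=e^{-\gamma\arg x}$. The operator $\delta$ acts on exotic series termwise by $\delta\bigl(p(x^{{\rm i}\gamma})x^k\bigr)=\bigl((k+{\rm i}\gamma\,t\tfrac{d}{dt})p\bigr)(x^{{\rm i}\gamma})\,x^k$; products and substitution of exotic series (series $\sum_k p_k(x^{{\rm i}\gamma})x^k$ with $p_k$ meromorphic at $0$) into the holomorphic function $F$ are taken formally, collecting terms by powers of $x$. ${\rm ord}_0$ denotes the order (of zero, negative for a pole) of a meromorphic function at $t=0$. *)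

(* Defs.v *)
From HB Require Import structures.
From mathcomp Require Import all_boot all_order all_algebra.
From mathcomp Require Import complex.
From mathcomp Require Import all_classical all_reals all_analysis.

Set Implicit Arguments.
Unset Strict Implicit.
Unset Printing Implicit Defensive.

Import Order.TTheory GRing.Theory Num.Theory.
Local Open Scope ring_scope.

Section ExoticDefs.
Variable R : realType.
Local Notation C := R[i].

Definition cabs (z : C) : R := let: Complex u v := z in Num.sqrt (u ^+ 2 + v ^+ 2).

Definition cexp (z : C) : C :=
  let: Complex u v := z in (expR u)%:C%C * (Complex (cos v) (sin v)).

Definition series_to (c : nat -> C) (s : C) : Prop :=
  forall e : R, 0 < e -> exists N : nat, forall M : nat, (N <= M)%N ->
    cabs (\sum_(l < M) c l - s) < e.

(* the sum of a series (meaningful when it converges; 0 otherwise) *)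
Definition csum (c : nat -> C) : C := xget 0 (series_to c).

(* Exotic series phi = sum_{k>=1} alpha_k(x^{i gamma}) x^k with
   alpha_k(t) = t^{-r k} sum_l a k l t^l.
   [dcoef gamma r a j k t] is the coefficient (a function of t = x^{i gamma})
   of x^k in delta^j phi, computed termwise:
   (k + i gamma t d/dt)^j alpha_k (t) = t^{-r k} sum_l (k + i gamma (l - r k))^j a k l t^l.
   The coefficient of x^0 is 0. *)
Definition dcoef (gamma : R) (r : nat -> int) (a : nat -> nat -> C)
    (j k : nat) (t : C) : C :=
  if k == 0%N then 0 else
  t ^ (- r k) * csum (fun l =>
     (k%:R + 'i * (gamma%:C)%C * ((l%:Z - r k)%:~R)) ^+ j * a k l * t ^+ l).

(* A power series in (x, y_0, ..., y_n):  sum_{a, b} g a b x^a y^b,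
   b : multi-index of the y's.  Convergence in a neighbourhood of 0
   (i.e. holomorphy near 0) : absolute convergence on some polydisc. *)
Definition mps_convergent (n : nat) (g : nat -> {ffun 'I_n.+1 -> nat} -> C) : Prop :=
  exists rho : R, 0 < rho /\ exists B : R, forall N : nat,
    \sum_(a < N) \sum_(b : {ffun 'I_n.+1 -> 'I_N})
       cabs (g a [ffun i => nat_of_ord (b i)]) * rho ^+ (a + \sum_(i < n.+1) b i)
    <= B.

Definition dpart (n : nat) (g : nat -> {ffun 'I_n.+1 -> nat} -> C) (j : 'I_n.+1)
  : nat -> {ffun 'I_n.+1 -> nat} -> C :=
  fun a b => (b j).+1%:R * g a [ffun i => (b i + (i == j))%N].

(* Formal substitution: coefficient of x^k in g(x, Y_0, ..., Y_n), where
   Y_j = sum_i c j i x^i are formal power series with c j 0 = 0.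
   (Only finitely many terms contribute; we compute modulo x^{k+1}.) *)
Definition subst_coef (n : nat) (g : nat -> {ffun 'I_n.+1 -> nat} -> C)
    (c : 'I_n.+1 -> nat -> C) (k : nat) : C :=
  (\sum_(a < k.+1) \sum_(b : {ffun 'I_n.+1 -> 'I_k.+1})
     g a [ffun i => nat_of_ord (b i)] *:
       ('X^a * \prod_(j < n.+1) (\poly_(i < k.+1) c j i) ^+ b j))`_k.

Definition subst_exotic (n : nat) (g : nat -> {ffun 'I_n.+1 -> nat} -> C)
    (gamma : R) (r : nat -> int) (a : nat -> nat -> C) (k : nat) (t : C) : C :=
  subst_coef g (fun j i => dcoef gamma r a j i t) k.

Definition germ_zero (h : C -> C) : Prop :=
  exists e : R, 0 < e /\ forall t : C, 0 < cabs t < e -> h t = 0.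

Definition ord0_ge (h : C -> C) (q : int) : Prop :=
  exists e : R, 0 < e /\ exists B : R, forall t : C, 0 < cabs t < e ->
    cabs (t ^ (- q) * h t) <= B.

Definition ord0_eq (h : C -> C) (q : int) : Prop :=
  ord0_ge h q /\ ~ ord0_ge h (q + 1).

(* the point x = rho e^{i theta} of the sector, with the branch
   ln x = ln rho + i theta, and t = x^{i gamma} = e^{i gamma ln x} *)
Definition sector_x (rho theta : R) : C :=
  rho%:C%C * Complex (cos theta) (sin theta).
Definition sector_t (gamma rho theta : R) : C :=
  cexp (Complex (- (gamma * theta)) (gamma * ln rho)).

End ExoticDefs.

(* Main.v *)
(* Write c_{j,k}(t) for the coefficient of x^k in delta^j phi. Beyond a finite order the
   equation F(x, Phi) = 0 is linear in the newest coefficients: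
   sum_j a_j(t) c_{j,k}(t) = f_k(t), with f_k a polynomial in the earlier ones.  Cauchy's
   majorant method then bounds |c_{j,k}| by C A^k in any family of submultiplicative
   seminorms for which every c_{j,k} is controlled linearly by f_k; such control is obtained
   in two stages.  On a small disc |t| <= eps the weights |k + i gamma (l - r_k)| of the
   Laurent coefficients of c_{0,k} are at least k in modulus, so for large k the term
   A_n(0) (k + i gamma (l - r_k))^n dominates, where A_n = t^{-q} a_n.  On paths in the variable s = ln x, where delta is d/ds, the equation
   is an ordinary differential equation of order n in which each step of a fixed length
   absorbs the terms of order less than n; this carries the bound from |t| = eps along a
   zero-free ray to a zero-free circle |t| = Rc > Rad.  Cauchy's estimate on that circle and
   the bound on |t| = eps together control c_{0,k} on the whole annulus, and the Weierstrass
   test concludes.  The circle is available because the linear equations extend every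
   alpha_k to a common disc of radius R' > Rad on which a_n vanishes at most inside
   |t| <= Rad. *)
Require Import Defs.
From HB Require Import structures.
From mathcomp Require Import all_boot all_order all_algebra.
From mathcomp Require Import complex ring lra zify.
From mathcomp Require Import all_classical all_reals all_analysis.
Import Order.TTheory GRing.Theory Num.Theory.
Import numFieldNormedType.Exports.
Local Open Scope ring_scope.

Set Implicit Arguments.
Unset Strict Implicit.
Unset Printing Implicit Defensive.

(** * Complex modulus and absolutely convergent series *)

(** Two features of the data shape the argument. The pole orders [r k] are not bounded in k, so a
    disc norm has to treat t^(l - r k) as a monomial of weight rho^(l - r k); the weighted Laurent
    norm does this and stays submultiplicative. And the radius on which alpha_k is known to converge
    exceeds [Rad] by an amount that may shrink with k, so no common outer circle is given. Zeros of
    a_n in 0 < |t| <= Rad prevent a direct estimate on the annulus, since near them the equation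
    cannot be solved for the top derivative. As q is the exact order of a_n, A_n(0) is nonzero and
    these zeros are finite in number: some ray avoids them, and the interior of the annulus is
    recovered from its two boundary circles alone. In both stages the equation only shows that a
    bound M may be replaced by M/2 plus data; convergence of each single coefficient supplies a
    finite M to start from. Arguments in the sector are bounded, so |t| = exp(-gamma arg x) stays
    away from 0, and uniform bounds are needed only for such t. *)

Section Cabs.
Variable R : realType.
Local Notation C := R[i].
Implicit Types (z w : C) (x : R).

Lemma cabs_norm z : (cabs z)%:C%C = `|z|.
Proof. by rewrite normc_def; case: z. Qed.

Lemma cabs_ge0 z : 0 <= cabs z.
Proof. by case: z => u v; rewrite sqrtr_ge0. Qed.

Lemma cabs0 : cabs (0 : C) = 0.
Proof. exact: Normc.normc0. Qed.

Lemma cabs1 : cabs (1 : C) = 1.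
Proof. exact: Normc.normc1. Qed.

Lemma cabs_eq0 z : (cabs z == 0) = (z == 0).
Proof. by apply/eqP/eqP => [/Normc.eq0_normc//|->]; rewrite cabs0. Qed.

Lemma cabs_gt0 z : (0 < cabs z) = (z != 0).
Proof. by rewrite lt_def cabs_ge0 andbT cabs_eq0. Qed.

Lemma cabsM z w : cabs (z * w) = cabs z * cabs w.
Proof. exact: Normc.normcM. Qed.

Lemma cabsV z : cabs z^-1 = (cabs z)^-1.
Proof. exact: Normc.normcV. Qed.

Lemma cabsN z : cabs (- z) = cabs z.
Proof. exact: normcN. Qed.

Lemma cabsD z w : cabs (z + w) <= cabs z + cabs w.
Proof. exact: le_normcD. Qed.

Lemma cabsBC z w : cabs (z - w) = cabs (w - z).
Proof. by rewrite -cabsN opprB. Qed.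

Lemma cabs_ler_dist z w : cabs z - cabs w <= cabs (z - w).
Proof. by have := cabsD (z - w) w; rewrite subrK; lra. Qed.

Lemma cabsX z n : cabs (z ^+ n) = cabs z ^+ n.
Proof. by elim: n => [|n IH]; rewrite ?expr0 ?cabs1 // !exprS cabsM IH. Qed.

Lemma cabs_real x : cabs (x%:C)%C = `|x|.
Proof. by rewrite /cabs /= expr0n /= addr0 sqrtr_sqr. Qed.

Lemma cabs_nat n : cabs (n%:R : C) = n%:R.
Proof. by rewrite -(rmorph_nat (real_complex R)) cabs_real normr_nat. Qed.

Lemma cabs_int (l : int) : cabs (l%:~R : C) = `|l%:~R|.
Proof. by rewrite -(rmorph_int (real_complex R)) cabs_real. Qed.

Lemma cabsXz z (l : int) : cabs (z ^ l) = cabs z ^ l.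
Proof.
by case: l => n; rewrite -?exprnP ?NegzE -?exprnN ?cabsV cabsX.
Qed.

Lemma cabs_sum (I : Type) (s : seq I) (P : pred I) (f : I -> C) :
  cabs (\sum_(i <- s | P i) f i) <= \sum_(i <- s | P i) cabs (f i).
Proof.
elim/big_ind2: _ => [|a b c d H1 H2|//]; first by rewrite cabs0.
exact: le_trans (cabsD _ _) (lerD H1 H2).
Qed.

Lemma cabs_ge_Re z : `|complex.Re z| <= cabs z.
Proof.
by case: z => u v /=; rewrite -sqrtr_sqr ler_wsqrtr // lerDl sqr_ge0.
Qed.

Lemma cabs_ge_Im z : `|complex.Im z| <= cabs z.
Proof.
by case: z => u v /=; rewrite -sqrtr_sqr ler_wsqrtr // lerDr sqr_ge0.
Qed.

Lemma cabs_le_ReIm z : cabs z <= `|complex.Re z| + `|complex.Im z|.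
Proof.
case: z => u v; rewrite [complex.Re _]/= [complex.Im _]/=.
have -> : (u +i* v)%C = (u%:C)%C + (0 +i* v)%C :> C by apply/eqP; rewrite eq_complex /= addr0 add0r !eqxx.
apply: (le_trans (cabsD _ _)); rewrite cabs_real lerD2l /cabs.
by rewrite expr0n add0r sqrtr_sqr.
Qed.

Lemma cabs_Complex x y : cabs (Complex x y) = Num.sqrt (x ^+ 2 + y ^+ 2).
Proof. by []. Qed.

Lemma cabs_eq0_small z : (forall e, 0 < e -> cabs z <= e) -> z = 0.
Proof.
move=> H; apply/eqP; rewrite -cabs_eq0 eq_le cabs_ge0 andbT.
by apply/ler_addgt0Pl => e /H; rewrite addr0.
Qed.

End Cabs.

(** * Absolutely convergent complex series and Cauchy products *)

Section Series.
Variable R : realType.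
Local Notation C := R[i].
Implicit Types (c d : nat -> C) (s z : C) (B : R).

(** Absolute convergence is carried with an explicit bound, so that every estimate on a sum reduces
    to its partial sums. *)
Definition abs_bounded c B := forall N : nat, \sum_(l < N) cabs (c l) <= B.

Lemma abs_bounded_ge0 c B : abs_bounded c B -> 0 <= B.
Proof. by move/(_ 0%N); rewrite big_ord0. Qed.

Lemma series_to_unique c s z : series_to c s -> series_to c z -> s = z.
Proof.
move=> hs hz; apply/subr0_eq/cabs_eq0_small => e e0.
have e20 : 0 < e / 2 by lra.
have [N1 h1] := hs _ e20; have [N2 h2] := hz _ e20.
have := h1 (maxn N1 N2) (leq_maxl _ _); have := h2 (maxn N1 N2) (leq_maxr _ _).
set S := \sum_(_ < _) _ => a1 a2.
have -> : s - z = (S - z) - (S - s) by ring.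
apply: (le_trans (cabsD _ _)); rewrite cabsN; lra.
Qed.

Lemma csum_unique c s : series_to c s -> csum c = s.
Proof.
move=> h; rewrite /csum; apply: (@xget_unique _ 0 (series_to c) s h) => y hy.
exact: series_to_unique hy h.
Qed.

Lemma sum_ord_split (V : nmodType) (f : nat -> V) N M : (N <= M)%N ->
  \sum_(l < M) f l = \sum_(l < N) f l + \sum_(N <= l < M) f l.
Proof. by move=> NM; rewrite -!(big_mkord xpredT) (big_cat_nat (leq0n _) NM). Qed.

Lemma real_abs_series (u : nat -> R) B :
  (forall N, \sum_(l < N) `|u l| <= B) ->
  exists s : R, forall e : R, 0 < e -> exists N, forall M, (N <= M)%N ->
    `|\sum_(l < M) u l - s| < e.
Proof.
move=> hB.
have : cvgn [normed series u].
  apply: nondecreasing_is_cvgn; first by apply: nondecreasing_series => *; exact: normr_ge0.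
  exists B => _ [N _ <-]; rewrite /= seriesEord; exact: hB.
move/normed_cvg => /cvg_ex [s /cvgrPdist_lt hs].
exists s => e /hs [N _ hN]; exists N => M /hN; rewrite seriesEord.
by rewrite distrC.
Qed.

Lemma csumP c B : abs_bounded c B -> series_to c (csum c).
Proof.
move=> hB.
have [s1 h1] : exists s : R, forall e : R, 0 < e -> exists N, forall M, (N <= M)%N ->
    `|\sum_(l < M) complex.Re (c l) - s| < e.
  apply: (@real_abs_series (fun l => complex.Re (c l)) B) => N; apply: le_trans (hB N).
  by apply: ler_sum => l _; exact: cabs_ge_Re.
have [s2 h2] : exists s : R, forall e : R, 0 < e -> exists N, forall M, (N <= M)%N ->
    `|\sum_(l < M) complex.Im (c l) - s| < e.
  apply: (@real_abs_series (fun l => complex.Im (c l)) B) => N; apply: le_trans (hB N).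
  by apply: ler_sum => l _; exact: cabs_ge_Im.
suff h : series_to c (Complex s1 s2) by rewrite (csum_unique h).
move=> e e0; have e20 : 0 < e / 2 by lra.
have [N1 k1] := h1 _ e20; have [N2 k2] := h2 _ e20.
exists (maxn N1 N2) => M; rewrite geq_max => /andP[/k1 a1 /k2 a2].
apply: (le_lt_trans (cabs_le_ReIm _)).
by rewrite !raddfB !raddf_sum /=; lra.
Qed.

(** The part of [B] that a partial sum leaves over pays for the remainder. *)
Lemma csum_tail c B N : abs_bounded c B ->
  cabs (csum c - \sum_(l < N) c l) <= B - \sum_(l < N) cabs (c l).
Proof.
move=> hB; apply/ler_addgt0Pl => e e0.
have [K hK] := csumP hB e0.
have := hK (maxn K N) (leq_maxl _ _); set M := maxn K N.
have NM : (N <= M)%N by exact: leq_maxr.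
move=> h; rewrite cabsBC in h.
have h1 := hB M; rewrite (sum_ord_split (fun l => cabs (c l)) NM) in h1.
have h2 : cabs (\sum_(N <= l < M) c l) <= \sum_(N <= l < M) cabs (c l) by exact: cabs_sum.
have -> : csum c - \sum_(l < N) c l =
    (csum c - \sum_(l < M) c l) + \sum_(N <= l < M) c l by rewrite (sum_ord_split c NM); ring.
apply: (le_trans (cabsD _ _)); lra.
Qed.

Lemma cabs_csum c B : abs_bounded c B -> cabs (csum c) <= B.
Proof. by move=> /(csum_tail 0); rewrite !big_ord0 !subr0. Qed.

Lemma abs_bounded_tail c B e : abs_bounded c B -> 0 < e -> exists N,
  forall M, \sum_(N <= l < M) cabs (c l) < e.
Proof.
move=> hB e0.
have [s hs] : exists s : R, forall e : R, 0 < e -> exists N, forall M, (N <= M)%N ->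
    `|\sum_(l < M) cabs (c l) - s| < e.
  apply: (@real_abs_series (fun l => cabs (c l)) B) => N; apply: le_trans (hB N).
  by apply: ler_sum => l _; rewrite ger0_norm ?cabs_ge0.
have e20 : 0 < e / 2 by lra.
have [N hN] := hs _ e20; exists N => M.
have [NM|MN] := leqP N M; last by rewrite big_geq // ltnW.
have := hN _ NM; have := hN _ (leqnn N).
rewrite (sum_ord_split (fun l => cabs (c l)) NM) !ltr_norml.
by move=> /andP[? _] /andP[_ ?]; lra.
Qed.

Lemma eq_csum c d : c =1 d -> csum c = csum d.
Proof. by move=> /funext ->. Qed.

Lemma abs_boundedD c d B B' : abs_bounded c B -> abs_bounded d B' ->
  abs_bounded (fun l => c l + d l) (B + B').
Proof.
move=> h1 h2 N; apply: le_trans (lerD (h1 N) (h2 N)); rewrite -big_split /=.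
by apply: ler_sum => l _; exact: cabsD.
Qed.

Lemma csumD c d B B' : abs_bounded c B -> abs_bounded d B' ->
  csum (fun l => c l + d l) = csum c + csum d.
Proof.
move=> h1 h2; apply: csum_unique => e e0; have e20 : 0 < e / 2 by lra.
have [N1 k1] := csumP h1 e20; have [N2 k2] := csumP h2 e20.
exists (maxn N1 N2) => M; rewrite geq_max => /andP[/k1 a1 /k2 a2].
rewrite big_split /= opprD addrACA.
by apply: (le_lt_trans (cabsD _ _)); lra.
Qed.

Lemma abs_boundedZ z c B : abs_bounded c B ->
  abs_bounded (fun l => z * c l) (cabs z * B).
Proof.
move=> h N; under eq_bigr do rewrite cabsM; rewrite -mulr_sumr.
by rewrite ler_wpM2l ?cabs_ge0.
Qed.

Lemma csumZ z c B : abs_bounded c B -> csum (fun l => z * c l) = z * csum c.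
Proof.
move=> h; apply: csum_unique => e e0.
have z0 := cabs_ge0 z.
have e20 : 0 < e / (cabs z + 1) by rewrite divr_gt0 //; lra.
have [N k1] := csumP h e20; exists N => M /k1 a1.
rewrite -mulr_sumr -mulrBr cabsM.
apply: (@le_lt_trans _ _ ((cabs z + 1) * cabs (\sum_(i < M) c i - csum c))).
  by rewrite ler_wpM2r ?cabs_ge0 //; lra.
by rewrite mulrC -ltr_pdivlMr //; lra.
Qed.

Lemma abs_bounded_sum (I : finType) (c : I -> nat -> C) (B : I -> R) :
  (forall i, abs_bounded (c i) (B i)) ->
  abs_bounded (fun l => \sum_i c i l) (\sum_i B i).
Proof.
move=> h N.
apply: (@le_trans _ _ (\sum_(l < N) \sum_i cabs (c i l))).
  by apply: ler_sum => l _; exact: cabs_sum.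
by rewrite exchange_big /=; apply: ler_sum => i _; exact: h.
Qed.

Lemma csum_sum m (c : 'I_m -> nat -> C) (B : 'I_m -> R) :
  (forall i, abs_bounded (c i) (B i)) ->
  csum (fun l => \sum_i c i l) = \sum_i csum (c i).
Proof.
elim: m c B => [|m IH] c B h.
  rewrite big_ord0; apply: csum_unique => e e0; exists 0%N => M _.
  by rewrite big1 ?subr0 ?cabs0 // => l _; rewrite big_ord0.
rewrite big_ord_recr /= -(IH _ (fun i => B (widen_ord (leqnSn m) i))) //.
have hs := @abs_bounded_sum _ _ (fun i => B (widen_ord (leqnSn m) i)) (fun i => h (widen_ord (leqnSn m) i)).
rewrite -(csumD hs (h ord_max)); apply: eq_csum => l.
by rewrite big_ord_recr.
Qed.

Lemma csum_delta c : (forall l, (0 < l)%N -> c l = 0) -> csum c = c 0%N.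
Proof.
move=> h; apply: csum_unique => e e0; exists 1%N => -[//|M] _.
rewrite big_ord_recl /= big1 ?addr0 ?subrr ?cabs0 // => l _.
by rewrite h.
Qed.

Lemma csum_recl c B : abs_bounded c B ->
  csum c = c 0%N + csum (fun l => c l.+1).
Proof.
move=> hB.
have hB' : abs_bounded (fun l => c l.+1) B.
  move=> N; apply: le_trans (hB N.+1); rewrite big_ord_recl /=.
  by rewrite lerDr cabs_ge0.
apply: csum_unique => e e0; have [N hN] := csumP hB' e0.
exists N.+1 => -[//|M] /hN; rewrite big_ord_recl /=.
by congr (cabs _ < _); ring.
Qed.

Definition cprod (c d : nat -> C) (l : nat) : C := \sum_(i < l.+1) c i * d (l - i)%N.

Lemma sum_conv (V : pzSemiRingType) (f g : nat -> V) N :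
  \sum_(l < N) \sum_(i < l.+1) f i * g (l - i)%N =
  \sum_(i < N) f i * \sum_(j < N - i) g j.
Proof.
elim: N => [|N IH]; first by rewrite !big_ord0.
rewrite big_ord_recr /= IH [RHS]big_ord_recr /= subSnn big_ord1.
rewrite big_ord_recr /= subnn addrA; congr (_ + _).
rewrite -big_split /=; apply: eq_bigr => i _.
by rewrite subSn ?big_ord_recr /= ?mulrDr // ltnW.
Qed.

Lemma abs_bounded_conv c d B B' : abs_bounded c B -> abs_bounded d B' ->
  abs_bounded (cprod c d) (B * B').
Proof.
move=> h1 h2 N.
apply: (@le_trans _ _ (\sum_(l < N) \sum_(i < l.+1) cabs (c i) * cabs (d (l - i)%N))).
  apply: ler_sum => l _; apply: le_trans (cabs_sum _ _ _) _.
  by under eq_bigr do rewrite cabsM.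
rewrite (sum_conv (fun i => cabs (c i)) (fun i => cabs (d i))).
apply: (@le_trans _ _ (\sum_(i < N) cabs (c i) * B')).
  by apply: ler_sum => i _; rewrite ler_wpM2l ?cabs_ge0.
by rewrite -mulr_suml ler_wpM2r // (abs_bounded_ge0 h2).
Qed.

(** The N-th partial sum of the product is sum_i c_i D_(N-i), with D the partial sums of [d]. For i
    below [p] the inner sum is close to its limit; from [p] on the tail of [c] is small while the
    inner remainder stays bounded by [B']. *)
Lemma csum_conv c d B B' : abs_bounded c B -> abs_bounded d B' ->
  csum (cprod c d) = csum c * csum d.
Proof.
move=> h1 h2; apply: csum_unique => e e0.
have B0 := abs_bounded_ge0 h1; have B'0 := abs_bounded_ge0 h2.
pose K := B + 2 * B' + 2.
have K0 : 0 < K by rewrite /K; lra.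
have e'0 : 0 < e / K by rewrite divr_gt0.
have [q hq] := csumP h2 e'0; have [p hp] := abs_bounded_tail h1 e'0.
have [q' hq'] := csumP h1 e'0.
exists (maxn q' (p + q)%N) => N; rewrite geq_max => /andP[N1 N2].
have pN : (p <= N)%N by lia.
rewrite (sum_conv c d).
have -> : \sum_(i < N) c i * \sum_(j < N - i) d j - csum c * csum d =
   \sum_(i < N) c i * (\sum_(j < N - i) d j - csum d) + (\sum_(i < N) c i - csum c) * csum d.
  rewrite mulrBl mulr_suml addrA -big_split /=; congr (_ - _).
  by apply: eq_bigr => i _; rewrite mulrBr subrK.
apply: (le_lt_trans (cabsD _ _)).
have a1 : cabs ((\sum_(i < N) c i - csum c) * csum d) <= e / K * B'.
  rewrite cabsM; apply: ler_pM; rewrite ?cabs_ge0 //; first exact/ltW/hq'.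
  exact: cabs_csum.
have a2 : \sum_(i < N) cabs (c i) * cabs (\sum_(j < N - i) d j - csum d)
    <= e / K * B + e / K * B'.
  rewrite -(big_mkord xpredT (fun i => cabs (c i) * cabs (\sum_(j < N - i) d j - csum d))).
  rewrite (big_cat_nat (leq0n _) pN) //=; apply: lerD.
    rewrite big_nat; apply: (@le_trans _ _ (\sum_(0 <= i < p) cabs (c i) * (e / K))).
      rewrite [leRHS]big_nat; apply: ler_sum => i /andP[_ ip].
      by rewrite ler_wpM2l ?cabs_ge0 //; apply/ltW/hq; lia.
    rewrite -mulr_suml mulrC ler_wpM2l ?(ltW e'0) //.
    by rewrite big_mkord.
  apply: (@le_trans _ _ (\sum_(p <= i < N) cabs (c i) * B')).
    apply: ler_sum => i _; rewrite ler_wpM2l ?cabs_ge0 // cabsBC.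
    apply: le_trans (csum_tail _ h2) _.
    by rewrite gerBl sumr_ge0 // => j _; exact: cabs_ge0.
  by rewrite -mulr_suml ler_wpM2r // ltW.
have a3 : cabs (\sum_(i < N) c i * (\sum_(j < N - i) d j - csum d)) <= e / K * B + e / K * B'.
  apply: le_trans (cabs_sum _ _ _) _.
  by under eq_bigr do rewrite cabsM.
have EK : e = e / K * K by rewrite divfK // lt0r_neq0.
have KE : K = B + 2 * B' + 2 by [].
move: (e / K) EK e'0 a1 a2 a3 => E EK E0 a1 _ a3; rewrite KE in EK; lra.
Qed.

End Series.

(** * Complex exponential, power series and Laurent series *)

Section ComplexExp.
Variable R : realType.
Local Notation C := R[i].
Implicit Types (z w : C) (x y : R).

Lemma cexpE z : cexp z = (expR (complex.Re z))%:C%C * Complex (cos (complex.Im z)) (sin (complex.Im z)).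
Proof. by case: z. Qed.

Lemma cexpD z w : cexp (z + w) = cexp z * cexp w.
Proof.
case: z w => [a b] [c d].
apply/eqP; rewrite eq_complex /= expRD cosD sinD.
by apply/andP; split; apply/eqP; ring.
Qed.

Lemma cexp0 : cexp (0 : C) = 1.
Proof. by apply/eqP; rewrite eq_complex /= expR0 cos0 sin0 !mul0r mulr1 mulr0 subr0 addr0 !eqxx. Qed.

Lemma cexpMn z n : cexp (z *+ n) = cexp z ^+ n.
Proof. by elim: n => [|n IH]; rewrite ?mulr0n ?cexp0 // mulrS exprS cexpD IH. Qed.

Lemma cabs_cis x : cabs (Complex (cos x) (sin x)) = 1.
Proof. by rewrite cabs_Complex cos2Dsin2 sqrtr1. Qed.

Lemma cabs_cexp z : cabs (cexp z) = expR (complex.Re z).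
Proof. by rewrite cexpE cabsM cabs_cis mulr1 cabs_real ger0_norm ?expR_ge0. Qed.

Lemma cexp_neq0 z : cexp z != 0.
Proof. by rewrite -cabs_gt0 cabs_cexp expR_gt0. Qed.

Lemma cexpN z : cexp (- z) = (cexp z)^-1.
Proof.
by apply: (mulfI (cexp_neq0 z)); rewrite -cexpD subrr cexp0 divff ?cexp_neq0.
Qed.

Lemma cabs_i : cabs ('i : C) = 1.
Proof. by rewrite -complexiE /cabs expr0n expr1n add0r sqrtr1. Qed.

Lemma cexp_cis x : cexp (Complex 0 x) = Complex (cos x) (sin x).
Proof. by rewrite cexpE /= expR0 mul1r. Qed.

Lemma cis2pi : Complex (cos (2 * pi)) (sin (2 * pi)) = 1 :> C.
Proof. by rewrite mulr_natl cos2pi sin2pi. Qed.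

Lemma cos_lt1 x : 0 < x -> x < 2 * pi -> cos x < 1.
Proof.
move=> x0 x1; have -> : x = (x / 2) *+ 2 by rewrite -mulr_natr divfK.
have : 0 < sin (x / 2) by apply: sin_gt0_pi; rewrite ltr_pdivlMr // ltr_pdivrMr //; apply/andP; split; lra.
move=> s0; rewrite cos_mulr2n cos2sin2.
have : 0 < sin (x / 2) ^+ 2 by rewrite exprn_gt0.
by rewrite mulr2n; lra.
Qed.

Definition unity N : C := cexp (Complex 0 (2 * pi / N%:R)).

Lemma cabs_unity N : cabs (unity N) = 1.
Proof. by rewrite cabs_cexp expR0. Qed.

Lemma unityX N d : unity N ^+ d = cexp (Complex 0 (2 * pi / N%:R * d%:R)).
Proof.
rewrite -cexpMn; congr cexp; elim: d => [|d IH]; first by rewrite mulr0n mulr0.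
have -> : 2 * pi / N%:R * d.+1%:R = 2 * pi / N%:R * d%:R + 2 * pi / N%:R :> R.
  by rewrite -(natr1 d); ring.
rewrite mulrSr IH; apply/eqP.
by rewrite eq_complex /= addr0 !eqxx.
Qed.

Lemma unityN N : (0 < N)%N -> unity N ^+ N = 1.
Proof.
move=> N0; rewrite unityX divfK; last by rewrite pnatr_eq0 -lt0n.
by rewrite cexp_cis cis2pi.
Qed.

Lemma unity_neq1 N d : (0 < d < N)%N -> unity N ^+ d != 1.
Proof.
move=> /andP[d0 dN]; rewrite unityX cexp_cis eq_complex /=; apply/nandP; left.
have N0 : 0 < N%:R :> R by rewrite ltr0n; apply: leq_trans dN.
rewrite lt_eqF // cos_lt1 //.
  by rewrite !mulr_gt0 ?pi_gt0 ?invr_gt0 // ltr0n.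
rewrite mulrAC -mulrA gtr_pMr ?mulr_gt0 ?pi_gt0 //.
by rewrite ltr_pdivrMr // mul1r ltr_nat.
Qed.

Lemma sum_unity N e : (0 < N)%N -> unity N ^+ e != 1 -> \sum_(j < N) unity N ^+ (j * e) = 0.
Proof.
move=> N0 h; have := subrX1 (unity N ^+ e) N; rewrite -exprM mulnC exprM unityN // expr1n subrr.
move/esym/eqP; rewrite mulf_eq0 subr_eq0 (negbTE h) /= => /eqP E.
by rewrite -[RHS]E; apply: eq_bigr => j _; rewrite -exprM mulnC.
Qed.

End ComplexExp.

(** * Power series with a weighted l^1 norm *)

Section PowerSeries.
Variable R : realType.
Local Notation C := R[i].
Implicit Types (c d : nat -> C) (t : C) (rho sigma B M u : R).

(** Weighted l^1 norm at radius [rho]. Unlike a supremum over a circle it is submultiplicative by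
    mere rearrangement of sums, and it is monotone in the radius term by term. *)
Definition bdd c rho B := forall N : nat, \sum_(l < N) cabs (c l) * rho ^+ l <= B.

Definition ps c t : C := csum (fun l => c l * t ^+ l).

Lemma bdd_ge0 c rho B : bdd c rho B -> 0 <= B.
Proof. by move=> /(_ 0%N); rewrite big_ord0. Qed.

Lemma bdd_abs c rho B t : cabs t <= rho -> bdd c rho B ->
  abs_bounded (fun l => c l * t ^+ l) B.
Proof.
move=> tr h N; apply: le_trans (h N); apply: ler_sum => l _.
rewrite cabsM cabsX ler_wpM2l ?cabs_ge0 // lerXn2r ?nnegrE ?cabs_ge0 //.
exact: le_trans (cabs_ge0 _) tr.
Qed.

Lemma bddW c rho sigma B : 0 <= sigma -> sigma <= rho -> bdd c rho B -> bdd c sigma B.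
Proof.
move=> s0 sr h N; apply: le_trans (h N); apply: ler_sum => l _.
by rewrite ler_wpM2l ?cabs_ge0 // lerXn2r ?nnegrE // (le_trans s0).
Qed.

Lemma bdd_leB c rho B B' : B <= B' -> bdd c rho B -> bdd c rho B'.
Proof. by move=> BB h N; apply: le_trans (h N) BB. Qed.

Lemma bddE c rho B : 0 <= rho ->
  bdd c rho B <-> abs_bounded (fun l => c l * (rho%:C%C) ^+ l) B.
Proof.
move=> r0; have E l : cabs (c l * (rho%:C%C) ^+ l) = cabs (c l) * rho ^+ l.
  by rewrite cabsM cabsX cabs_real ger0_norm.
by split=> h N; [under eq_bigr do rewrite E | have := h N; under eq_bigr do rewrite E].
Qed.

Lemma convX c d t l : cprod (fun l => c l * t ^+ l) (fun l => d l * t ^+ l) l = cprod c d l * t ^+ l.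
Proof.
rewrite /cprod mulr_suml; apply: eq_bigr => i _.
have -> : t ^+ l = t ^+ i * t ^+ (l - i) by rewrite -exprD subnKC // -ltnS.
by ring.
Qed.

Lemma bdd_conv c d rho B B' : 0 <= rho -> bdd c rho B -> bdd d rho B' ->
  bdd (cprod c d) rho (B * B').
Proof.
move=> r0 /(bddE _ _ r0) h /(bddE _ _ r0) h'; apply/(bddE _ _ r0).
by move=> N; under eq_bigr do rewrite -convX; exact: abs_bounded_conv.
Qed.

Lemma ps_conv c d rho B B' t : cabs t <= rho -> bdd c rho B -> bdd d rho B' ->
  ps (cprod c d) t = ps c t * ps d t.
Proof.
move=> tr h h'; rewrite -(csum_conv (bdd_abs tr h) (bdd_abs tr h')).
by apply: eq_csum => l; rewrite convX.
Qed.

Lemma cabs_ps c rho B t : cabs t <= rho -> bdd c rho B -> cabs (ps c t) <= B.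
Proof. by move=> tr h; apply: cabs_csum (bdd_abs tr h). Qed.

Lemma bddD c d rho B B' : 0 <= rho -> bdd c rho B -> bdd d rho B' ->
  bdd (fun l => c l + d l) rho (B + B').
Proof.
move=> r0 h h' N; apply: le_trans (lerD (h N) (h' N)); rewrite -big_split /=.
by apply: ler_sum => l _; rewrite -mulrDl ler_wpM2r ?exprn_ge0 // cabsD.
Qed.

Lemma psD c d rho B B' t : cabs t <= rho -> bdd c rho B -> bdd d rho B' ->
  ps (fun l => c l + d l) t = ps c t + ps d t.
Proof.
move=> tr h h'; rewrite -(csumD (bdd_abs tr h) (bdd_abs tr h')).
by apply: eq_csum => l; rewrite mulrDl.
Qed.

Lemma bddZ z c rho B : bdd c rho B -> bdd (fun l => z * c l) rho (cabs z * B).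
Proof.
move=> h N; under eq_bigr do rewrite cabsM -mulrA; rewrite -mulr_sumr.
by rewrite ler_wpM2l ?cabs_ge0.
Qed.

Lemma psZ z c rho B t : cabs t <= rho -> bdd c rho B -> ps (fun l => z * c l) t = z * ps c t.
Proof.
move=> tr h; rewrite -(csumZ z (bdd_abs tr h)).
by apply: eq_csum => l; rewrite mulrA.
Qed.

Lemma bdd_sum m (c : 'I_m -> nat -> C) rho (B : 'I_m -> R) : 0 <= rho ->
  (forall i, bdd (c i) rho (B i)) -> bdd (fun l => \sum_i c i l) rho (\sum_i B i).
Proof.
move=> r0 h N; apply: (@le_trans _ _ (\sum_(l < N) \sum_i cabs (c i l) * rho ^+ l)).
  by apply: ler_sum => l _; rewrite -mulr_suml ler_wpM2r ?exprn_ge0 // cabs_sum.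
by rewrite exchange_big /=; apply: ler_sum => i _; exact: h.
Qed.

Lemma ps_sum m (c : 'I_m -> nat -> C) rho (B : 'I_m -> R) t : cabs t <= rho ->
  (forall i, bdd (c i) rho (B i)) -> ps (fun l => \sum_i c i l) t = \sum_i ps (c i) t.
Proof.
move=> tr h; rewrite -(csum_sum (fun i => bdd_abs tr (h i))).
by apply: eq_csum => l; rewrite mulr_suml.
Qed.

Lemma ps_recl c rho B t : cabs t <= rho -> bdd c rho B ->
  ps c t = c 0%N + t * ps (fun l => c l.+1) t.
Proof.
move=> tr h; rewrite /ps (csum_recl (bdd_abs tr h)) expr0 mulr1; congr (_ + _).
have h' : abs_bounded (fun l => t * (c l.+1 * t ^+ l)) B.
  move=> N; apply: le_trans (bdd_abs tr h N.+1); rewrite big_ord_recl /=.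
  rewrite (eq_bigr (fun l : 'I_N => cabs (c l.+1 * t ^+ l.+1))) ?lerDr ?cabs_ge0 // => l _.
  by rewrite exprS mulrCA.
have [->|t0] := eqVneq t 0.
  rewrite mul0r (@csum_delta _ (fun l => c l.+1 * 0 ^+ l.+1)) ?expr0n ?mulr0 // => l _.
  by rewrite expr0n mulr0.
have h2 : abs_bounded (fun l => c l.+1 * t ^+ l) (cabs t^-1 * B).
  move=> N; have := abs_boundedZ t^-1 h' N.
  by under eq_bigr do rewrite mulKf //.
by rewrite -(csumZ t h2); apply: eq_csum => l; rewrite exprS mulrCA.
Qed.

Definition cshift (d : nat) c : nat -> C := fun l => if (l < d)%N then 0 else c (l - d)%N.

Lemma shift0 c : cshift 0 c = c.
Proof. by apply/funext => l; rewrite /cshift subn0. Qed.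

Lemma sum_shift (d N : nat) c rho :
  \sum_(l < N) cabs (cshift d c l) * rho ^+ l = rho ^+ d * \sum_(l < N - d) cabs (c l) * rho ^+ l.
Proof.
have [Nd|dN] := leqP N d.
  rewrite (eqP Nd) big_ord0 mulr0 big1 // => l _.
  by rewrite /cshift (leq_trans (ltn_ord l) Nd) cabs0 mul0r.
rewrite (sum_ord_split (fun l => cabs (cshift d c l) * rho ^+ l) (ltnW dN)) big1 ?add0r => [|l _]; last first.
  by rewrite /cshift ltn_ord cabs0 mul0r.
rewrite -{1}[d]add0n big_addn big_mkord mulr_sumr; apply: eq_bigr => l _.
by rewrite /cshift ltnNge leq_addl /= addnK exprD; ring.
Qed.

Lemma bdd_shift (d : nat) c rho B : 0 <= rho -> bdd c rho B -> bdd (cshift d c) rho (rho ^+ d * B).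
Proof. by move=> r0 h N; rewrite sum_shift ler_wpM2l ?exprn_ge0. Qed.

Lemma bdd_unshift (d : nat) c rho B : 0 < rho -> bdd (cshift d c) rho B -> bdd c rho (rho ^- d * B).
Proof.
move=> r0 h N; have := h (N + d)%N; rewrite sum_shift addnK.
by rewrite [rho ^- d * B]mulrC ler_pdivlMr ?exprn_gt0 // mulrC.
Qed.

Lemma ps_shift (d : nat) c rho B t : cabs t <= rho -> bdd c rho B -> ps (cshift d c) t = t ^+ d * ps c t.
Proof.
move=> tr h; elim: d => [|d IH]; first by rewrite shift0 mul1r.
have r0 : 0 <= rho := le_trans (cabs_ge0 t) tr.
rewrite (ps_recl tr (bdd_shift d.+1 r0 h)) {1}/cshift /= add0r exprS -mulrA -IH; congr (_ * _).
Qed.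

Lemma csum_tail_small c B N (e : R) : abs_bounded c B ->
  (forall M : nat, \sum_(N <= l < M) cabs (c l) <= e) -> cabs (csum c - \sum_(l < N) c l) <= e.
Proof.
move=> h he; have h' : abs_bounded c (\sum_(l < N) cabs (c l) + e).
  move=> M; have [MN|NM] := leqP M N.
    have e0 : 0 <= e by have := he N; rewrite big_geq.
    rewrite (sum_ord_split (fun l => cabs (c l)) MN) -addrA lerDl addr_ge0 //.
    by apply: sumr_ge0 => l _; exact: cabs_ge0.
  by rewrite (sum_ord_split (fun l => cabs (c l)) (ltnW NM)) lerD2l.
by apply: le_trans (csum_tail N h') _; rewrite addrC addKr.
Qed.

(* Averaging the partial sums over the N-th roots of unity isolates one coefficient. *)
Lemma cauchy_estimate c rho B sigma M l : 0 < sigma -> sigma <= rho -> bdd c rho B ->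
  (forall t, cabs t = sigma -> cabs (ps c t) <= M) -> cabs (c l) * sigma ^+ l <= M.
Proof.
move=> s0 sr h hM; apply/ler_addgt0Pr => e e0.
have hs := bddW (ltW s0) sr h.
have [N0 hN0] := abs_bounded_tail ((bddE _ _ (ltW s0)).1 hs) e0.
pose N := maxn N0 l.+1.
have N00 : (0 < N)%N by rewrite leq_max orbT.
have lN : (l < N)%N by rewrite leq_max ltnSn orbT.
pose w := unity R N.
pose P (j : nat) := \sum_(i < N) c i * (sigma%:C%C * w ^+ j) ^+ i.
have abst j : cabs (sigma%:C%C * w ^+ j) = sigma.
  by rewrite cabsM cabsX cabs_unity expr1n mulr1 cabs_real ger0_norm // ltW.
have hP j : cabs (P j) <= M + e.
  have -> : P j = ps c (sigma%:C%C * w ^+ j) - (ps c (sigma%:C%C * w ^+ j) - P j) by ring.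
  apply: le_trans (cabsD _ _) _; rewrite cabsN; apply: lerD; first exact: hM.
  have tj : cabs (sigma%:C%C * w ^+ j) <= sigma by rewrite abst.
  apply: (csum_tail_small (bdd_abs tj hs)) => K.
  apply: le_trans (ltW (hN0 K)).
  have [NK|KN] := leqP N K; last first.
    by rewrite big_geq ?(ltnW KN) // sumr_ge0 // => i _; exact: cabs_ge0.
  rewrite [leRHS](big_cat_nat (leq_maxl N0 l.+1) NK) /=.
  apply: (@le_trans _ _ (\sum_(N <= i < K) cabs (c i * sigma%:C%C ^+ i))).
    apply: ler_sum => i _; rewrite !cabsM !cabsX abst.
    by rewrite cabs_real ger0_norm // ltW.
  by rewrite lerDr sumr_ge0 // => i _; exact: cabs_ge0.
(* The factor w^(j (N - l)) stands for w^(-j l) without negative exponents; summing over j keeps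
   only i = l, because the indices below N are distinct modulo N. *)
have E : \sum_(j < N) P j * w ^+ (j * (N - l)) = N%:R * (c l * sigma%:C%C ^+ l).
  under eq_bigr do rewrite mulr_suml.
  rewrite exchange_big /= (bigD1 (Ordinal lN)) //= [X in _ + X]big1 ?addr0.
    rewrite (eq_bigr (fun=> c l * sigma%:C%C ^+ l)); first by rewrite sumr_const card_ord mulr_natl.
    move=> j _; rewrite exprMn -!mulrA; congr (_ * _); rewrite -[RHS]mulr1; congr (_ * _).
    by rewrite -exprM -exprD -mulnDr subnKC ?(ltnW lN) // mulnC exprM unityN // expr1n.
  move=> i il; transitivity (c i * sigma%:C%C ^+ i * \sum_(j < N) w ^+ (j * (i + (N - l)))).
    rewrite mulr_sumr; apply: eq_bigr => j _.
    by rewrite exprMn mulnDr exprD -exprM; ring.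
  rewrite sum_unity ?mulr0 //.
  have il' : nat_of_ord i != l by [].
  have iN := ltn_ord i.
  have [ltil|ltli|eqil] := ltngtP i l; last by rewrite eqil eqxx in il'.
    by apply: unity_neq1; lia.
  have -> : (i + (N - l) = N + (i - l))%N by lia.
  by rewrite exprD unityN // mul1r; apply: unity_neq1; lia.
have NR : 0 < N%:R :> R by rewrite ltr0n.
have : cabs (N%:R * (c l * sigma%:C%C ^+ l)) <= N%:R * (M + e).
  rewrite -E; apply: le_trans (cabs_sum _ _ _) _.
  apply: (@le_trans _ _ (\sum_(j < N) (M + e))); last by rewrite sumr_const card_ord mulr_natl.
  by apply: ler_sum => j _; rewrite cabsM cabsX cabs_unity expr1n mulr1.
rewrite cabsM cabs_nat ler_pM2l // cabsM cabsX cabs_real ger0_norm //.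
exact: ltW.
Qed.

(** Cauchy's estimate with bound 0 on one small circle. *)
Lemma ps_eq0 c rho B (e : R) : 0 < rho -> bdd c rho B -> 0 < e ->
  (forall t, 0 < cabs t < e -> ps c t = 0) -> forall l, c l = 0.
Proof.
move=> r0 h e0 h0 l; pose sigma := Num.min rho (e / 2).
have s0 : 0 < sigma by rewrite lt_min r0 divr_gt0.
have sr : sigma <= rho by rewrite ge_min lexx.
have se : sigma < e by apply: (@le_lt_trans _ _ (e / 2)); [rewrite ge_min lexx orbT | lra].
have : cabs (c l) * sigma ^+ l <= 0.
  apply: (@cauchy_estimate c rho B sigma 0 l s0 sr h) => t ts.
  by rewrite h0 ?cabs0 // ts s0 se.
rewrite pmulr_lle0 ?exprn_gt0 // => hc; apply/eqP.
by rewrite -cabs_eq0 eq_le hc cabs_ge0.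
Qed.

Lemma ps_inj c d rho rho' B B' (e : R) : 0 < rho -> bdd c rho B -> 0 < rho' -> bdd d rho' B' -> 0 < e ->
  (forall t, 0 < cabs t < e -> ps c t = ps d t) -> c = d.
Proof.
move=> r0 h r0' h' e0 E; apply/funext => l; apply/subr0_eq.
pose s := Num.min rho rho'; have s0 : 0 < s by rewrite lt_min r0 r0'.
have hc : bdd c s B by apply: bddW h; rewrite ?ge_min ?lexx // ltW.
have hd : bdd (fun l => -1 * d l) s (cabs (-1 : C) * B').
  by apply: bddZ; apply: bddW h'; rewrite ?ge_min ?lexx ?orbT // ltW.
have e0' : 0 < Num.min e s by rewrite lt_min e0 s0.
have := @ps_eq0 (fun l => c l + -1 * d l) s _ _ s0 (bddD (ltW s0) hc hd) e0'.
move=> /(_ _ l); rewrite mulN1r; apply=> t /andP[t0]; rewrite lt_min => /andP[te ts].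
rewrite (psD (ltW ts) hc hd) (psZ _ (ltW ts) (bddW (ltW s0) _ h')); last by rewrite ge_min lexx orbT.
by rewrite mulN1r E ?subrr // t0 te.
Qed.


Lemma psX (d : nat) t : ps (fun l => (l == d)%:R) t = t ^+ d.
Proof.
apply: csum_unique => e e0; exists d.+1 => M dM.
rewrite (bigD1 (Ordinal dM)) //= eqxx mul1r big1 ?addr0 ?subrr ?cabs0 // => i id.
by rewrite (_ : nat_of_ord i == d = false) ?mul0r //; exact: negbTE.
Qed.

End PowerSeries.

Lemma le_int_nat (r r' : int) : (r <= r')%R -> exists d : nat, r' = r + d%:Z.
Proof.
by move=> le; exists `|(r' - r)%R|%N; rewrite gez0_abs ?subr_ge0 // addrCA subrr addr0.
Qed.

(** * Laurent expansions, their norm and their order at 0 *)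

Section Laurent.
Variable R : realType.
Local Notation C := R[i].
Implicit Types (c : nat -> C) (t : C) (rho sigma B u v : R) (h : C -> C) (r : int).

(** The pair (r, c) is not unique: raising [r] by d and shifting [c] by d gives the same function,
    and [r] need not be the exact pole order. *)
Definition laurent r c t : C := t ^ (- r) * ps c t.

(* The sum of |coefficient| rho^exponent over the Laurent expansion of h is at most u. *)
Definition nbl rho h u := exists (r : int) (c : nat -> C),
  bdd c rho (u * rho ^ r) /\ forall t, 0 < cabs t < rho -> h t = laurent r c t.

Lemma laurent_shift (d : nat) r c rho B t : t != 0 -> cabs t <= rho -> bdd c rho B ->
  laurent (r + d%:Z) (cshift d c) t = laurent r c t.
Proof.
move=> t0 tr h; rewrite /laurent (ps_shift _ tr h) opprD expfzDr // -mulrA; congr (_ * _).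
by rewrite mulrA -exprnN mulVf ?mul1r // expf_neq0.
Qed.

Variable rho : R.
Hypothesis rho0 : 0 < rho.

Lemma rhoz_gt0 r : 0 < rho ^ r. Proof. exact: exprz_gt0. Qed.

Lemma nbl_ge0 h u : nbl rho h u -> 0 <= u.
Proof. by move=> [r [c [/bdd_ge0 + _]]]; rewrite pmulr_lge0 // rhoz_gt0. Qed.

Lemma nbl_le h u v : u <= v -> nbl rho h u -> nbl rho h v.
Proof.
move=> uv [r [c [h1 h2]]]; exists r, c; split=> //; apply: bdd_leB h1.
by rewrite ler_wpM2r // ltW // rhoz_gt0.
Qed.

Lemma nbl_ext h h' u : (forall t, 0 < cabs t < rho -> h t = h' t) -> nbl rho h u -> nbl rho h' u.
Proof. by move=> E [r [c [h1 h2]]]; exists r, c; split=> // t tr; rewrite -E // h2. Qed.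

Lemma nbl_cst z : nbl rho (fun=> z) (cabs z).
Proof.
exists 0, (fun l => z * (l == 0%N)%:R); split=> [N|t tr].
  rewrite expr0z mulr1; case: N => [|N]; first by rewrite big_ord0 cabs_ge0.
  rewrite big_ord_recl big1 => [|i _]; last by rewrite mulr0 cabs0 mul0r.
  by rewrite addr0 /= !mulr1.
rewrite /laurent oppr0 expr0z mul1r /ps (@csum_delta _ (fun l => z * (l == 0%N)%:R * t ^+ l)) ?mulr1 //.
by case=> // l _; rewrite mulr0 mul0r.
Qed.

Lemma nbl_lift (d : nat) r c u : bdd c rho (u * rho ^ r) ->
  bdd (cshift d c) rho (u * rho ^ (r + d%:Z)).
Proof.
move=> h; have := bdd_shift d (ltW rho0) h; apply: bdd_leB.
by rewrite expfzDr ?gt_eqF // -exprnP [rho ^ r * _]mulrC mulrCA.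
Qed.

Lemma nblD h h' u v : nbl rho h u -> nbl rho h' v -> nbl rho (fun t => h t + h' t) (u + v).
Proof.
move=> [r [c [h1 h2]]] [r' [c' [h1' h2']]].
wlog le : r c r' c' h h' u v h1 h2 h1' h2' / (r <= r')%R.
  move=> W; have [?|/ltW ?] := leP r r'; first exact: (W r c r' c').
  have := W r' c' r c h' h v u h1' h2' h1 h2; rewrite (addrC v).
  move=> W'; apply: nbl_ext (W' _) => // t _; exact: addrC.
have [d Ed] := le_int_nat le.
subst r'; have h1s := nbl_lift d h1.
exists (r + d%:Z), (fun l => cshift d c l + c' l); split.
  by rewrite mulrDl; apply: bddD => //; exact: ltW.
move=> t tr; have /andP[t0 /ltW tr'] := tr.
rewrite h2 // h2' // -(laurent_shift d r _ tr' h1) ?/laurent -?cabs_gt0 // -mulrDr.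
by rewrite (psD tr' h1s h1').
Qed.

Lemma nblM h h' u v : nbl rho h u -> nbl rho h' v -> nbl rho (fun t => h t * h' t) (u * v).
Proof.
move=> [r [c [h1 h2]]] [r' [c' [h1' h2']]].
exists (r + r'), (cprod c c'); split.
  have := bdd_conv (ltW rho0) h1 h1'; apply: bdd_leB.
  by rewrite expfzDr ?gt_eqF // le_eqVlt; apply/orP; left; apply/eqP; ring.
move=> t tr; have /andP[t0 /ltW tr'] := tr.
rewrite h2 // h2' // /laurent (ps_conv tr' h1 h1') opprD expfzDr -?cabs_gt0 //.
by ring.
Qed.

Lemma laurent_inj r c r' c' sigma sigma' B B' (e : R) : 0 < sigma -> bdd c sigma B ->
  0 < sigma' -> bdd c' sigma' B' -> 0 < e ->
  (forall t, 0 < cabs t < e -> laurent r c t = laurent r' c' t) ->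
  forall d : nat, r' = r + d%:Z -> c' = cshift d c.
Proof.
move=> s0 h s0' h' e0 E d Ed; subst r'.
have e0' : 0 < Num.min e sigma by rewrite lt_min e0 s0.
symmetry; apply: (ps_inj s0 (bdd_shift d (ltW s0) h) s0' h' e0') => t /andP[t0].
rewrite lt_min => /andP[te ts].
have tn0 : t != 0 by rewrite -cabs_gt0.
have := E t; rewrite t0 te => /(_ isT); rewrite -(laurent_shift d r tn0 (ltW ts) h).
by apply: mulfI; rewrite expfz_neq0.
Qed.

(** The norm does not depend on the representation: expansions that agree near 0 are shifts of one
    another, and a shift by d multiplies both sides of the bound by rho^d. A bound on a function
    thus becomes a bound on prescribed coefficients. *)
Lemma nbl_bdd h u r c sigma B (e : R) : nbl rho h u -> 0 < sigma -> bdd c sigma B -> 0 < e ->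
  (forall t, 0 < cabs t < e -> h t = laurent r c t) -> bdd c rho (u * rho ^ r).
Proof.
move=> [r' [c' [h1 h2]]] s0 hc e0 E.
have e0' : 0 < Num.min e rho by rewrite lt_min e0 rho0.
have E' t : 0 < cabs t < Num.min e rho -> laurent r c t = laurent r' c' t.
  by rewrite lt_min => /and3P[t0 te tr]; rewrite -E ?t0 // h2 // t0.
have [le|/ltW le] := leP r r'.
  have [d Ed] := le_int_nat le.
  have Ec := laurent_inj s0 hc rho0 h1 e0' E' Ed.
  rewrite Ec in h1; have := bdd_unshift rho0 h1; apply: bdd_leB.
  rewrite Ed expfzDr ?gt_eqF // -exprnP mulrC -!mulrA divff ?mulr1 //.
  by rewrite expf_neq0 // gt_eqF.
have [d Ed] := le_int_nat le.
by rewrite (laurent_inj rho0 h1 s0 hc e0' (fun t ht => esym (E' t ht)) Ed) Ed; apply: nbl_lift.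
Qed.

Lemma nbl_eq0 h u (e : R) : nbl rho h u -> 0 < e -> (forall t, 0 < cabs t < e -> h t = 0) ->
  forall t, 0 < cabs t < rho -> h t = 0.
Proof.
move=> [r [c [h1 h2]]] e0 h0 t tr; rewrite h2 // /laurent.
have e0' : 0 < Num.min e rho by rewrite lt_min e0 rho0.
have c0 := @ps_eq0 _ c rho _ _ rho0 h1 e0'.
rewrite /ps (@eq_csum _ _ (fun=> 0)).
  by rewrite (@csum_delta _ (fun=> 0)) ?mulr0.
move=> l; rewrite c0 ?mul0r // => s; rewrite lt_min => /and3P[s0 se sr].
have := h0 s; rewrite s0 se => /(_ isT); rewrite h2 ?s0 // => /eqP.
rewrite mulf_eq0 => /orP[/eqP E|/eqP //].
by move: s0; rewrite cabs_gt0 => /(expfz_neq0 (- r)); rewrite E eqxx.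
Qed.

Lemma nbl_order h u (q : int) : nbl rho h u -> ord0_ge h q ->
  exists (A : nat -> C) B, bdd A rho B /\
    forall t, 0 < cabs t < rho -> h t = laurent (- q) A t.
Proof.
move=> [r [c [h1 h2]]] [e [e0 [B hB]]].
have [le|lt] := leP (- q) r.
  have [d Ed] := le_int_nat le.
  have cz l : (l < d)%N -> c l = 0.
    move=> ld; apply/cabs_eq0_small => z z0.
    pose B1 := Num.max B 1; have B10 : 0 < B1 by rewrite lt_max ltr01 orbT.
    (* The first two bounds keep the circle inside both discs; s <= 1 gives s^(d-l) <= s, and the
       last one gives s B1 <= z. Here [B1] replaces [B] to have a positive divisor. *)
    pose s := Num.min (rho / 2) (Num.min (e / 2) (Num.min 1 (z / B1))).
    have s0 : 0 < s by rewrite !lt_min ltr01 !divr_gt0.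
    have s1 : s <= 1 by rewrite !ge_min lexx !orbT.
    have sz : s * B1 <= z.
      rewrite -ler_pdivlMr // /s !ge_min lexx !orbT //.
    have sr : s <= rho / 2 by rewrite ge_min lexx.
    have se : s <= e / 2 by rewrite !ge_min lexx !orbT.
    have sr' : s <= rho by move: rho0 sr; lra.
    have : cabs (c l) * s ^+ l <= B * s ^+ d.
      apply: (@cauchy_estimate _ c rho _ s _ l s0 sr' h1) => t ts.
      have t0 : t != 0 by rewrite -cabs_gt0 ts.
      have := hB t; rewrite ts s0 h2 ?ts ?s0 //; last by move: rho0 sr; lra.
      move=> /(_ (le_lt_trans se _)) H.
      have {}H : cabs (t ^ (- q) * laurent r c t) <= B by apply: H; lra.
      move: H; rewrite /laurent mulrA -expfzDr // Ed.
      have -> : - q - (- q + d%:Z) = - d%:Z by rewrite opprD addrA subrr sub0r.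
      rewrite cabsM -exprnN cabsV cabsX ts => H.
      by rewrite -ler_pdivrMr ?exprn_gt0 // mulrC.
    rewrite -(subnKC (ltnW ld)) exprD [s ^+ l * _]mulrC mulrA ler_pM2r ?exprn_gt0 //.
    move=> H; apply: le_trans H _.
    apply: le_trans sz; rewrite mulrC.
    apply: (@le_trans _ _ (s ^+ (d - l) * B1)).
      by rewrite ler_wpM2l ?exprn_ge0 ?(ltW s0) // le_max lexx.
    rewrite ler_wpM2r ?(ltW B10) //; apply: ler_iXnr => //; last exact: ltW.
    by rewrite subn_gt0.
  have Ec : c = cshift d (fun l => c (l + d)%N).
    apply/funext => l; rewrite /cshift; case: ltnP => [/cz //|dl]; by rewrite subnK.
  have hA : bdd (fun l => c (l + d)%N) rho (rho ^- d * (u * rho ^ r)).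
    by apply: bdd_unshift => //; rewrite -Ec.
  exists (fun l => c (l + d)%N), (rho ^- d * (u * rho ^ r)); split=> // t tr.
  have /andP[t0 /ltW tr'] := tr.
  by rewrite h2 // Ed {1}Ec (laurent_shift _ _ _ tr' hA) // -cabs_gt0.
have [d Ed] := le_int_nat (ltW lt).
exists (cshift d c), (rho ^+ d * (u * rho ^ r)); split; first exact: bdd_shift (ltW rho0) _.
move=> t tr; have /andP[t0 /ltW tr'] := tr.
by rewrite h2 // Ed (laurent_shift _ _ _ tr' h1) // -cabs_gt0.
Qed.

(** If the constant term vanished, a factor t could be taken out and the order would be at least
    [q + 1]. *)
Lemma order_coef0 h (q : int) A B : bdd A rho B ->
  (forall t, 0 < cabs t < rho -> h t = laurent (- q) A t) -> ~ ord0_ge h (q + 1) -> A 0%N != 0.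
Proof.
move=> hA E nh; apply/eqP => A0; apply: nh.
have hA1 : bdd (fun l => A l.+1) rho (rho ^- 1 * B).
  apply: bdd_unshift => //.
  have -> : cshift 1 (fun l => A l.+1) = A => //.
  by apply/funext => -[|l]; rewrite /cshift //= subSS subn0.
exists rho; split=> //; exists (rho ^- 1 * B) => t tr; have /andP[t0 /ltW tr'] := tr.
rewrite E // /laurent opprK (ps_recl tr' hA) A0 add0r mulrA mulrA.
have tn0 : t != 0 by rewrite -cabs_gt0.
rewrite -expfzDr // opprD addrAC addNr sub0r -mulrA [t ^ _ * _](_ : _ = ps (fun l => A l.+1) t).
  exact: cabs_ps tr' hA1.
by rewrite exprN1 mulKf.
Qed.

End Laurent.

(** * The operator delta on Laurent coefficients *)

Section Exponents.
Variables (R : realType) (gamma : R).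
Local Notation C := R[i].
Implicit Types (c : nat -> C) (t : C) (rho sigma B u v : R) (r : int).

(** Eigenvalue of delta on t^(l - r) x^k with t = x^(i gamma); hence [exponentX] with parameter p
    represents delta^p. *)
Definition exponent (k : nat) r (l : nat) : C :=
  k%:R + 'i * (gamma%:C)%C * ((l%:Z - r)%:~R).

Definition exponentX k r p c : nat -> C := fun l => exponent k r l ^+ p * c l.

Lemma cabs_expo_le k r l :
  cabs (exponent k r l) <= k%:R + `|gamma| * `|r|%:~R + `|gamma| * l%:R.
Proof.
apply: le_trans (cabsD _ _) _; rewrite cabs_nat -addrA lerD2l.
rewrite !cabsM cabs_i mul1r cabs_real cabs_int -mulrDr ler_wpM2l // rmorphB /=.
apply: le_trans (ler_normB _ _) _; rewrite addrC lerD //.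
  by rewrite -intr_norm.
by rewrite -pmulrn normr_nat.
Qed.

Lemma exprn_le_exp (x : R) p : 0 <= x -> x ^+ p <= p`!%:R * expR x.
Proof.
case: p => [|p] x0; first by rewrite expr0 fact0 mul1r -expR0 ler_expR.
have := expR_ge1Dxn p x0; have f0 : 0 < p.+1`!%:R :> R by rewrite ltr0n fact_gt0.
move=> h; rewrite mulrC -ler_pdivrMr //; lra.
Qed.

Definition expo_cst k r (d : R) := expR (d * (k%:R + `|gamma| * `|r|%:~R)).

(** Apply x^p <= p! d^(-p) e^(d x) to the linear bound x on the modulus. The growth in l becomes a
    pure power, to be paid for by a smaller radius, and the growth in p is that of a Cauchy
    estimate, with d independent of k, r and p. *)
Lemma cabs_expoX_le k r l p (d : R) : 0 < d ->
  cabs (exponent k r l) ^+ p <= p`!%:R * d ^- p * expo_cst k r d * expR (d * `|gamma|) ^+ l.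
Proof.
move=> d0; pose x := k%:R + `|gamma| * `|r|%:~R + `|gamma| * l%:R.
have x0 : 0 <= x by rewrite /x !addr_ge0 ?mulr_ge0 ?ler0n // ler0z.
apply: (@le_trans _ _ (x ^+ p)).
  by apply: lerXn2r; rewrite ?nnegrE ?cabs_ge0 // cabs_expo_le.
have := @exprn_le_exp (d * x) p (mulr_ge0 (ltW d0) x0).
rewrite exprMn mulrC -ler_pdivlMr ?exprn_gt0 // => h; apply: le_trans h _.
rewrite /expo_cst -expRM_natr [d * `|gamma| * _](_ : _ = d * (`|gamma| * l%:R)); last by ring.
rewrite -!mulrA -expRD -mulrDr -/x le_eqVlt; apply/orP; left; apply/eqP; ring.
Qed.

Lemma bdd_expoX k r p c rho sigma B (d : R) : 0 < d -> 0 <= sigma ->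
  sigma * expR (d * `|gamma|) <= rho -> bdd c rho B ->
  bdd (exponentX k r p c) sigma (p`!%:R * d ^- p * expo_cst k r d * B).
Proof.
move=> d0 s0 sr h N; have cst0 : 0 <= p`!%:R * d ^- p * expo_cst k r d.
  by rewrite !mulr_ge0 ?ler0n ?invr_ge0 ?exprn_ge0 ?expR_ge0 // ltW.
apply: le_trans (ler_wpM2l cst0 (h N)); rewrite mulr_sumr; apply: ler_sum => l _.
rewrite cabsM cabsX -!mulrA; apply: (@le_trans _ _
  (p`!%:R * d ^- p * expo_cst k r d * expR (d * `|gamma|) ^+ l * (cabs (c l) * sigma ^+ l))).
  by rewrite ler_wpM2r ?cabsX ?cabs_expoX_le // mulr_ge0 ?cabs_ge0 ?exprn_ge0.
rewrite -!mulrA; do 3![rewrite ler_wpM2l ?ler0n ?invr_ge0 ?exprn_ge0 ?expR_ge0 ?(ltW d0) //].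
rewrite mulrCA ler_wpM2l ?cabs_ge0 // -exprMn lerXn2r ?nnegrE ?mulr_ge0 ?expR_ge0 //.
  by apply: le_trans sr; rewrite mulr_ge0 ?expR_ge0.
by rewrite mulrC.
Qed.

Hypothesis gamma0 : gamma != 0.

Lemma expo_room rho sigma : 0 < sigma -> sigma < rho ->
  exists d : R, 0 < d /\ sigma * expR (d * `|gamma|) <= rho.
Proof.
move=> s0 sr; exists (ln (rho / sigma) / `|gamma|); split.
  by rewrite divr_gt0 ?normr_gt0 // ln_gt0 // ltr_pdivlMr // mul1r.
rewrite divfK ?normr_eq0 // lnK ?posrE ?divr_gt0 //; last exact: lt_trans sr.
by rewrite mulrC divfK // gt_eqF.
Qed.

Lemma bdd_expoX_ex k r p c rho sigma B : 0 < sigma -> sigma < rho -> bdd c rho B ->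
  exists B', bdd (exponentX k r p c) sigma B'.
Proof.
move=> s0 sr h; have [d [d0 hd]] := expo_room s0 sr.
by exists (p`!%:R * d ^- p * expo_cst k r d * B); apply: bdd_expoX hd h => //; exact: ltW.
Qed.

Lemma dcoefE (r : nat -> int) (a : nat -> nat -> C) j k t : (0 < k)%N ->
  dcoef gamma r a j k t = laurent (r k) (exponentX k (r k) j (a k)) t.
Proof. by rewrite /dcoef; case: eqVneq => [->|]. Qed.

Lemma nbl_dcoef (r : nat -> int) (a : nat -> nat -> C) j k rho sigma B : 0 < sigma -> sigma < rho ->
  bdd (a k) rho B -> exists u, nbl sigma (dcoef gamma r a j k) u.
Proof.
move=> s0 sr h; case: (posnP k) => [k0|k0].
  exists (cabs (0 : C)); apply: (@nbl_ext _ _ (fun=> 0)); last exact: nbl_cst.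
  move=> t _.
  by rewrite /dcoef k0 eqxx.
have [B' hB'] := bdd_expoX_ex k (r k) j s0 sr h.
exists (B' / sigma ^ (r k)); exists (r k), (exponentX k (r k) j (a k)); split.
  by rewrite divfK // expfz_neq0 // gt_eqF.
by move=> t _; rewrite dcoefE.
Qed.

End Exponents.

(** * Linearisation of the formal equation *)

Lemma eq_big_supp (T : eqType) (V : nmodType) (r1 r2 : seq T) (f : T -> V) :
  uniq r1 -> uniq r2 -> (forall x, f x != 0 -> (x \in r1) = (x \in r2)) ->
  \sum_(x <- r1) f x = \sum_(x <- r2) f x.
Proof.
move=> u1 u2 h.
have rm r : \sum_(x <- r) f x = \sum_(x <- r | f x != 0) f x.
  by rewrite [RHS]big_mkcond; apply: eq_bigr => x _; case: eqVneq.
rewrite rm [RHS]rm.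
rewrite -big_filter -[RHS]big_filter; apply: perm_big; apply: uniq_perm; rewrite ?filter_uniq //.
by move=> x; rewrite !mem_filter; case: eqVneq => //= /h.
Qed.

Section OrderAtZero.
Variable K : comNzRingType.
Implicit Types (p q : {poly K}) (d e : nat).

Definition ordge d p := forall i, (i < d)%N -> p`_i = 0.

Lemma ordgeW d e p : (d <= e)%N -> ordge e p -> ordge d p.
Proof. by move=> de h i id; apply: h; apply: leq_trans id de. Qed.

Lemma ordge0 d : ordge d 0.
Proof. by move=> i _; rewrite coef0. Qed.

Lemma ordgeD d p q : ordge d p -> ordge d q -> ordge d (p + q).
Proof. by move=> h1 h2 i id; rewrite coefD h1 // h2 // addr0. Qed.

Lemma ordgeZ d a p : ordge d p -> ordge d (a *: p).
Proof. by move=> h1 i id; rewrite coefZ h1 // mulr0. Qed.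

Lemma ordgeM d e p q : ordge d p -> ordge e q -> ordge (d + e) (p * q).
Proof.
move=> h1 h2 i id; rewrite coefM big1 // => j _.
have [jd|dj] := ltnP j d; first by rewrite h1 // mul0r.
by rewrite h2 ?mulr0 //; move: (ltn_ord j); lia.
Qed.

Lemma ordge_any p : ordge 0 p. Proof. by []. Qed.

Lemma ordgeMl d p q : ordge d p -> ordge d (p * q).
Proof. by move=> h; have := ordgeM h (@ordge_any q); rewrite addn0. Qed.

Lemma ordgeMr d p q : ordge d p -> ordge d (q * p).
Proof. by rewrite mulrC; apply: ordgeMl. Qed.

Lemma ordge_sum (I : Type) (s : seq I) (P : pred I) d (f : I -> {poly K}) :
  (forall i, P i -> ordge d (f i)) -> ordge d (\sum_(i <- s | P i) f i).
Proof.
move=> h; elim/big_ind: _ => //; [exact: ordge0 | move=> *; exact: ordgeD].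
Qed.

Lemma ordgeX d p e : ordge d p -> ordge (d * e) (p ^+ e).
Proof.
move=> h; elim: e => [|e IH]; first by rewrite muln0.
by rewrite exprS mulnS; apply: ordgeM.
Qed.

Lemma ordge_prod (I : Type) (s : seq I) (P : pred I) (d : I -> nat) (f : I -> {poly K}) :
  (forall i, ordge (d i) (f i)) ->
  ordge (\sum_(i <- s | P i) d i) (\prod_(i <- s | P i) f i).
Proof.
move=> h; elim: s => [|i s IH]; first by rewrite !big_nil.
by rewrite !big_cons; case: ifP => // _; apply: ordgeM.
Qed.

Lemma ordgeXn e : ordge e ('X^e : {poly K}).
Proof. by move=> i ie; rewrite coefXn ltn_eqF. Qed.

End OrderAtZero.

(** * Substitution of truncated series into a power series *)

Section Substitution.
Variables (K : comNzRingType) (n : nat).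
Local Notation multi := {ffun 'I_n.+1 -> nat}.
Implicit Types (G : nat -> multi -> K) (Y Z V : 'I_n.+1 -> {poly K}) (b : multi).

Definition box (M : nat) : seq multi :=
  [seq [ffun i => nat_of_ord (b i)] | b : {ffun 'I_n.+1 -> 'I_M}].

Lemma mem_box M b : (b \in box M) = [forall i, (b i < M)%N].
Proof.
rewrite /box; apply/idP/forallP => [/mapP[c _ ->] i|h]; first by rewrite ffunE ltn_ord.
apply/mapP; exists [ffun i => Ordinal (h i)]; first by rewrite mem_enum.
by apply/ffunP => i; rewrite !ffunE.
Qed.

Lemma box_uniq M : uniq (box M).
Proof.
rewrite map_inj_uniq ?enum_uniq // => b c /ffunP h; apply/ffunP => i.
by apply: val_inj; have := h i; rewrite !ffunE.
Qed.

Lemma sum_boxE (A : nmodType) M (f : multi -> A) :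
  \sum_(b <- box M) f b = \sum_(b : {ffun 'I_n.+1 -> 'I_M}) f [ffun i => nat_of_ord (b i)].
Proof. by rewrite /box big_map big_enum. Qed.

Definition mon Y b := \prod_j Y j ^+ b j.

Definition dmon Y b (j : 'I_n.+1) :=
  (Y j ^+ (b j).-1 *+ b j) * \prod_(i | i != j) Y i ^+ b i.

(** Exponents are cut off at [M], which makes the substitution polynomial; when all [Y j] vanish at
    0, the coefficients of degree below [M] are not affected by the cut. *)
Definition psubst G M Y :=
  \sum_(a < M) \sum_(b <- box M) G a b *: ('X^a * mon Y b).

Definition dsubst G M Y j :=
  \sum_(a < M) \sum_(b <- box M) G a b *: ('X^a * dmon Y b j).

Lemma ordge_mon Y b : (forall j, ordge 1 (Y j)) -> ordge (\sum_j b j) (mon Y b).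
Proof.
move=> h; apply: ordge_prod => j.
by have := @ordgeX _ 1 (Y j) (b j) (h j); rewrite mul1n.
Qed.

Lemma ordge_dmon Y b j : (forall j, ordge 1 (Y j)) ->
  ordge (\sum_j b j).-1 (dmon Y b j).
Proof.
move=> h; rewrite /dmon (bigD1 j) //=.
have [->|bj] := eqVneq (b j) 0%N; first by rewrite mulr0n mul0r; apply: ordge0.
apply: (@ordgeW _ _ ((b j).-1 + \sum_(i | i != j) b i)).
  by case: (b j) bj.
apply: ordgeM; last first.
  by apply: ordge_prod => i; have := @ordgeX _ 1 (Y i) (b i) (h i); rewrite mul1n.
rewrite -scaler_nat; apply: ordgeZ; have := @ordgeX _ 1 (Y j) (b j).-1 (h j).
by rewrite mul1n.
Qed.

Lemma mon_congr d Y V b : (forall j, ordge d (Y j - V j)) ->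
  ordge d (mon Y b - mon V b).
Proof.
move=> h; rewrite /mon; elim/big_ind2: _ => [|p q p' q' h1 h2|j _].
- by rewrite subrr; apply: ordge0.
- have -> : q * q' - p * p' = (q - p) * q' + p * (q' - p') by ring.
  by apply: ordgeD; [apply: ordgeMl | apply: ordgeMr].
- elim: (b j) => [|e IH]; first by rewrite !expr0 subrr; apply: ordge0.
  rewrite !exprS; have -> : Y j * Y j ^+ e - V j * V j ^+ e =
    (Y j - V j) * Y j ^+ e + V j * (Y j ^+ e - V j ^+ e) by ring.
  by apply: ordgeD; [apply: ordgeMl | apply: ordgeMr].
Qed.

(** A monomial x^a V^b has order at least a + |b|, so only indices at most p contribute in degree p,
    and a change of the arguments beyond degree p has no effect there. *)
Lemma psubst_stable G M M' Y V p : (p < M)%N -> (p < M')%N ->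
  (forall j, ordge 1 (V j)) -> (forall j, ordge p.+1 (Y j - V j)) ->
  (psubst G M Y)`_p = (psubst G M' V)`_p.
Proof.
move=> pM pM' oV hYV.
have small N a b : (p < N)%N -> ('X^a * mon V b)`_p != 0 -> (a < N)%N && (b \in box N).
  move=> pN h; have oX := ordgeM (@ordgeXn K a) (@ordge_mon V b oV).
  have : (a + \sum_j b j <= p)%N by rewrite leqNgt; apply: contra h => /oX ->.
  move=> le; apply/andP; split; first by lia.
  rewrite mem_box; apply/forallP => i.
  have : (b i <= \sum_j b j)%N by rewrite (bigD1 i) //= leq_addr.
  by lia.
have -> : (psubst G M Y)`_p = (psubst G M V)`_p.
  apply/subr0_eq; rewrite -coefB /psubst.
  rewrite -sumrB coef_sum big1 // => a _; rewrite -sumrB coef_sum big1 // => b _.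
  rewrite -scalerBr -mulrBr; apply: (@ordgeZ _ p.+1) => //; apply: ordgeMr.
  exact: mon_congr.
have E N : (psubst G N V)`_p = \sum_(a <- iota 0 N) \sum_(b <- box N) G a b * ('X^a * mon V b)`_p.
  rewrite /psubst coef_sum -(big_mkord xpredT (fun a => (\sum_(b <- box N) G a b *: ('X^a * mon V b))`_p)).
  rewrite /index_iota subn0; apply: eq_bigr => a _.
  by rewrite coef_sum; apply: eq_bigr => b _; rewrite coefZ.
have key N N' : (p < N)%N -> (p < N')%N ->
    \sum_(a <- iota 0 N) \sum_(b <- box N) G a b * ('X^a * mon V b)`_p =
    \sum_(a <- iota 0 N') \sum_(b <- box N') G a b * ('X^a * mon V b)`_p.
  move=> pN pN'.
  have -> : \sum_(a <- iota 0 N) \sum_(b <- box N) G a b * ('X^a * mon V b)`_p =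
    \sum_(a <- iota 0 N) \sum_(b <- box N') G a b * ('X^a * mon V b)`_p.
    apply: eq_bigr => a _; apply: eq_big_supp; rewrite ?box_uniq // => b h.
    have h' : ('X^a * mon V b)`_p != 0 by apply: contraNneq h => ->; rewrite mulr0.
    by have /andP[_ ->] := small _ a b pN h'; have /andP[_ ->] := small _ a b pN' h'.
  apply: eq_big_supp; rewrite ?iota_uniq // => a; rewrite !mem_iota /= !add0n => h.
  have [b h'] : exists b, ('X^a * mon V b)`_p != 0.
    apply: contrapT => hn; move/eqP: h; apply.
    rewrite big1 // => b _; have [->|hb] := eqVneq (('X^a * mon V b)`_p) 0.
      by rewrite mulr0.
    by case: hn; exists b.
  by have /andP[-> _] := small _ a b pN h'; have /andP[-> _] := small _ a b pN' h'.
by rewrite !E; apply: key.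
Qed.

Definition dpart_gen G (j : 'I_n.+1) : nat -> multi -> K :=
  fun a b => (b j).+1%:R * G a [ffun i => (b i + (i == j))%N].

(** Raising the j-th exponent by one matches the two index sets; this is why [p.+1], and not only
    [p], has to lie below [M]. *)
Lemma dsubst_psubst G M Y j p : (p.+1 < M)%N -> (forall j, ordge 1 (Y j)) ->
  (dsubst G M Y j)`_p = (psubst (dpart_gen G j) M Y)`_p.
Proof.
move=> pM oY; rewrite /dsubst /psubst !coef_sum; apply: eq_bigr => a _.
rewrite !coef_sum; under eq_bigr do rewrite coefZ.
pose shift (b : multi) : multi := [ffun i => (b i + (i == j))%N].
have shift_inj : injective shift.
  by move=> b c /ffunP h; apply/ffunP => i; have := h i; rewrite !ffunE => /addIn.
transitivity (\sum_(b <- map shift (box M)) G a b * ('X^a * dmon Y b j)`_p).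
  apply: eq_big_supp; rewrite ?(map_inj_uniq shift_inj) ?box_uniq // => b h.
  have h' : ('X^a * dmon Y b j)`_p != 0 by apply: contraNneq h => ->; rewrite mulr0.
  have bj : (0 < b j)%N.
    rewrite lt0n; apply: contraNneq h'; rewrite /dmon => ->.
    by rewrite mulr0n mul0r mulr0 coef0.
  have oX := ordgeM (@ordgeXn K a) (@ordge_dmon Y b j oY).
  have le : (a + (\sum_j b j).-1 <= p)%N by rewrite leqNgt; apply: contra h' => /oX ->.
  have bM i : (b i <= p.+1)%N.
    apply: (@leq_trans (\sum_j b j)); first by rewrite (bigD1 i) //= leq_addr.
    move: le; case: (\sum_j b j)%N => [|S] le; first by [].
    by rewrite ltnS; apply: leq_trans le; rewrite leq_addl.
  have -> : b \in box M.
    by rewrite mem_box; apply/forallP => i; apply: leq_ltn_trans (bM i) pM.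
  symmetry; apply/mapP; exists [ffun i => (b i - (i == j))%N].
    rewrite mem_box; apply/forallP => i; rewrite ffunE.
    exact: leq_ltn_trans (leq_subr _ _) (leq_ltn_trans (bM i) pM).
  apply/ffunP => i; rewrite !ffunE; case: (eqVneq i j) => [->|_]; last by rewrite subn0 addn0.
  by rewrite subnK.
rewrite big_map; apply: eq_bigr => b _; rewrite coefZ /dpart_gen -/(shift b).
have -> : dmon Y (shift b) j = (b j).+1%:R *: mon Y b.
  have sj : shift b j = (b j).+1 by rewrite ffunE eqxx addn1.
  rewrite /dmon /mon sj [in RHS](bigD1 j) //= scaler_nat -mulrnAl.
  by congr (_ * _); apply: eq_bigr => i ij; rewrite ffunE (negbTE ij) addn0.
by rewrite -scalerAr coefZ mulrA (mulrC (G _ _)).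
Qed.

(** * First-order expansions closed under products *)

Section Taylor.
Variables (X : Type) (T : nat -> (X -> {poly K}) -> (X -> {poly K}) -> (X -> {poly K}) -> Prop).
Hypothesis T1 : T 0 (fun=> 1) (fun=> 1) (fun=> 0).
Hypothesis TM : forall d P Q L d' P' Q' L', T d P Q L -> T d' P' Q' L' ->
  T (d + d') (fun x => P x * P' x) (fun x => Q x * Q' x)
    (fun x => Q x * L' x + L x * Q' x).

Lemma taylor_pow P Q L e : T 1 P Q L ->
  T e (fun x => P x ^+ e) (fun x => Q x ^+ e) (fun x => (Q x ^+ e.-1 *+ e) * L x).
Proof.
move=> h; elim: e => [|e IH].
  have -> : (fun x => (Q x ^+ 0.-1 *+ 0) * L x) = (fun=> 0).
    by apply/funext => x; rewrite mulr0n mul0r.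
  by have -> : (fun x => P x ^+ 0) = (fun=> 1) by [].
have := TM h IH; rewrite add1n.
have -> : (fun x => P x * P x ^+ e) = (fun x => P x ^+ e.+1) by apply/funext => x; rewrite exprS.
have -> : (fun x => Q x * Q x ^+ e) = (fun x => Q x ^+ e.+1) by apply/funext => x; rewrite exprS.
congr (T _ _ _ _); apply/funext => x /=.
case: e {IH} => [|e] /=; first by rewrite mulr0n mul0r mulr0 add0r !expr0 mulr1 mulr1n mul1r.
by rewrite mulrA mulrnAr -exprS (mulrC (L x)) -mulrDl -mulrSr.
Qed.

Lemma taylor_prod (I : eqType) (s : seq I) (d : I -> nat) (P Q L : I -> X -> {poly K}) :
  uniq s -> (forall i, T (d i) (P i) (Q i) (L i)) ->
  T (\sum_(i <- s) d i) (fun x => \prod_(i <- s) P i x) (fun x => \prod_(i <- s) Q i x)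
    (fun x => \sum_(j <- s) (\prod_(i <- s | i != j) Q i x) * L j x).
Proof.
move=> + h; elim: s => [|i0 s IH] /=.
  rewrite big_nil => _.
  have -> : (fun x => \prod_(i <- [::]) P i x) = (fun=> 1) by apply/funext => x; rewrite big_nil.
  have -> : (fun x => \prod_(i <- [::]) Q i x) = (fun=> 1) by apply/funext => x; rewrite big_nil.
  by under [X in T _ _ _ X]eq_fun do rewrite big_nil.
move=> /andP[i0s us]; have := TM (h i0) (IH us); rewrite big_cons.
have -> : (fun x => P i0 x * \prod_(i <- s) P i x) = (fun x => \prod_(i <- i0 :: s) P i x).
  by apply/funext => x; rewrite big_cons.
have -> : (fun x => Q i0 x * \prod_(i <- s) Q i x) = (fun x => \prod_(i <- i0 :: s) Q i x).
  by apply/funext => x; rewrite big_cons.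
congr (T _ _ _ _); apply/funext => x /=.
rewrite [in RHS]big_cons big_cons eqxx /= addrC; congr (_ + _).
  rewrite mulrC; congr (_ * _); rewrite big_seq_cond [RHS]big_seq_cond.
  apply: eq_bigl => i; rewrite andbT; case: (boolP (i \in s)) => //= is_.
  by rewrite (memPn i0s).
rewrite mulr_sumr; apply: eq_big_seq => j js.
by rewrite big_cons eq_sym (memPn i0s) // mulrA.
Qed.

(** [T d P Q L] is to be read as: Q + L expands P to first order, in degree d. A relation that
    respects the product rule passes from the variables to all monomials. It is instantiated once
    with orders of vanishing and once with norms, so that the Leibniz computation is done only
    here. *)
Lemma taylor_mon (Y Z : 'I_n.+1 -> X -> {poly K}) b :
  (forall j, T 1 (fun x => Y j x + Z j x) (Y j) (Z j)) ->
  T (\sum_j b j) (fun x => mon (fun j => Y j x + Z j x) b) (fun x => mon (Y ^~ x) b)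
    (fun x => \sum_j dmon (Y ^~ x) b j * Z j x).
Proof.
move=> h.
have := @taylor_prod _ (index_enum 'I_n.+1) b
  (fun j x => (Y j x + Z j x) ^+ b j) (fun j x => Y j x ^+ b j)
  (fun j x => (Y j x ^+ (b j).-1 *+ b j) * Z j x) (index_enum_uniq _)
  (fun j => taylor_pow (b j) (h j)).
congr (T _ _ _ _); apply/funext => x; apply: eq_bigr => j _.
by rewrite /dmon mulrA (mulrC (\prod_(_ | _) _)).
Qed.

End Taylor.

Lemma psubst_taylor G M Y Z :
  psubst G M (fun j => Y j + Z j) = psubst G M Y + \sum_j dsubst G M Y j * Z j +
   \sum_(a < M) \sum_(b <- box M) G a b *: ('X^a *
      (mon (fun j => Y j + Z j) b - mon Y b - \sum_j dmon Y b j * Z j)).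
Proof.
have -> : \sum_j dsubst G M Y j * Z j = \sum_(a < M) \sum_(b <- box M)
    G a b *: ('X^a * \sum_j dmon Y b j * Z j).
  rewrite /dsubst; under eq_bigr do rewrite mulr_suml.
  rewrite exchange_big; apply: eq_bigr => a _.
  under eq_bigr do rewrite mulr_suml.
  rewrite exchange_big; apply: eq_bigr => b _.
  rewrite mulr_sumr scaler_sumr; apply: eq_bigr => j _.
  by rewrite -scalerAl mulrA.
rewrite /psubst -!big_split; apply: eq_bigr => a _ /=.
rewrite -!big_split; apply: eq_bigr => b _ /=.
by rewrite -!scalerDr -!mulrDr; congr (_ *: (_ * _)); ring.
Qed.

(** Every term of the remainder contains at least two factors taken from [Z]. *)
Lemma ordge_taylor G M Y Z d : (forall j, ordge d (Z j)) ->
  ordge (d + d) (\sum_(a < M) \sum_(b <- box M) G a b *: ('X^a *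
      (mon (fun j => Y j + Z j) b - mon Y b - \sum_j dmon Y b j * Z j))).
Proof.
move=> h; apply: ordge_sum => a _; apply: ordge_sum => b _; apply: ordgeZ; apply: ordgeMr.
pose T (d' : nat) (P Q L : unit -> {poly K}) :=
  ordge d (L tt) /\ ordge (d + d) (P tt - Q tt - L tt).
have TO : T 0 (fun=> 1) (fun=> 1) (fun=> 0).
  by rewrite /T !subrr; split; apply: ordge0.
have TM d1 P Q L d2 P' Q' L' : T d1 P Q L -> T d2 P' Q' L' ->
    T (d1 + d2)%N (fun x => P x * P' x) (fun x => Q x * Q' x)
      (fun x => Q x * L' x + L x * Q' x).
  move=> [h1 h2] [h3 h4].
  split; first by apply: ordgeD; [apply: ordgeMr | apply: ordgeMl].
  have -> : P tt * P' tt - Q tt * Q' tt - (Q tt * L' tt + L tt * Q' tt) =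
     (P tt - Q tt - L tt) * P' tt + Q tt * (P' tt - Q' tt - L' tt) + L tt * L' tt
     + L tt * (P' tt - Q' tt - L' tt) by ring.
  apply: ordgeD; last first.
    by apply: ordgeMr; move=> i idd; apply: h4.
  apply: ordgeD; last by apply: ordgeM.
  by apply: ordgeD; [apply: ordgeMl | apply: ordgeMr].
have TB j : T 1 (fun x : unit => Y j + Z j) (fun=> Y j) (fun=> Z j).
  split; [exact: h | have -> : Y j + Z j - Y j - Z j = 0 by ring].
  exact: ordge0.
by have [_ H] := @taylor_mon unit T TO TM (fun j => fun=> Y j) (fun j => fun=> Z j) b TB.
Qed.


Lemma psubst_subst G M (c : 'I_n.+1 -> nat -> K) Y k : (k < M)%N ->
  (forall j, c j 0%N = 0) -> (forall j i, (i <= k)%N -> (Y j)`_i = c j i) ->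
  (psubst G M Y)`_k = (psubst G k.+1 (fun j => \poly_(i < k.+1) c j i))`_k.
Proof.
move=> kM c0 hY; apply: psubst_stable => // j i.
  by case: i => // _; rewrite coef_poly c0.
by move=> ik; rewrite coefB coef_poly ik hY // subrr.
Qed.

End Substitution.

Lemma subst_coefE (R : realType) n (G : nat -> {ffun 'I_n.+1 -> nat} -> R[i]) c k :
  subst_coef G c k = (psubst G k.+1 (fun j => \poly_(i < k.+1) c j i))`_k.
Proof.
rewrite /subst_coef /psubst !coef_sum; apply: eq_bigr => a _.
rewrite sum_boxE !coef_sum; apply: eq_bigr => b _; rewrite /mon !coefZ; congr (_ * ('X^a * _)`_k).
by apply: eq_bigr => j _; rewrite ffunE.
Qed.

(** * Linear equations for the newest coefficients *)

Section FormalLinearization.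
Variables (R : realType) (n : nat) (F : nat -> {ffun 'I_n.+1 -> nat} -> R[i]).
Variables (c : 'I_n.+1 -> nat -> R[i]) (m : nat).
Hypothesis c0 : forall j, c j 0%N = 0.
Hypothesis dF0 : forall j k, (k < m)%N -> subst_coef (dpart F j) c k = 0.

Definition trunc_ser K j : {poly R[i]} := \poly_(i < K) c j i.

Lemma dsubst_trunc K M j k : (k < K)%N -> (k.+1 < M)%N ->
  (dsubst F M (trunc_ser K) j)`_k = subst_coef (dpart F j) c k.
Proof.
move=> kK kM; rewrite dsubst_psubst //; last first.
  by move=> i [|//] _; rewrite coef_poly c0 if_same.
rewrite subst_coefE -(@psubst_subst _ _ _ M c (trunc_ser K)) ?(ltnW kM) //.
by move=> i l lk; rewrite coef_poly (leq_ltn_trans lk kK).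
Qed.

(* The quadratic part of the Taylor expansion at the truncated series starts
   in degree 2 K > m + K, so the coefficient c j K enters only linearly. *)
Lemma subst_coef_trunc K M k : (m < K)%N -> (k <= K)%N -> ((m + K).+1 < M)%N ->
  subst_coef F c (m + k) = (psubst F M (trunc_ser K))`_(m + k) +
    (\sum_j subst_coef (dpart F j) c m * c j K) *+ (k == K).
Proof.
move=> mK kK MK.
rewrite subst_coefE -(@psubst_subst _ _ _ M c (trunc_ser M)) //; first last.
- by move=> j i ik; rewrite coef_poly (_ : (i < M)%N) //; lia.
- by lia.
pose Z j := trunc_ser M j - trunc_ser K j.
have -> : trunc_ser M = (fun j => trunc_ser K j + Z j) by apply/funext => j; rewrite /Z addrC subrK.
have oZ j : ordge K (Z j).
  by move=> i iK; rewrite coefB !coef_poly iK (_ : (i < M)%N) ?subrr //; lia.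
rewrite psubst_taylor !coefD (ordge_taylor F M (trunc_ser K) oZ) ?addr0; last by lia.
congr (_ + _); rewrite coef_sum -sumrMnl; apply: eq_bigr => j _.
rewrite coefM.
have mlt : (m < (m + k).+1)%N by lia.
rewrite (bigD1 (Ordinal mlt)) //= big1 ?addr0 => [|i im].
  rewrite dsubst_trunc //; last by lia.
  rewrite addKn; case: (eqVneq k K) => [->|kneK]; last first.
    by rewrite oZ ?mulr0 // ltn_neqAle kneK.
  by rewrite mulr1n coefB !coef_poly ltnn subr0 (_ : (K < M)%N) //; lia.
have [lim|gem] := ltnP i m.
  by rewrite dsubst_trunc ?dF0 ?mul0r //; lia.
rewrite oZ ?mulr0 //.
have : (nat_of_ord i != m)%N by [].
by lia.
Qed.

Hypothesis F0 : forall k, subst_coef F c k = 0.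

(** Only k = K carries new information: for k < K the substitution of the truncated series already
    has vanishing coefficient in degree m + k, and the subtracted sum gives back the left side. One
    right-hand side valid for all k up to K lets the majorant estimate sum over k. *)
Lemma linearized_eq K M k : (m < K)%N -> (k <= K)%N -> ((m + K).+1 < M)%N ->
  \sum_j subst_coef (dpart F j) c m * c j k =
  - (psubst F M (trunc_ser K) -
      \sum_j subst_coef (dpart F j) c m *: ('X^m * trunc_ser K j))`_(m + k).
Proof.
move=> mK kK MK; have := subst_coef_trunc mK kK MK; rewrite F0 => E.
rewrite coefB opprB.
have -> : (\sum_j subst_coef (dpart F j) c m *: ('X^m * trunc_ser K j))`_(m + k) =
   \sum_j subst_coef (dpart F j) c m * (if (k < K)%N then c j k else 0).
  rewrite coef_sum; apply: eq_bigr => j _; rewrite coefZ coefXnM addKn coef_poly.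
  by rewrite ltnNge leq_addr.
case: (eqVneq k K) E => [->|kneK]; rewrite ?mulr1n ?mulr0n => E.
  have -> : \sum_j subst_coef (dpart F j) c m * (if (K < K)%N then c j K else 0) = 0.
    by apply: big1 => j _; rewrite ltnn mulr0.
  rewrite sub0r.
  by apply/eqP; rewrite -addr_eq0 addrC -E.
by rewrite ltn_neqAle kneK kK /= -[(psubst _ _ _)`_(_)]addr0 -E subr0.
Qed.

End FormalLinearization.

(** * The majorant method *)

Section Majorant.
Variable R : realType.
Local Notation C := R[i].
Variables (X : Type) (Dm : X -> Prop) (nb : nat -> (X -> C) -> R -> Prop).
Implicit Types (rho sigma u v s : R) (P Q : X -> {poly C}).
Hypothesis nb_ext : forall k h h' u, (forall x, Dm x -> h x = h' x) -> nb k h u -> nb k h' u.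
Hypothesis nb_ge0 : forall k h u, nb k h u -> 0 <= u.
Hypothesis nb_le : forall k h u v, u <= v -> nb k h u -> nb k h v.
Hypothesis nb_cst : forall k z, nb k (fun=> z) (cabs z).
Hypothesis nbD : forall k h h' u v, nb k h u -> nb k h' v -> nb k (fun x => h x + h' x) (u + v).
Hypothesis nbM : forall k k' h h' u v, nb k h u -> nb k' h' v ->
  nb (k + k') (fun x => h x * h' x) (u * v).

Lemma nb0 k : nb k (fun=> 0) 0.
Proof. by have := nb_cst k 0; rewrite cabs0. Qed.

Lemma nbZ k z h u : nb k h u -> nb k (fun x => z * h x) (cabs z * u).
Proof. by move=> h1; have := nbM (nb_cst 0 z) h1. Qed.

Lemma nb_sum k (I : Type) (s : seq I) (h : I -> X -> C) (u : I -> R) :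
  (forall i, nb k (h i) (u i)) -> nb k (fun x => \sum_(i <- s) h i x) (\sum_(i <- s) u i).
Proof.
move=> H; elim: s => [|i s IH].
  by rewrite big_nil; apply: nb_ext (nb0 k) => x _; rewrite big_nil.
by rewrite big_cons; apply: nb_ext (nbD (H i) IH) => x _; rewrite big_cons.
Qed.

(** Norm of a polynomial in x whose coefficients are functions on [X]: the grading index of [nb]
    follows the degree in x, and [rho] is the radius in x. *)
Definition nbP (rho : R) (P : X -> {poly C}) (u : R) :=
  exists e : nat -> R, (forall p, nb p (fun x => (P x)`_p) (e p)) /\
    forall M : nat, \sum_(p < M) e p * rho ^+ p <= u.

Lemma nbP_le rho P u v : u <= v -> nbP rho P u -> nbP rho P v.
Proof. by move=> uv [e [h1 h2]]; exists e; split=> // M; apply: le_trans (h2 M) uv. Qed.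

Lemma nbP_ge0 rho P u : nbP rho P u -> 0 <= u.
Proof. by move=> [e [_ /(_ 0%N)]]; rewrite big_ord0. Qed.

Lemma nbP_ext rho P Q u : (forall x, Dm x -> P x = Q x) -> nbP rho P u -> nbP rho Q u.
Proof.
move=> PQ [e [h1 h2]]; exists e; split=> // p.
by apply: nb_ext (h1 p) => x /PQ ->.
Qed.

Lemma nbP0 rho : nbP rho (fun=> 0) 0.
Proof.
exists (fun=> 0); split; last by move=> M; rewrite big1 // => p _; rewrite mul0r.
by move=> p; apply: nb_ext (nb0 p) => x _; rewrite coef0.
Qed.

Lemma nbP1 rho : nbP rho (fun=> 1) 1.
Proof.
exists (fun p => (p == 0%N)%:R); split=> [p|M].
  case: (eqVneq p 0%N) => [->|p0].
    by have := nb_cst 0 1; rewrite cabs1; apply: nb_ext => x _; rewrite coef1.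
  by apply: nb_ext (nb0 p) => x _; rewrite coef1 (negbTE p0).
case: M => [|M]; first by rewrite big_ord0.
rewrite big_ord_recl /= expr0 mulr1 big1 ?addr0 // => i _.
by rewrite mul0r.
Qed.

Lemma nbPX rho a : 0 <= rho -> nbP rho (fun=> 'X^a) (rho ^+ a).
Proof.
move=> r0; exists (fun p => (p == a)%:R); split=> [p|M].
  case: (eqVneq p a) => [->|p0].
    by have := nb_cst a 1; rewrite cabs1; apply: nb_ext => x _; rewrite coefXn eqxx.
  by apply: nb_ext (nb0 p) => x _; rewrite coefXn (negbTE p0).
have [aM|Ma] := ltnP a M.
  rewrite (bigD1 (Ordinal aM)) //= eqxx mul1r big1 ?addr0 // => i ia.
  by rewrite (_ : nat_of_ord i == a = false) ?mul0r //; apply: negbTE.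
rewrite big1 ?exprn_ge0 // => i _; rewrite (_ : nat_of_ord i == a = false) ?mul0r //.
by apply/negbTE; have := ltn_ord i; lia.
Qed.

Lemma nbPD rho P Q u v : nbP rho P u -> nbP rho Q v -> nbP rho (fun x => P x + Q x) (u + v).
Proof.
move=> [e [h1 h2]] [e' [h1' h2']]; exists (fun p => e p + e' p); split=> [p|M].
  by apply: nb_ext (nbD (h1 p) (h1' p)) => x _; rewrite coefD.
under eq_bigr do rewrite mulrDl; rewrite big_split /=.
  exact: lerD (h2 M) (h2' M).
Qed.

Lemma nbPZ rho z P u : nbP rho P u -> nbP rho (fun x => z *: P x) (cabs z * u).
Proof.
move=> [e [h1 h2]]; exists (fun p => cabs z * e p); split=> [p|M].
  by apply: nb_ext (nbZ z (h1 p)) => x _; rewrite coefZ.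
under eq_bigr do rewrite -mulrA; rewrite -mulr_sumr.
by rewrite ler_wpM2l ?cabs_ge0.
Qed.

Lemma nbPM rho P Q u v : 0 <= rho -> nbP rho P u -> nbP rho Q v ->
  nbP rho (fun x => P x * Q x) (u * v).
Proof.
move=> r0 hP hQ; have v0 := nbP_ge0 hQ.
case: hP hQ => [e [h1 h2]] [e' [h1' h2']].
exists (fun p => \sum_(i < p.+1) e i * e' (p - i)%N); split=> [p|M].
  have := @nb_sum p _ (index_enum 'I_p.+1) (fun i x => (P x)`_i * (Q x)`_(p - i))
     (fun i => e i * e' (p - i)%N).
  move=> H; apply: nb_ext (H _) => [x _|i]; first by rewrite coefM.
  by have := nbM (h1 i) (h1' (p - i)%N); rewrite subnKC // -ltnS.
have -> : \sum_(p < M) (\sum_(i < p.+1) e i * e' (p - i)%N) * rho ^+ p =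
   \sum_(p < M) \sum_(i < p.+1) (e i * rho ^+ i) * (e' (p - i)%N * rho ^+ (p - i)%N).
  apply: eq_bigr => p _; rewrite mulr_suml; apply: eq_bigr => i _.
  have -> : rho ^+ p = rho ^+ i * rho ^+ (p - i) by rewrite -exprD subnKC // -ltnS.
  ring.
rewrite (sum_conv (fun i => e i * rho ^+ i) (fun i => e' i * rho ^+ i)).
apply: (@le_trans _ _ (\sum_(i < M) e i * rho ^+ i * v)).
  apply: ler_sum => i _; rewrite ler_wpM2l // mulr_ge0 ?exprn_ge0 //.
  exact: nb_ge0 (h1 i).
by rewrite -mulr_suml ler_wpM2r.
Qed.

Lemma nbP_sum rho (I : Type) (s : seq I) (P : I -> X -> {poly C}) (u : I -> R) :
  (forall i, nbP rho (P i) (u i)) -> nbP rho (fun x => \sum_(i <- s) P i x) (\sum_(i <- s) u i).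
Proof.
move=> H; elim: s => [|i s IH].
  by rewrite big_nil; apply: nbP_ext (nbP0 rho) => x _; rewrite big_nil.
by rewrite big_cons; apply: nbP_ext (nbPD (H i) IH) => x _; rewrite big_cons.
Qed.

Lemma nbP_exp rho P u e : 0 <= rho -> nbP rho P u -> nbP rho (fun x => P x ^+ e) (u ^+ e).
Proof.
move=> r0 h; elim: e => [|e IH]; first by rewrite expr0; exact: nbP1.
rewrite exprS; apply: nbP_ext (nbPM r0 h IH) => x _; by rewrite exprS.
Qed.

Lemma nbP_prod rho (I : Type) (s : seq I) (p : pred I) (P : I -> X -> {poly C}) (u : I -> R) : 0 <= rho ->
  (forall i, nbP rho (P i) (u i)) ->
  nbP rho (fun x => \prod_(i <- s | p i) P i x) (\prod_(i <- s | p i) u i).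
Proof.
move=> r0 H; elim: s => [|i s IH].
  by rewrite big_nil; apply: nbP_ext (nbP1 rho) => x _; rewrite big_nil.
rewrite big_cons; case: ifP => pi.
  by apply: nbP_ext (nbPM r0 (H i) IH) => x _; rewrite big_cons pi.
by apply: nbP_ext IH => x _; rewrite big_cons pi.
Qed.

(** With the degrees below d removed, every remaining coefficient gains at least (rho/sigma)^d when
    the radius shrinks from sigma to rho. This gain is what closes the growth induction. *)
Lemma nbP_high rho sigma P Q u d : 0 < rho -> rho <= sigma -> nbP sigma P u ->
  (forall x p, Dm x -> (p < d)%N -> (Q x)`_p = 0) ->
  (forall x p, Dm x -> (d <= p)%N -> (Q x)`_p = (P x)`_p) ->
  nbP rho Q ((rho / sigma) ^+ d * u).
Proof.
move=> r0 rs [e [h1 h2]] lo hi; have s0 : 0 < sigma by apply: lt_le_trans rs.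
exists (fun p => if (p < d)%N then 0 else e p); split=> [p|M].
  case: ltnP => pd; first by apply: nb_ext (nb0 p) => x Dx; rewrite lo.
  by apply: nb_ext (h1 p) => x Dx; rewrite hi.
have q1 : rho / sigma <= 1 by rewrite ler_pdivrMr // mul1r.
have q0 : 0 <= rho / sigma by rewrite divr_ge0 ?ltW.
apply: (@le_trans _ _ (\sum_(p < M) (rho / sigma) ^+ d * (e p * sigma ^+ p))).
  apply: ler_sum => p _; have e0 := nb_ge0 (h1 p).
  case: ltnP => pd; first by rewrite mul0r !mulr_ge0 ?exprn_ge0 // ltW.
  have -> : rho ^+ p = (rho / sigma) ^+ p * sigma ^+ p.
    by rewrite -exprMn divfK // gt_eqF.
  rewrite mulrCA ler_wpM2r ?mulr_ge0 ?exprn_ge0 ?(ltW s0) //.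
  exact: ler_wiXn2l.
by rewrite -mulr_sumr ler_wpM2l ?exprn_ge0.
Qed.

Lemma nbP_poly rho (K : nat) (c : nat -> X -> C) (e : nat -> R) u : 0 <= rho ->
  (forall i, (i < K)%N -> nb i (c i) (e i)) -> \sum_(i < K) e i * rho ^+ i <= u ->
  nbP rho (fun x => \poly_(i < K) c i x) u.
Proof.
move=> r0 h1 h2; exists (fun p => if (p < K)%N then e p else 0); split=> [p|M].
  case: ltnP => pK; first by apply: nb_ext (h1 p pK) => x _; rewrite coef_poly pK.
  by apply: nb_ext (nb0 p) => x _; rewrite coef_poly ltnNge pK.
have [MK|KM] := leqP M K.
  apply: le_trans h2; rewrite (sum_ord_split (fun i => e i * rho ^+ i) MK).
  rewrite (eq_bigr (fun i : 'I_M => e i * rho ^+ i)) ?lerDl => [|i _]; last first.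
    by rewrite (leq_trans (ltn_ord i) MK).
  rewrite big_nat; apply: sumr_ge0 => i /andP[_ iK].
  by rewrite mulr_ge0 ?exprn_ge0 // (nb_ge0 (h1 i iK)).
rewrite (sum_ord_split (fun i => (if (i < K)%N then e i else 0) * rho ^+ i) (ltnW KM)).
rewrite [X in _ + X]big_nat [X in _ + X]big1 ?addr0 => [|i /andP[Ki _]]; last first.
  by rewrite ltnNge Ki mul0r.
by apply: le_trans h2; apply: ler_sum => i _; rewrite ltn_ord.
Qed.

Section Bounds.
Variables (n : nat) (F : nat -> {ffun 'I_n.+1 -> nat} -> C) (tau B : R).
Hypothesis tau0 : 0 < tau.
Hypothesis FB : forall M : nat,
  \sum_(a < M) \sum_(b <- box n M) cabs (F a b) * tau ^+ (a + \sum_j b j) <= B.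

Lemma nbP_family rho M s (W : nat -> {ffun 'I_n.+1 -> nat} -> X -> {poly C}) : 0 <= s ->
  (forall a b, nbP rho (W a b) (s * tau ^+ (a + \sum_j b j))) ->
  nbP rho (fun x => \sum_(a < M) \sum_(b <- box n M) F a b *: W a b x) (s * B).
Proof.
move=> s0 hW.
have H := @nbP_sum rho _ (index_enum 'I_M) (fun a x => \sum_(b <- box n M) F a b *: W a b x)
   (fun a => \sum_(b <- box n M) cabs (F a b) * (s * tau ^+ (a + \sum_j b j)))
   (fun a => nbP_sum (box n M) (fun b => nbPZ (F a b) (hW a b))).
apply: nbP_le H; apply: le_trans (ler_wpM2l s0 (FB M)).
rewrite mulr_sumr; apply: ler_sum => a _; rewrite mulr_sumr; apply: ler_sum => b _.
by rewrite mulrCA.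
Qed.

Variables (rho : R) (Y : 'I_n.+1 -> X -> {poly C}).
Hypothesis rho0 : 0 <= rho.
Hypothesis rhotau : rho <= tau.
Hypothesis Ytau : forall j, nbP rho (Y j) (tau / 2).

Lemma nbPXtau a : nbP rho (fun=> 'X^a) (tau ^+ a).
Proof. by apply: nbP_le (nbPX a rho0); apply: lerXn2r; rewrite ?nnegrE // ltW. Qed.

Lemma nbP_mon b : nbP rho (fun x => mon (Y ^~ x) b) (tau ^+ (\sum_j b j)).
Proof.
rewrite -prodrXr; apply: nbP_prod => // j; apply: nbP_exp => //.
by apply: nbP_le (Ytau j); move: tau0; lra.
Qed.

Lemma nbP_psubst M : nbP rho (fun x => psubst F M (Y ^~ x)) B.
Proof.
rewrite -[B]mul1r; apply: (nbP_family M (W := fun a b x => 'X^a * mon (Y ^~ x) b)) => // a b.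
by rewrite mul1r exprD; apply: nbPM => //; [exact: nbPXtau | exact: nbP_mon].
Qed.

Lemma nat_half_pow (b : nat) : b%:R * (2^-1 : R) ^+ b <= 1.
Proof.
elim: b => [|b IH]; first by rewrite mul0r.
case: b IH => [|b] IH; first by rewrite mul1r expr1; lra.
rewrite exprS -natr1 mulrA mulrDl mulrDl.
have : 2^-1 ^+ b.+1 <= 1 :> R by apply: exprn_ile1; lra.
by move: IH; set u := b.+1%:R; set v := _ ^+ _; nra.
Qed.

(** Cauchy's estimate for dF/dy_j on half the polyradius: b (tau/2)^(b-1) <= (2/tau) tau^b. This is
    one reason for bounding [Y] by tau/2; the other half of tau is room for the increment [Z]. *)
Lemma nbP_dsubst M j : nbP rho (fun x => dsubst F M (Y ^~ x) j) (2 / tau * B).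
Proof.
have t20 : 0 <= 2 / tau by rewrite divr_ge0 // ltW.
apply: (nbP_family M (W := fun a b x => 'X^a * dmon (Y ^~ x) b j)) => // a b.
rewrite exprD mulrCA; apply: nbPM => //; first exact: nbPXtau.
rewrite (bigD1 j) //= exprD mulrA; apply: nbPM => //; last first.
  rewrite -prodrXr; apply: nbP_prod => // i; apply: nbP_exp => //.
  by apply: nbP_le (Ytau i); move: tau0; lra.
have H := nbPZ (b j)%:R (nbP_exp (b j).-1 rho0 (Ytau j)).
apply: nbP_ext (nbP_le _ H) => [x _|]; first by rewrite scaler_nat.
rewrite cabs_nat; case: (b j) => [|e]; first by rewrite mul0r mulr_ge0 ?exprn_ge0 // ltW.
have -> : 2 / tau * tau ^+ e.+1 = 2 * tau ^+ e by rewrite exprS; field; rewrite gt_eqF.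
have -> : e.+1%:R * (tau / 2) ^+ e.+1.-1 = 2 * tau ^+ e * (e.+1%:R * (2^-1) ^+ e.+1).
  by rewrite /= exprMn (exprS _^-1 e); field.
by rewrite ler_piMr ?nat_half_pow // mulr_ge0 ?exprn_ge0 // ltW.
Qed.

(* Weighting the linear part by 1/s and the remainder by 1/s^2 gives a
   submultiplicative bound, hence a Taylor remainder quadratic in s = 2 S / tau. *)
Lemma nbP_taylor M (Z : 'I_n.+1 -> X -> {poly C}) S : 0 < S -> S <= tau / 2 ->
  (forall j, nbP rho (Z j) S) ->
  nbP rho (fun x => \sum_(a < M) \sum_(b <- box n M) F a b *: ('X^a *
      (mon (fun j => Y j x + Z j x) b - mon (Y ^~ x) b - \sum_j dmon (Y ^~ x) b j * Z j x)))
   ((2 * S / tau) ^+ 2 * B).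
Proof.
move=> S0 Stau hZ; pose s := 2 * S / tau.
have s0 : 0 < s by rewrite divr_gt0 // mulr_gt0.
have s1 : s <= 1 by rewrite ler_pdivrMr // mul1r; lra.
pose T d (P Q L : X -> {poly C}) := exists p l q, [/\ nbP rho Q p, nbP rho L l,
   nbP rho (fun x => P x - Q x - L x) q & p + l / s + q / s ^+ 2 <= tau ^+ d].
have T1 : T 0 (fun=> 1) (fun=> 1) (fun=> 0).
  exists 1, 0, 0; split; [exact: nbP1 | exact: nbP0 | | by rewrite !mul0r !addr0].
  by apply: nbP_ext (nbP0 rho) => x _; rewrite subr0 subrr.
have TM d P Q L d' P' Q' L' : T d P Q L -> T d' P' Q' L' ->
    T (d + d')%N (fun x => P x * P' x) (fun x => Q x * Q' x)
      (fun x => Q x * L' x + L x * Q' x).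
  move=> [p [l [q [h1 h2 h3 h4]]]] [p' [l' [q' [h1' h2' h3' h4']]]].
  have [p0 l0 q0] : [/\ 0 <= p, 0 <= l & 0 <= q].
    by split; [apply: nbP_ge0 h1 | apply: nbP_ge0 h2 | apply: nbP_ge0 h3].
  have [p0' l0' q0'] : [/\ 0 <= p', 0 <= l' & 0 <= q'].
    by split; [apply: nbP_ge0 h1' | apply: nbP_ge0 h2' | apply: nbP_ge0 h3'].
  exists (p * p'), (p * l' + l * p'), (p * q' + q * p' + l * l' + l * q' + q * l' + q * q').
  split; [exact: nbPM | by apply: nbPD; apply: nbPM | | ].
    have H := nbPD (nbPD (nbPD (nbPD (nbPD (nbPM rho0 h1 h3') (nbPM rho0 h3 h1'))
      (nbPM rho0 h2 h2')) (nbPM rho0 h2 h3')) (nbPM rho0 h3 h2')) (nbPM rho0 h3 h3').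
    by apply: nbP_ext H => x _; ring.
  rewrite exprD; have ls0 : 0 <= l / s by rewrite divr_ge0 // ltW.
  have ls0' : 0 <= l' / s by rewrite divr_ge0 // ltW.
  have qs0 : 0 <= q / s ^+ 2 by rewrite divr_ge0 // exprn_ge0 // ltW.
  have qs0' : 0 <= q' / s ^+ 2 by rewrite divr_ge0 // exprn_ge0 // ltW.
  apply: le_trans (ler_pM _ _ h4 h4'); rewrite ?addr_ge0 //.
  have El : l = l / s * s by rewrite divfK // gt_eqF.
  have El' : l' = l' / s * s by rewrite divfK // gt_eqF.
  have Eq : q = q / s ^+ 2 * s ^+ 2 by rewrite divfK // expf_neq0 // gt_eqF.
  have Eq' : q' = q' / s ^+ 2 * s ^+ 2 by rewrite divfK // expf_neq0 // gt_eqF.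
  move: (l / s) (l' / s) (q / s ^+ 2) (q' / s ^+ 2) El El' Eq Eq' ls0 ls0' qs0 qs0'.
  move=> lam lam' kap kap' -> -> -> -> ls0 ls0' qs0 qs0'.
  have -> : (p * (lam' * s) + lam * s * p') / s = p * lam' + lam * p'.
    by field; rewrite gt_eqF.
  have -> : (p * (kap' * s ^+ 2) + kap * s ^+ 2 * p' + lam * s * (lam' * s) +
      lam * s * (kap' * s ^+ 2) + kap * s ^+ 2 * (lam' * s) + kap * s ^+ 2 * (kap' * s ^+ 2)) / s ^+ 2 =
      p * kap' + kap * p' + lam * lam' + lam * kap' * s + kap * lam' * s + kap * kap' * s ^+ 2.
    by field; rewrite gt_eqF.
  have a1 : lam * kap' * s <= lam * kap' by rewrite ler_piMr ?mulr_ge0.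
  have a2 : kap * lam' * s <= kap * lam' by rewrite ler_piMr ?mulr_ge0.
  have a3 : kap * kap' * s ^+ 2 <= kap * kap'.
    by rewrite ler_piMr ?mulr_ge0 // exprn_ile1 // ltW.
  by rewrite !mulrDl !mulrDr; lra.
have TB j : T 1%N (fun x => Y j x + Z j x) (Y j) (Z j).
  (* By the choice of [s], S / s = tau / 2, so the value and the linear part of one variable
     together use up exactly tau. *)
  exists (tau / 2), S, 0; split => //.
    apply: nbP_ext (nbP0 rho) => x _.
    by ring.
  rewrite mul0r addr0 expr1 /s.
  have -> : S / (2 * S / tau) = tau / 2 by field; rewrite !gt_eqF.
  lra.
apply: (nbP_family M (W := fun a b x => 'X^a *
      (mon (fun j => Y j x + Z j x) b - mon (Y ^~ x) b - \sum_j dmon (Y ^~ x) b j * Z j x))).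
  by rewrite exprn_ge0 // ltW.
move=> a b; have [p [l [q [h1 h2 h3 h4]]]] := @taylor_mon _ n X T T1 TM Y Z b TB.
rewrite exprD mulrCA; apply: nbPM => //; first exact: nbPXtau.
apply: nbP_le h3; rewrite -/s mulrC -ler_pdivrMr ?exprn_gt0 //.
apply: le_trans h4.
have : 0 <= l / s by rewrite divr_ge0 ?(ltW s0) // (nbP_ge0 h2).
by have := nbP_ge0 h1; lra.
Qed.

End Bounds.

Lemma sum_geom_tail (q : R) N K : 0 <= q -> q <= 1 / 2 ->
  \sum_(N <= k < K) q ^+ k <= 2 * q ^+ N.
Proof.
move=> q0 q2.
have [KN|NK] := leqP K N; first by rewrite big_geq // mulr_ge0 ?exprn_ge0.
rewrite -(subnK (ltnW NK)) addnC; elim: (K - N)%N => [|d IH].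
  by rewrite addn0 big_geq // mulr_ge0 ?exprn_ge0.
suff : \sum_(N <= k < N + d.+1) q ^+ k <= 2 * q ^+ N - q ^+ (N + d).
  by have := exprn_ge0 (N + d) q0; lra.
elim: d {IH} => [|d IH].
  by rewrite addn1 big_nat1 addn0; lra.
rewrite [X in \sum_(N <= k < X) _]addnS big_nat_recr ?leq_addr //=.
apply: (@le_trans _ _ (2 * q ^+ N - q ^+ (N + d) + q ^+ (N + d).+1)).
  by rewrite addnS lerD2r -addnS.
rewrite addnS exprS; have := exprn_ge0 (N + d) q0; nra.
Qed.

(** The term [C0 * A0 ^+ k] leaves room for initial data on a path; on a disc it is 0. The terms of
    index at least [N] are estimated as one block: if their sum at radius rho is at most eta, the
    bounds that the linear equations return sum to at most rho eta Q, which is again at most eta. *)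
Theorem majorant_growth n (F : nat -> {ffun 'I_n.+1 -> nat} -> C)
    (c : 'I_n.+1 -> nat -> X -> C) (m N : nat) (K0 C0 A0 : R) :
  mps_convergent F -> (forall j x, c j 0%N x = 0) -> (m.+1 < N)%N ->
  0 <= K0 -> 0 <= C0 -> 0 <= A0 ->
  (forall k x, Dm x -> subst_coef F (fun j i => c j i x) k = 0) ->
  (forall j k x, Dm x -> (k < m)%N -> subst_coef (dpart F j) (fun j i => c j i x) k = 0) ->
  (forall j k, exists u, nb k (c j k) u) ->
  (forall k f u, (N <= k)%N -> nb (m + k) f u ->
    (forall x, Dm x -> \sum_j subst_coef (dpart F j) (fun j i => c j i x) m * c j k x = f x) ->
    forall j, nb k (c j k) (K0 * (u + C0 * A0 ^+ k))) ->
  exists C1 A1 : R, [/\ 0 <= C1, 0 < A1 & forall j k, nb k (c j k) (C1 * A1 ^+ k)].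
Proof.
move=> [tau [tau0 [B FB']]] c0 mN K00 C00 A00 hF hdF fin lin.
have FB M : \sum_(a < M) \sum_(b <- box n M) cabs (F a b) * tau ^+ (a + \sum_j b j) <= B.
  apply: le_trans (FB' M); apply: ler_sum => a _; rewrite sum_boxE.
  apply: ler_sum => b _; rewrite le_eqVlt; apply/orP; left; apply/eqP.
  by congr (_ * _ ^+ (_ + _)%N); apply: eq_bigr => i _; rewrite ffunE.
have B0 : 0 <= B by have := FB 0%N; rewrite big_ord0.
have [u0 hu0] : exists u0 : 'I_n.+1 -> nat -> R, forall j k, nb k (c j k) (u0 j k).
  have /choice[f hf] : forall jk : 'I_n.+1 * nat, exists u, nb jk.2 (c jk.1 jk.2) u.
    by move=> [j k]; exact: fin.
  by exists (fun j k => f (j, k)) => j k; exact: hf (j, k).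
pose U k : R := \sum_j u0 j k.
have U0 k : 0 <= U k by apply: sumr_ge0 => j _; apply: nb_ge0 (hu0 j k).
have hU j k : nb k (c j k) (U k).
  apply: nb_le (hu0 j k); rewrite /U (bigD1 j) //= lerDl.
  by apply: sumr_ge0 => i _; apply: nb_ge0 (hu0 i k).
pose SU := \sum_(i < N) U i.
have SU0 : 0 <= SU by apply: sumr_ge0.
(* At this radius the first [N] terms have norm at most tau/2, so that F can be expanded about
   them. *)
pose sigma := Num.min 1 (Num.min (tau / 2) (tau / 2 / (1 + SU))).
have t20 : 0 < tau / 2 by lra.
have sig0 : 0 < sigma by rewrite !lt_min ltr01 t20 divr_gt0 //; lra.
have sig1 : sigma <= 1 by rewrite ge_min lexx.
have sigt : sigma <= tau / 2 by rewrite !ge_min lexx orbT.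
have sigU : SU * sigma <= tau / 2.
  have h : sigma <= tau / 2 / (1 + SU) by rewrite !ge_min lexx !orbT.
  rewrite ler_pdivlMr in h; last by lra.
  by move: h; rewrite mulrDr mulr1 [sigma * SU]mulrC; lra.
have hY rho : 0 <= rho -> rho <= sigma -> forall j,
    nbP rho (fun x => trunc_ser (fun j i => c j i x) N j) (tau / 2).
  move=> r0 rs j.
  apply: (@nbP_poly rho N (c j) (fun i => if i == 0%N then 0 else U i)) => //.
    move=> i _; case: eqVneq => [->|_]; last exact: hU.
    by apply: nb_ext (nb0 0) => x _; rewrite c0.
  apply: le_trans sigU; rewrite mulr_suml; apply: ler_sum => i _.
  case: eqVneq => [_|i0]; first by rewrite mul0r mulr_ge0 // ltW.
  rewrite ler_wpM2l //; apply: (@le_trans _ _ rho) => //.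
  by rewrite ler_iXnr ?lt0n // (le_trans rs).
(* After extraction of rho eta, the four summands come from F at the truncation in high degrees,
   from its derivatives in high degrees times [Z], from the quadratic Taylor remainder, and from the
   initial data. *)
pose Q := K0 * (sigma ^- (m + N) * B + n.+1%:R * (sigma ^- m.+1 * (2 / tau * B))
   + 4 * B / tau ^+ 2) + 2 * K0 * C0 * A0 ^+ N.
have Q0 : 0 <= Q.
  by rewrite /Q; do ?[done | exact: ltW | rewrite ler0n | rewrite invr_ge0 | apply: exprn_ge0 |
    apply: addr_ge0 | apply: mulr_ge0].
pose rho := Num.min sigma (Num.min (1 / (1 + Q)) (1 / (2 * (1 + A0)))).
have rho0 : 0 < rho.
  by rewrite /rho lt_min sig0 lt_min !divr_gt0 //; lra.
have rhos : rho <= sigma by rewrite ge_min lexx.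
have rho1 : rho <= 1 by lra.
have rhoQ : rho * Q <= 1.
  have h : rho <= 1 / (1 + Q) by rewrite !ge_min lexx !orbT.
  rewrite ler_pdivlMr in h; last by lra.
  by move: h; rewrite mulrDr mulr1; lra.
have rhoA : A0 * rho <= 1 / 2.
  have h : rho <= 1 / (2 * (1 + A0)) by rewrite !ge_min lexx !orbT.
  rewrite ler_pdivlMr in h; last by lra.
  by nra.
(* With this exponent, division by rho^m turns eta^2 into rho eta, and N > m + 1 makes rho^N at most
   rho eta: every contribution keeps a spare factor rho. *)
pose eta := rho ^+ m.+1.
have eta0 : 0 < eta by rewrite exprn_gt0.
have etat : eta <= tau / 2.
  apply: le_trans sigt; apply: le_trans rhos.
  by rewrite /eta exprS ler_piMr ?(ltW rho0) // exprn_ile1 // ltW.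
(* The bounds of index at least [N] are recomputed for each K from the whole system of equations
   instead of being extended by one term; the induction controls only their weighted sum. *)
have claim K : (N <= K)%N -> exists u : nat -> R,
    [/\ forall j k, (k < K)%N -> nb k (c j k) (u k), (forall k, (k < N)%N -> u k = U k)
      & \sum_(N <= k < K) u k * rho ^+ k <= eta].
  elim: K => [|K IH].
    by rewrite leqn0 => /eqP N0; rewrite N0 in mN.
  rewrite leq_eqVlt ltnS => /orP[/eqP <-|NK].
    by exists U; split=> [j k _|//|]; [exact: hU | rewrite big_geq // ltW].
  have [u [hu huN hsum]] := IH NK.
  have mK : (m < K)%N := leq_trans (ltnW mN) NK.
  pose M := (m + K).+2.
  pose ct x := fun j i => c j i x.
  pose Y j x := trunc_ser (ct x) N j.
  pose Z j x := trunc_ser (ct x) K j - trunc_ser (ct x) N j.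
  have hYr j : nbP rho (Y j) (tau / 2) by apply: hY => //; exact: ltW.
  have hYs j : nbP sigma (Y j) (tau / 2) by apply: hY => //; exact: ltW.
  have hZ j : nbP rho (Z j) eta.
    have H : nbP rho (fun x => \poly_(i < K) (if (i < N)%N then 0 else c j i x)) eta.
      apply: (@nbP_poly rho K (fun i x => if (i < N)%N then 0 else c j i x)
         (fun i => if (i < N)%N then 0 else u i)) => //.
      - exact: ltW.
      - move=> i iK; case: ltnP => _; [exact: nb0 | exact: hu].
      rewrite (sum_ord_split (fun i => (if (i < N)%N then 0 else u i) * rho ^+ i) NK).
      rewrite big1 ?add0r => [|i _]; last by rewrite ltn_ord mul0r.
      apply: le_trans hsum; rewrite big_nat [leRHS]big_nat.
      by apply: ler_sum => i /andP[Ni _]; rewrite ltnNge Ni.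
    apply: nbP_ext H => x _; apply/polyP => i; rewrite coefB !coef_poly.
    have [iN|Ni] := ltnP i N; first by rewrite (leq_trans iN NK) /ct subrr.
    by rewrite subr0.
  pose G x := psubst F M (trunc_ser (ct x) K) -
     \sum_j subst_coef (dpart F j) (ct x) m *: ('X^m * trunc_ser (ct x) K j).
  pose hi d (p : {poly C}) : {poly C} := \poly_(i < size p) (if (i < d)%N then 0 else p`_i).
  have hiE d (p : {poly C}) i : (hi d p)`_i = if (i < d)%N then 0 else p`_i.
    by rewrite coef_poly; case: ltnP => // sP; rewrite nth_default ?if_same.
  pose Rem x := \sum_(a < M) \sum_(b <- box n M) F a b *: ('X^a *
      (mon (fun j => Y j x + Z j x) b - mon (Y ^~ x) b - \sum_j dmon (Y ^~ x) b j * Z j x)).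
  (* [H] agrees with [G] in degrees at least m + N, and its pieces have their low coefficients
     removed, so that the gain from shrinking the radius applies to them. *)
  pose H x := hi (m + N)%N (psubst F M (Y ^~ x)) +
     \sum_j hi m.+1 (dsubst F M (Y ^~ x) j) * Z j x + Rem x.
  have nbH : nbP rho H ((rho / sigma) ^+ (m + N) * B +
     \sum_(j < n.+1) (rho / sigma) ^+ m.+1 * (2 / tau * B) * eta + (2 * eta / tau) ^+ 2 * B).
    apply: nbPD; first apply: nbPD.
    - apply: (nbP_high rho0 rhos (nbP_psubst tau0 FB (ltW sig0) _ hYs M)); first by lra.
      + by move=> x p _ pd; rewrite hiE pd.
      + by move=> x p _ pd; rewrite hiE ltnNge pd.
    - apply: nbP_sum => j; apply: nbPM => //; first exact: ltW.
      apply: (nbP_high rho0 rhos (nbP_dsubst tau0 FB (ltW sig0) _ hYs M j)); first by lra.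
      + by move=> x p _ pd; rewrite hiE pd.
      + by move=> x p _ pd; rewrite hiE ltnNge pd.
    - apply: (nbP_taylor tau0 FB (ltW rho0) _ hYr) => //; first by lra.
  have GH x p : Dm x -> (m + N <= p)%N -> (G x)`_p = (H x)`_p.
    move=> Dx pd.
    have -> : G x = psubst F M (Y ^~ x) - \sum_j subst_coef (dpart F j) (ct x) m *: ('X^m * Y j x)
       + \sum_j (dsubst F M (Y ^~ x) j - subst_coef (dpart F j) (ct x) m *: 'X^m) * Z j x + Rem x.
      rewrite /G; have -> : trunc_ser (ct x) K = (fun j => Y j x + Z j x).
        by apply/funext => j; rewrite /Y /Z addrC subrK.
      rewrite psubst_taylor -/(Rem x).
      have -> : \sum_j subst_coef (dpart F j) (ct x) m *: ('X^m * (Y j x + Z j x)) =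
         \sum_j subst_coef (dpart F j) (ct x) m *: ('X^m * Y j x) +
         \sum_j subst_coef (dpart F j) (ct x) m *: 'X^m * Z j x.
        by rewrite -big_split; apply: eq_bigr => j _ /=; rewrite mulrDr scalerDr -scalerAl.
      have -> : \sum_j (dsubst F M (Y ^~ x) j - subst_coef (dpart F j) (ct x) m *: 'X^m) * Z j x =
         \sum_j dsubst F M (Y ^~ x) j * Z j x - \sum_j subst_coef (dpart F j) (ct x) m *: 'X^m * Z j x.
        by rewrite -sumrB; apply: eq_bigr => j _; rewrite mulrBl.
      move: (psubst _ _ _) (\sum_j _ * Z j x) (\sum_j _ *: _) (\sum_j _ * Z j x) (Rem x).
      by move=> p1 p2 p3 p4 p5; ring.
    rewrite !coefD; congr (_ + _ + _).
      have -> : (- \sum_j subst_coef (dpart F j) (ct x) m *: ('X^m * Y j x))`_p = 0.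
        rewrite coefN coef_sum big1 ?oppr0 // => j _; rewrite coefZ coefXnM coef_poly.
        have mp := leq_trans (leq_addr N m) pd.
        have Np : (N <= p - m)%N by rewrite leq_subRL.
        by rewrite ltnNge mp /= ltnNge Np mulr0.
      by rewrite addr0 hiE ltnNge pd.
    have -> : \sum_j (dsubst F M (Y ^~ x) j - subst_coef (dpart F j) (ct x) m *: 'X^m) * Z j x =
       \sum_j hi m.+1 (dsubst F M (Y ^~ x) j) * Z j x => //.
    (* Below degree m the derivative has no coefficients, and its coefficient of degree m is the
       subtracted one; the difference is therefore exactly its part of degree above m. *)
    apply: eq_bigr => j _; congr (_ * _).
    apply/polyP => i; rewrite hiE coefB coefZ coefXn ltnS.
    have [im|mi] := leqP i m; last by rewrite gtn_eqF // mulr0 subr0.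
    have iN : (i < N)%N := leq_ltn_trans im (ltnW mN).
    have iM : (i.+1 < M)%N by rewrite /M !ltnS (leq_trans im (leq_addr _ _)).
    rewrite (dsubst_trunc F (c := ct x) (fun j => c0 j x) j iN iM).
    have [->|im'] := eqVneq i m; first by rewrite mulr1 subrr.
    by rewrite mulr0 subr0 hdF // ltn_neqAle im'.
  have [e [he hes]] := nbH.
  pose u' k := if (k < N)%N then U k else K0 * (e (m + k)%N + C0 * A0 ^+ k).
  exists u'; split.
  - move=> j k; rewrite ltnS /u' => kK; case: ltnP => Nk; first exact: hU.
    apply: (lin k (fun x => - 1 * (H x)`_(m + k))) => //.
      by have := nbZ (- 1) (he (m + k)%N); rewrite cabsN cabs1 mul1r.
    move=> x Dx; rewrite mulN1r -GH // ?leq_add2l //.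
    apply: (linearized_eq (c := ct x)) => //; [by move=> ?; rewrite /ct c0 | | by move=> k'; apply: hF].
    by move=> j' k' k'm; apply: hdF.
  - by move=> k kN; rewrite /u' kN.
  have -> : \sum_(N <= k < K.+1) u' k * rho ^+ k =
     K0 * (\sum_(N <= k < K.+1) e (m + k)%N * rho ^+ k) + K0 * C0 * \sum_(N <= k < K.+1) (A0 * rho) ^+ k.
    rewrite !mulr_sumr -big_split; apply: eq_big_nat => k /andP[Nk _] /=.
    by rewrite /u' ltnNge Nk /= exprMn; ring.
  have t1 : \sum_(N <= k < K.+1) (A0 * rho) ^+ k <= 2 * (A0 * rho) ^+ N.
    by apply: sum_geom_tail => //; rewrite mulr_ge0 // ltW.
  have t2 : \sum_(N <= k < K.+1) e (m + k)%N * rho ^+ k <= rho ^- m * ((rho / sigma) ^+ (m + N) * B +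
     \sum_(j < n.+1) (rho / sigma) ^+ m.+1 * (2 / tau * B) * eta + (2 * eta / tau) ^+ 2 * B).
    apply: le_trans (ler_wpM2l _ (hes (m + K.+1)%N)); last by rewrite invr_ge0 exprn_ge0 // ltW.
    have en p : 0 <= e p by apply: nb_ge0 (he p).
    rewrite (sum_ord_split (fun p => e p * rho ^+ p) (leq_addr K.+1 m)) mulrDr.
    apply: (@le_trans _ _ (rho ^- m * \sum_(m <= p < m + K.+1) e p * rho ^+ p)); last first.
      rewrite lerDr mulr_ge0 ?invr_ge0 ?exprn_ge0 ?(ltW rho0) //.
      by apply: sumr_ge0 => p _; rewrite mulr_ge0 ?exprn_ge0 ?(ltW rho0).
    have -> : \sum_(m <= p < m + K.+1) e p * rho ^+ p =
        \sum_(0 <= p < K.+1) e (m + p)%N * rho ^+ (m + p).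
      by rewrite /index_iota addKn subn0 -{1}[m]addn0 iotaDl big_map.
    rewrite mulr_sumr.
    rewrite [leRHS](big_cat_nat (leq0n _) (leqW NK)) /=.
    rewrite -[leLHS]add0r; apply: lerD.
      apply: sumr_ge0 => p _; rewrite !mulr_ge0 ?invr_ge0 ?exprn_ge0 ?(ltW rho0) //.
    apply: ler_sum => p _; rewrite exprD.
    have -> : rho ^- m * (e (m + p)%N * (rho ^+ m * rho ^+ p)) = e (m + p)%N * rho ^+ p.
      by field; rewrite expf_neq0 // gt_eqF.
    by [].
  apply: (@le_trans _ _ (rho * eta * Q)); last first.
    by rewrite mulrAC -[leRHS]mul1r ler_wpM2r // ltW.
  have Es (z : R) : \sum_(j < n.+1) z = n.+1%:R * z by rewrite sumr_const card_ord mulr_natl.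
  rewrite Es in t2.
  have r2 : rho ^+ N <= rho * eta by rewrite /eta -exprS; apply: ler_wiXn2l => //; exact: ltW.
  have E1 : rho ^- m * ((rho / sigma) ^+ (m + N) * B) = rho ^+ N * (sigma ^- (m + N) * B).
    by rewrite expr_div_n exprD; field; rewrite !expf_neq0 ?gt_eqF.
  have E2 : rho ^- m * ((rho / sigma) ^+ m.+1 * (2 / tau * B) * eta) = rho * eta * (sigma ^- m.+1 * (2 / tau * B)).
    by rewrite expr_div_n [rho ^+ m.+1]exprS; field; rewrite !expf_neq0 ?gt_eqF.
  have E3 : rho ^- m * ((2 * eta / tau) ^+ 2 * B) = rho * eta * (4 * B / tau ^+ 2).
    by rewrite {1 2}/eta [rho ^+ m.+1]exprS; field; rewrite !expf_neq0 ?gt_eqF.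
  rewrite 2!mulrDr E1 E3 [rho ^- m * (n.+1%:R * _)]mulrCA E2 in t2.
  have s1 : rho ^+ N * (sigma ^- (m + N) * B) <= rho * eta * (sigma ^- (m + N) * B).
    by rewrite ler_wpM2r // mulr_ge0 // invr_ge0 exprn_ge0 // ltW.
  have s2 : 2 * (A0 * rho) ^+ N <= rho * eta * (2 * A0 ^+ N).
    rewrite exprMn mulrA mulrC ler_wpM2r // mulr_ge0 // exprn_ge0 //.
  have f1 := ler_wpM2l K00 (le_trans t2 (lerD (lerD s1 (lexx _)) (lexx _))).
  have f2 := ler_wpM2l (mulr_ge0 K00 C00) (le_trans t1 s2).
  apply: le_trans (lerD f1 f2) _; rewrite le_eqVlt; apply/orP; left; apply/eqP.
  by rewrite /Q; ring.
exists (eta + SU), rho^-1; split; [by rewrite addr_ge0 // ltW | by rewrite invr_gt0 |].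
move=> j k; have [kN|Nk] := ltnP k N.
  apply: nb_le (hU j k); apply: (@le_trans _ _ SU).
    by rewrite /SU (bigD1 (Ordinal kN)) //= lerDl sumr_ge0.
  rewrite exprVn -[leLHS]mulr1; apply: ler_pM => //; first by rewrite lerDr ltW.
  by rewrite invf_ge1 ?exprn_gt0 // exprn_ile1 // ltW.
have [u [hu _ hs]] := claim k.+1 (leqW Nk).
apply: nb_le (hu j k (ltnSn k)); rewrite exprVn ler_pdivlMr ?exprn_gt0 //.
rewrite big_nat_recr //= in hs.
have : 0 <= \sum_(N <= i < k) u i * rho ^+ i.
  rewrite big_nat; apply: sumr_ge0 => i /andP[_ ik].
  by rewrite mulr_ge0 ?exprn_ge0 ?(ltW rho0) // (nb_ge0 (hu j i _)) // ltnW.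
by move: hs SU0; lra.
Qed.

End Majorant.

(** * Zeros of power series *)

Section Zeros.
Variable R : realType.
Local Notation C := R[i].
Implicit Types (f g : nat -> C) (z t : C) (rho B M : R).

Lemma sum_geom2 (x y : R) (i : nat) :
  (x - y) * \sum_(l < i) x ^+ l * y ^+ (i.-1 - l) = x ^+ i - y ^+ i.
Proof.
rewrite -[RHS]opprB subrXX -mulNr opprB; congr (_ * _).
by apply: eq_bigr => l _; rewrite mulrC.
Qed.

(** The quotient has coefficients -z^(-l-1) S_(l+1), with S the partial sums of [f] at z. As the
    whole sum is 0, S_(l+1) is minus a tail, and interchanging the double sum leaves sum_i |f_i|
    (rho^i - |z|^i) / (rho - |z|). The radius is not reduced, so the division can be repeated. *)
Lemma ps_div f z rho B : 0 < cabs z -> cabs z < rho -> bdd f rho B -> ps f z = 0 ->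
  exists g, [/\ bdd g rho (B / (rho - cabs z)), ps f z = 0, f 0%N = - z * g 0%N
   & forall t, cabs t <= rho -> ps f t = (t - z) * ps g t].
Proof.
move=> z0 zr h fz.
have r0 : 0 < rho := lt_trans z0 zr.
have zn0 : z != 0 by rewrite -cabs_gt0.
pose S n := \sum_(i < n) f i * z ^+ i.
pose g l := - (z ^- l.+1 * S l.+1).
have Sg l : f l.+1 = g l - z * g l.+1.
  rewrite /g /S [in X in _ = _ - _ * X]big_ord_recr /= [z ^+ l.+2]exprS.
  by field; rewrite expf_neq0.
have f0 : f 0%N = - z * g 0%N by rewrite /g /S big_ord1 expr1 expr0 mulr1 mulrNN mulVKf.
have hg : bdd g rho (B / (rho - cabs z)).
  move=> N; apply/ler_addgt0Pr => e e0.
  have S0 : series_to (fun i => f i * z ^+ i) 0.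
    by rewrite -fz; apply: csumP; apply: bdd_abs h; exact: ltW.
  (* Tails are cut at a finite index L, where S_L is small but not 0; its total contribution over l
     < N is at most e/(K+1) times K. *)
  pose K := \sum_(l < N) rho ^+ l / cabs z ^+ l.+1.
  have K0 : 0 <= K by apply: sumr_ge0 => l _; rewrite divr_ge0 ?exprn_ge0 ?cabs_ge0 // ltW.
  have K10 : 0 < K + 1 by move: K0; lra.
  have e10 : 0 < e / (K + 1) by rewrite divr_gt0.
  have [N1 hN1] := S0 _ e10.
  pose L := maxn N1 N.
  have NL : (N <= L)%N by exact: leq_maxr.
  have SL : cabs (S L) <= e / (K + 1) by apply: ltW; have := hN1 L (leq_maxl _ _); rewrite subr0.
  have term l : (l < N)%N -> cabs (g l) * rho ^+ l <= e / (K + 1) * (rho ^+ l / cabs z ^+ l.+1) +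
      \sum_(i < L) (if (l < i)%N then cabs (f i) * (rho ^+ l * cabs z ^+ (i.-1 - l)) else 0).
    move=> lN; have lL : (l.+1 <= L)%N by apply: leq_trans NL.
    have S1 : cabs (S l.+1) <= e / (K + 1) + \sum_(l.+1 <= i < L) cabs (f i) * cabs z ^+ i.
      have -> : S l.+1 = S L - \sum_(l.+1 <= i < L) f i * z ^+ i.
        by rewrite /S (sum_ord_split (fun i => f i * z ^+ i) lL) addrK.
      apply: le_trans (cabsD _ _) _; rewrite cabsN; apply: lerD => //.
      apply: le_trans (cabs_sum _ _ _) _; apply: ler_sum => i _.
      by rewrite cabsM cabsX.
    rewrite /g cabsN cabsM cabsV cabsX.
    have zl : 0 < cabs z ^+ l.+1 by rewrite exprn_gt0.
    have -> : \sum_(i < L) (if (l < i)%N then cabs (f i) * (rho ^+ l * cabs z ^+ (i.-1 - l)) else 0) =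
       (rho ^+ l / cabs z ^+ l.+1) * \sum_(l.+1 <= i < L) cabs (f i) * cabs z ^+ i.
      rewrite (sum_ord_split (fun i => if (l < i)%N then cabs (f i) * (rho ^+ l * cabs z ^+ (i.-1 - l)) else 0) lL).
      rewrite big1 ?add0r => [|i _]; last by rewrite ltnNge -ltnS ltn_ord.
      rewrite mulr_sumr; apply: eq_big_nat => i /andP[li iL]; rewrite li.
      have -> : cabs z ^+ i = cabs z ^+ l.+1 * cabs z ^+ (i.-1 - l).
        by rewrite -exprD; congr (_ ^+ _); case: i li {iL} => // i li; rewrite addSn subnKC.
      by field; rewrite gt_eqF.
    rewrite [leRHS](_ : _ = rho ^+ l * ((cabs z ^+ l.+1)^-1 *
      (e / (K + 1) + \sum_(l.+1 <= i < L) cabs (f i) * cabs z ^+ i))); last by ring.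
    rewrite [leLHS](_ : _ = rho ^+ l * ((cabs z ^+ l.+1)^-1 * cabs (S l.+1))); last by ring.
    rewrite ler_wpM2l ?exprn_ge0 ?(ltW r0) // ler_wpM2l //.
    by rewrite invr_ge0 ltW.
  apply: (@le_trans _ _ (\sum_(l < N) (e / (K + 1) * (rho ^+ l / cabs z ^+ l.+1) +
      \sum_(i < L) (if (l < i)%N then cabs (f i) * (rho ^+ l * cabs z ^+ (i.-1 - l)) else 0)))).
    by apply: ler_sum => l _; exact: term.
  rewrite big_split /= -mulr_sumr -/K addrC; apply: lerD; last first.
    by rewrite mulrAC ler_pdivrMr // mulrDr mulr1 lerDl ltW.
  rewrite exchange_big /= ler_pdivlMr ?subr_gt0 //.
  apply: le_trans (h L); rewrite mulr_suml; apply: ler_sum => i _.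
  rewrite -big_mkcond /= -mulr_sumr -mulrA ler_wpM2l ?cabs_ge0 // mulrC.
  have := sum_geom2 rho (cabs z) i => G.
  apply: (@le_trans _ _ (rho ^+ i - cabs z ^+ i)); last by rewrite gerBl exprn_ge0 // ltW.
  rewrite -G ler_wpM2l ?subr_ge0 ?(ltW zr) //.
  pose F l := if (l < i)%N then rho ^+ l * cabs z ^+ (i.-1 - l) else 0.
  have F0 l : 0 <= F l by rewrite /F; case: ifP => // _; rewrite mulr_ge0 ?exprn_ge0 ?cabs_ge0 ?(ltW r0).
  have -> : \sum_(l < N | (l < i)%N) rho ^+ l * cabs z ^+ (i.-1 - l) = \sum_(l < N) F l by rewrite big_mkcond.
  have -> : \sum_(l < i) rho ^+ l * cabs z ^+ (i.-1 - l) = \sum_(l < i) F l.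
    by apply: eq_bigr => l _; rewrite /F ltn_ord.
  have [iN|Ni] := leqP i N.
    rewrite (sum_ord_split F iN) [X in _ + X]big_nat [X in _ + X]big1 ?addr0 // => l /andP[il _].
    by rewrite /F ltnNge il.
  by rewrite [leRHS](sum_ord_split F (ltnW Ni)) lerDl sumr_ge0.
exists g; split=> // t tr.
have Ef : f = (fun l => cshift 1 g l + - z * g l).
  apply/funext => -[|l]; first by rewrite /cshift /= add0r f0.
  by rewrite /cshift /= subSS subn0 Sg mulNr.
rewrite {1}Ef (psD tr (bdd_shift 1 (ltW r0) hg) (bddZ (- z) hg)) (ps_shift 1 tr hg) (psZ _ tr hg).
by rewrite expr1; ring.
Qed.

Lemma cabs_conj z : cabs (z^*%C) = cabs z.
Proof. by case: z => x y; rewrite /cabs /= sqrrN. Qed.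

Lemma mul_conj z : z * z^*%C = (cabs z ^+ 2)%:C%C.
Proof.
by rewrite -sqr_normc -cabs_norm rmorphXn.
Qed.

(* Dividing by a Blaschke factor keeps the modulus on |t| = rho and multiplies
   the value at 0 by at least rho / rho1, so zeros can be counted as in Jensen. *)
Lemma jensen_count f rho rho1 B M (zs : seq C) : 0 < rho1 -> rho1 < rho -> bdd f rho B ->
  (forall t, cabs t = rho -> cabs (ps f t) <= M) ->
  uniq zs -> (forall z, z \in zs -> 0 < cabs z <= rho1 /\ ps f z = 0) ->
  cabs (f 0%N) * (rho / rho1) ^+ size zs <= M.
Proof.
move=> r10 r1r; have r0 : 0 < rho := lt_trans r10 r1r.
elim: zs f B => [|z zs IH] f B h hM.
  move=> _ _; have := @cauchy_estimate _ f rho B rho M 0 r0 (lexx _) h hM.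
  by rewrite !expr0.
move=> /= /andP[zzs us] hz; have [/andP[z0 zr1] fz] := hz z (mem_head _ _).
have zr : cabs z < rho := le_lt_trans zr1 r1r.
have [g [hg _ f0 fg]] := ps_div z0 zr h fz.
(* Blaschke factor: on |t| = rho the moduli of rho - conj(z) t / rho and t - z agree, whereas at t =
   0 they are rho and |z|. *)
pose w : C := - (z^*%C / rho%:C%C).
pose k : nat -> C := fun l => rho%:C%C * g l + w * cshift 1 g l.
have hk := bddD (ltW r0) (bddZ rho%:C%C hg) (bddZ w (bdd_shift 1 (ltW r0) hg)).
have kE t : cabs t <= rho -> ps k t = (rho%:C%C + w * t) * ps g t.
  move=> tr; rewrite (psD tr (bddZ rho%:C%C hg) (bddZ w (bdd_shift 1 (ltW r0) hg))).
  rewrite (psZ _ tr hg) (psZ _ tr (bdd_shift 1 (ltW r0) hg)) (ps_shift 1 tr hg) expr1.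
  by ring.
have rC : rho%:C%C != 0 :> C by rewrite -cabs_gt0 cabs_real normr_gt0 gt_eqF.
have kM t : cabs t = rho -> cabs (ps k t) <= M.
  move=> tr; rewrite kE ?tr //; apply: le_trans (hM t tr); rewrite fg ?tr // !cabsM.
  rewrite ler_wpM2r ?cabs_ge0 // -(ler_pM2l r0).
  have -> : rho * cabs (rho%:C%C + w * t) = cabs (t * (t - z)^*%C).
    have {1}-> : rho = cabs (rho%:C%C : C) by rewrite cabs_real ger0_norm // ltW.
    rewrite -cabsM mulrDr /w; congr cabs.
    have -> : (t - z)^*%C = t^*%C - z^*%C by case: (t) (z) => [a b] [c d] /=; rewrite opprD.
    rewrite mulrBr mul_conj tr rmorphXn /= expr2; congr (_ + _).
    by rewrite mulNr mulrN mulrA mulrCA divff // mulr1 mulrC.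
  by rewrite cabsM cabs_conj tr.
have kz z' : z' \in zs -> 0 < cabs z' <= rho1 /\ ps k z' = 0.
  move=> zs'; have [/andP[z'0 z'r] fz'] : 0 < cabs z' <= rho1 /\ ps f z' = 0.
    by apply: hz; rewrite in_cons zs' orbT.
  rewrite z'0 z'r; split=> //; have z'rho : cabs z' <= rho := le_trans z'r (ltW r1r).
  move: fz'; rewrite fg // kE // => /eqP; rewrite mulf_eq0 subr_eq0 => /orP[/eqP E|/eqP ->].
    by rewrite E (negbTE zzs) in zs'.
  by rewrite mulr0.
have := IH k _ hk kM us kz.
have -> : cabs (k 0%N) = rho * cabs (g 0%N).
  by rewrite /k /cshift /= mulr0 addr0 cabsM cabs_real ger0_norm // ltW.
apply: le_trans; rewrite exprS mulrA ler_wpM2r ?exprn_ge0 ?divr_ge0 ?(ltW r0) ?(ltW r10) //.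
have -> : cabs (f 0%N) * (rho / rho1) = rho * cabs (g 0%N) * (cabs z / rho1).
  by rewrite f0 cabsM cabsN; ring.
by rewrite ler_piMr ?mulr_ge0 ?cabs_ge0 ?(ltW r0) // ler_pdivrMr // mul1r.
Qed.

(** If no finite list exhausted the zeros, there would be lists of distinct zeros of every length n,
    while |f(0)| (rho/rho1)^n stays below the bound of f. *)
Lemma zeros_finite f rho rho1 B : 0 < rho1 -> rho1 < rho -> bdd f rho B -> f 0%N != 0 ->
  exists zs : seq C, forall z, 0 < cabs z <= rho1 -> ps f z = 0 -> z \in zs.
Proof.
move=> r10 r1r h f0; apply: contrapT => nex.
have ex n : exists zs : seq C, [/\ uniq zs, size zs = n &
    forall z, z \in zs -> 0 < cabs z <= rho1 /\ ps f z = 0].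
  elim: n => [|n [zs [us sn hz]]]; first by exists [::].
  apply: contrapT => nz; apply: nex; exists zs => z zr fz.
  apply: contrapT => /negP zzs; apply: nz; exists (z :: zs); split=> /=; [by rewrite zzs|by rewrite sn|].
  by move=> z'; rewrite in_cons => /orP[/eqP ->//|/hz].
have r0 : 0 < rho := lt_trans r10 r1r.
have hM t : cabs t = rho -> cabs (ps f t) <= B by move=> tr; apply: cabs_ps h; rewrite tr.
have c0 : 0 < cabs (f 0%N) by rewrite cabs_gt0.
have q0 : 0 < rho / rho1 - 1 by rewrite subr_gt0 ltr_pdivlMr // mul1r.
pose n := Num.truncn (B / cabs (f 0%N) / (rho / rho1 - 1)).
have hn : B / cabs (f 0%N) / (rho / rho1 - 1) < n.+1%:R by exact: truncnS_gt.
have [zs [us sn hz]] := ex n.+1.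
have := jensen_count r10 r1r h hM us hz; rewrite sn; apply/negP; rewrite -ltNge.
rewrite ltr_pdivrMr // in hn.
rewrite [ltRHS]mulrC -ltr_pdivrMr //; apply: lt_le_trans hn _.
elim: n.+1 => [|k IH]; first by rewrite mul0r.
rewrite -natr1 mulrDl mul1r exprS.
have : 1 <= (rho / rho1) ^+ k by rewrite exprn_ege1 // ltW // -subr_gt0.
by move: IH q0; move: (rho / rho1) (_ ^+ k) => x y; nra.
Qed.

Lemma increasing_id (u : nat -> nat) : increasing_seq u -> forall i, (i <= u i)%N.
Proof.
move=> hu; elim=> [//|i IH]; apply: leq_ltn_trans IH _.
have := hu i.+1 i; rewrite !leEnat ltnn => /negbT; by rewrite -ltnNge.
Qed.

Lemma complex_bw (u : nat -> C) M : (forall i, cabs (u i) <= M) ->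
  exists z, forall (e : R) N, 0 < e -> exists i, (N <= i)%N /\ cabs (u i - z) < e.
Proof.
move=> hM.
have bf (v : nat -> R) : (forall i, `|v i| <= M) -> bounded_fun v.
  by move=> hv; exists M; split=> [|x Mx i _]; [exact: num_real | apply: le_trans (hv i) (ltW Mx)].
have [p hp cp] : exists2 p : nat -> nat, increasing_seq p & cvgn ((fun i => complex.Re (u i)) \o p).
  by apply: bolzano_weierstrass; apply: bf => i; apply: le_trans (cabs_ge_Re _) (hM i).
have [q hq cq] : exists2 q : nat -> nat, increasing_seq q & cvgn ((fun i => complex.Im (u (p i))) \o q).
  by apply: bolzano_weierstrass; apply: bf => i; apply: le_trans (cabs_ge_Im _) (hM _).
move/cvg_ex: cp => [x /cvgrPdist_lt hx]; move/cvg_ex: cq => [y /cvgrPdist_lt hy].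
exists (Complex x y) => e N e0; have e20 : 0 < e / 2 by rewrite divr_gt0.
have [N1 _ h1] := hx _ e20; have [N2 _ h2] := hy _ e20.
pose i := maxn N (maxn N1 N2).
exists (p (q i)); split.
  apply: leq_trans (increasing_id hp _); apply: leq_trans (increasing_id hq _).
  exact: leq_maxl.
have k1 : `|x - complex.Re (u (p (q i)))| < e / 2.
  apply: h1 => /=; apply: leq_trans (increasing_id hq _).
  by rewrite !leq_max leqnn orbT.
have k2 : `|y - complex.Im (u (p (q i)))| < e / 2.
  by apply: h2 => /=; rewrite !leq_max leqnn !orbT.
apply: le_lt_trans (cabs_le_ReIm _) _; rewrite !raddfB /= distrC [X in _ + X]distrC.
by move: k1 k2; lra.
Qed.

(** Divide f - f(z) by t - z; the norm of the quotient is the Lipschitz constant. *)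
Lemma ps_continuous f rho B z : 0 < cabs z -> cabs z < rho -> bdd f rho B ->
  exists L, 0 <= L /\ forall t, cabs t <= rho -> cabs (ps f t - ps f z) <= L * cabs (t - z).
Proof.
move=> z0 zr h; have r0 : 0 < rho := lt_trans z0 zr.
have hc : bdd (fun l => - ps f z * (l == 0%N)%:R) rho (cabs (- ps f z) * 1).
  apply: bddZ => N; case: N => [|N]; first by rewrite big_ord0.
  rewrite big_ord_recl big1 => [|i _]; last by rewrite cabs0 mul0r.
  by rewrite addr0 eqxx cabs1 mul1r.
have psc t : cabs t <= rho -> ps (fun l => f l + - ps f z * (l == 0%N)%:R) t = ps f t - ps f z.
  move=> tr; rewrite (psD tr h hc); congr (_ + _).
  rewrite /ps (@csum_delta _ (fun l => _ * t ^+ l)) ?mulr1 // => l l0.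
  by rewrite (gtn_eqF l0) mulr0 mul0r.
have fz : ps (fun l => f l + - ps f z * (l == 0%N)%:R) z = 0 by rewrite psc ?subrr // ltW.
have [g [hg _ _ hgt]] := ps_div z0 zr (bddD (ltW r0) h hc) fz.
set L := _ / _ in hg; exists L; split; first exact: bdd_ge0 hg.
move=> t tr; rewrite -psc // hgt // cabsM mulrC ler_wpM2r ?cabs_ge0 //.
exact: cabs_ps hg.
Qed.

(** Compactness by sequences: points of [P] along which |f| tends to 0 accumulate at a point of the
    closed set [P], where f vanishes by continuity. *)
Lemma ps_lower_bound f rho rho1 B (P : C -> Prop) : rho1 < rho -> bdd f rho B ->
  (forall z, P z -> 0 < cabs z <= rho1) ->
  (forall z, (forall e : R, 0 < e -> exists2 w, P w & cabs (w - z) < e) -> P z) ->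
  (forall z, P z -> ps f z != 0) ->
  exists c : R, 0 < c /\ forall z, P z -> c <= cabs (ps f z).
Proof.
move=> r1r h Pr Pcl Pn0; apply: contrapT => nex.
have ex i : exists z, P z /\ cabs (ps f z) < i.+1%:R^-1.
  apply: contrapT => nz; apply: nex; exists (i.+1%:R^-1); split; first by rewrite invr_gt0.
  by move=> z Pz; rewrite leNgt; apply/negP => lt; apply: nz; exists z.
have /choice[u hu] := ex.
have [z hz] : exists z, forall (e : R) N, 0 < e -> exists i, (N <= i)%N /\ cabs (u i - z) < e.
  by apply: (@complex_bw _ rho1) => i; have [/Pr/andP[]] := hu i.
have Pz : P z.
  by apply: Pcl => e e0; have [i [_ hi]] := hz e 0%N e0; exists (u i) => //; exact: (hu i).1.
have /andP[z0 zr1] := Pr z Pz.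
have [L [L0 hL]] := ps_continuous z0 (le_lt_trans zr1 r1r) h.
have /negP := Pn0 z Pz; apply; apply/eqP; apply: cabs_eq0_small => e e0.
pose N := Num.truncn (2 / e); have hN : 2 / e < N.+1%:R by exact: truncnS_gt.
have e1 : 0 < e / (2 * (L + 1)) by rewrite divr_gt0 // mulr_gt0 //; move: L0; lra.
have [i [Ni hi]] := hz _ N e1.
have [Pui fui] := hu i; have /andP[_ uir] := Pr _ Pui.
have a1 : cabs (ps f (u i)) <= e / 2.
  apply: le_trans (ltW fui) _; rewrite invf_ple ?posrE ?divr_gt0 // invf_div.
  by apply: le_trans (ltW hN) _; rewrite ler_nat ltnS.
have a2 := hL _ (le_trans uir (ltW r1r)).
have a3 : L * cabs (u i - z) <= e / 2.
  apply: (@le_trans _ _ ((L + 1) * (e / (2 * (L + 1))))).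
    by apply: ler_pM; rewrite ?cabs_ge0 ?(ltW hi) //; move: L0; lra.
  by rewrite le_eqVlt; apply/orP; left; apply/eqP; field; apply/lt0r_neq0; move: L0; lra.
rewrite -(subKr (ps f (u i)) (ps f z)); apply: le_trans (cabsD _ _) _; rewrite cabsN.
by move: a1 a2 a3; lra.
Qed.

End Zeros.

(** * Extension of the coefficients to a common disc *)

Lemma ffact_le (a b j n : nat) : (a <= b)%N -> (j <= n)%N -> ((a + j) ^_ j <= (b + n) ^_ n)%N.
Proof.
move=> ab jn; apply: (@leq_trans ((b + j) ^_ j)).
  elim: j {jn} => [|j IH]; first by rewrite !ffactn0.
  by rewrite !addnS !ffactSS leq_mul // ltnS leq_add2r.
rewrite -(subnK jn); elim: (n - j)%N => [|i IH]; first by rewrite add0n.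
by rewrite addSn addnS ffactSS; apply: leq_trans IH _; rewrite leq_pmull.
Qed.

(** * Growth of Taylor coefficients under a linear equation *)

Section Jets.
Variable R : realType.
Local Notation C := R[i].

Lemma sum_pow_le2 (q : R) N : 0 <= q -> q <= 1 / 2 -> \sum_(i < N) q ^+ i <= 2.
Proof.
move=> q0 q2; suff : \sum_(i < N) q ^+ i <= 2 - 2 * q ^+ N.
  by have := exprn_ge0 N q0; lra.
elim: N => [|N IH]; first by rewrite big_ord0 expr0; lra.
rewrite big_ord_recr /= exprS; have := exprn_ge0 N q0; move: IH.
by move: (\sum_(_ < _) _) (q ^+ N) => S Q; nra.
Qed.

(* Taylor coefficients v of a solution of sum_j A_j D^j v = phi with A_n(0)
   bounded below grow at most like d^-p, with d independent of v and phi. *)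
Lemma jet_growth (n : nat) (c M d0 : R) : 0 < c -> 0 <= M -> 0 < d0 ->
  exists d : R, 0 < d /\ forall (A : 'I_n.+1 -> nat -> C) (v phi : nat -> C) (M' K0 : R),
   c <= cabs (A ord_max 0%N) -> (forall j p, cabs (A j p) <= M * d0 ^- p) ->
   (forall p, cabs (phi p) <= M' * d0 ^- p) ->
   (forall p, \sum_(j < n.+1) \sum_(q < p.+1)
      A j q * (((p - q + j) ^_ j)%:R * v (p - q + j)%N) = phi p) ->
   (forall p, (p < n)%N -> cabs (v p) <= K0) -> 0 <= K0 ->
   forall p, cabs (v p) <= (K0 + 2 * M' / c) * d ^- p.
Proof.
move=> c0 M0 d00.
(* d <= 1 keeps powers of d at most 1, d <= d0/2 makes the sums over q geometric of ratio at most
   1/2, and the last bound makes all terms other than the leading one at most half of it. *)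
pose d := Num.min 1 (Num.min (d0 / 2) (c / 2 / (M * (2 * n%:R + 2 / d0) + 1))).
have n0 : 0 <= n%:R :> R by rewrite ler0n.
have D0 : 0 < M * (2 * n%:R + 2 / d0) + 1.
  apply: ltr_wpDl => //; apply: mulr_ge0 => //.
  by apply: addr_ge0; [exact: mulr_ge0 | rewrite divr_ge0 // ltW].
have dp : 0 < d by rewrite /d !lt_min ltr01 !divr_gt0.
have d1 : d <= 1 by rewrite /d ge_min lexx.
have dd0 : d <= d0 / 2 by rewrite /d !ge_min lexx orbT.
have dc : M * (2 * n%:R * d + 2 * (d / d0)) <= c / 2.
  have h : d <= c / 2 / (M * (2 * n%:R + 2 / d0) + 1) by rewrite /d !ge_min lexx !orbT.
  rewrite ler_pdivlMr // in h; apply: le_trans h.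
  rewrite [leRHS](_ : _ = M * (2 * n%:R * d + 2 * (d / d0)) + d); last by ring.
  by rewrite lerDl ltW.
exists d; split=> // A v phi M' K0 hc hA hphi eqn hv K00.
have M'0 : 0 <= M'.
  by have := le_trans (cabs_ge0 _) (hphi 0%N); rewrite expr0 invr1 mulr1.
pose K := K0 + 2 * M' / c; have K_0 : 0 <= K by rewrite addr_ge0 // divr_ge0 ?mulr_ge0 // ltW.
pose th := d / d0.
have th0 : 0 <= th by rewrite divr_ge0 // ltW.
have th2 : th <= 1 / 2 by rewrite ler_pdivrMr //; lra.
elim/ltn_ind => p IH; rewrite -/K.
have [pn|np] := ltnP p n.
  apply: le_trans (hv p pn) _; apply: (@le_trans _ _ (K * 1)).
    by rewrite mulr1 /K lerDl divr_ge0 ?mulr_ge0 // ltW.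
  by rewrite ler_wpM2l // invf_ge1 ?exprn_gt0 // exprn_ile1 // ltW.
have [p' Ep] : exists p', p = (p' + n)%N by exists (p - n)%N; rewrite subnK.
(* W = (p' + n)! / p'! multiplies the leading unknown and dominates every other falling factorial in
   the equation. *)
subst p; pose W : R := ((p' + n) ^_ n)%:R.
have W1 : 1 <= W by rewrite ler1n ffact_gt0 leq_addl.
have W0 : 0 < W by apply: lt_le_trans W1.
have dpn : 0 < d ^+ (p' + n) by rewrite exprn_gt0.
rewrite ler_pdivlMr //.
have term (j : 'I_n.+1) q : (q <= p')%N -> (p' - q + j < p' + n)%N ->
   cabs (A j q * (((p' - q + j) ^_ j)%:R * v (p' - q + j)%N)) * d ^+ (p' + n) <=
   W * (K * M * (th ^+ q * d ^+ (n - j))).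
  move=> qp lt; rewrite !cabsM cabs_nat.
  have jn : (j <= n)%N by rewrite -ltnS.
  have h1 : ((p' - q + j) ^_ j)%:R <= W.
    by rewrite ler_nat; apply: ffact_le => //; rewrite leq_subr.
  have h2 := IH _ lt; rewrite -/K in h2.
  apply: (@le_trans _ _ (M * d0 ^- q * (W * (K * d ^- (p' - q + j))) * d ^+ (p' + n))).
    rewrite ler_wpM2r ?(ltW dpn) //; apply: ler_pM; rewrite ?cabs_ge0 ?mulr_ge0 ?ler0n ?cabs_ge0 //.
    by apply: ler_pM; rewrite ?cabs_ge0.
  have -> : d ^+ (p' + n) = d ^+ (p' - q + j) * (d ^+ q * d ^+ (n - j)).
    by rewrite -!exprD; congr (_ ^+ _); move: qp jn; clear; lia.
  rewrite /th expr_div_n le_eqVlt; apply/orP; left; apply/eqP.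
  by field; rewrite !expf_neq0 ?gt_eqF.
have E := eqn p'; rewrite big_ord_recr /= big_ord_recl /= subn0 in E.
(* [S1] collects the derivatives of order below n, each gaining at least a factor d; [S2] collects
   order n with q > 0, gaining (d/d0)^q. *)
set S1 := \sum_(i < n) _ in E; set S2 := \sum_(i < p') _ in E.
have {}E : A ord_max 0%N * (W%:C%C * v (p' + n)%N) = phi p' - S1 - S2.
  by rewrite -E /W rmorph_nat; ring.
have b1 : cabs S1 * d ^+ (p' + n) <= W * (K * M * (2 * n%:R * d)).
  apply: (@le_trans _ _ (\sum_(j < n) W * (K * M * (2 * d)))); last first.
    by rewrite sumr_const card_ord -mulr_natl le_eqVlt; apply/orP; left; apply/eqP; ring.
  apply: le_trans (ler_wpM2r (ltW dpn) (cabs_sum _ _ _)) _.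
  rewrite mulr_suml; apply: ler_sum => j _.
  apply: le_trans (ler_wpM2r (ltW dpn) (cabs_sum _ _ _)) _; rewrite mulr_suml.
  apply: (@le_trans _ _ (\sum_(q < p'.+1) W * (K * M * (th ^+ q * d)))).
    apply: ler_sum => q _; have qp : (q <= p')%N by rewrite -ltnS.
    have lt : (p' - q + widen_ord (leqnSn n) j < p' + n)%N.
      by rewrite /= -addnS; apply: leq_add; rewrite ?leq_subr.
    apply: le_trans (term _ q qp lt) _; rewrite ler_wpM2l ?(ltW W0) // ler_wpM2l ?mulr_ge0 //.
    rewrite ler_wpM2l ?exprn_ge0 //=; apply: ler_iXnr => //; last exact: ltW.
    by rewrite subn_gt0.
  rewrite -!mulr_sumr ler_wpM2l ?(ltW W0) // ler_wpM2l ?mulr_ge0 // -mulr_suml.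
  by rewrite ler_wpM2r ?(ltW dp) // sum_pow_le2.
have b2 : cabs S2 * d ^+ (p' + n) <= W * (K * M * (2 * th)).
  apply: le_trans (ler_wpM2r (ltW dpn) (cabs_sum _ _ _)) _; rewrite mulr_suml.
  apply: (@le_trans _ _ (\sum_(q < p') W * (K * M * (th * th ^+ q)))).
    apply: ler_sum => q _; have qp : (bump 0 q <= p')%N by rewrite /bump /= add1n.
    have lt : (p' - bump 0 q + (ord_max : 'I_n.+1) < p' + n)%N.
      by rewrite /= ltn_add2r ltn_subrL /bump /=; apply: leq_ltn_trans (ltn_ord q).
    apply: le_trans (term _ _ qp lt) _.
    by rewrite subnn expr0 mulr1 /bump /= add1n exprS.
  rewrite -!mulr_sumr ler_wpM2l ?(ltW W0) // ler_wpM2l ?mulr_ge0 //.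
  by rewrite mulrC ler_wpM2r // sum_pow_le2.
have b3 : cabs (phi p') * d ^+ (p' + n) <= W * M'.
  apply: (@le_trans _ _ (M' * (th ^+ p' * d ^+ n))).
    apply: le_trans (ler_wpM2r (ltW dpn) (hphi p')) _.
    by rewrite exprD /th expr_div_n le_eqVlt; apply/orP; left; apply/eqP; ring.
  rewrite -[leLHS]mul1r; apply: ler_pM => //.
    by rewrite !mulr_ge0 ?exprn_ge0 // ltW.
  rewrite -[leRHS]mulr1 ler_wpM2l //; apply: mulr_ile1; rewrite ?exprn_ge0 ?exprn_ile1 //; try exact: ltW.
  by move: th2; lra.
have : c * W * (cabs (v (p' + n)%N) * d ^+ (p' + n)) <= W * (c * K).
  apply: (@le_trans _ _ (cabs (A ord_max 0%N * (W%:C%C * v (p' + n)%N)) * d ^+ (p' + n))).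
    rewrite !cabsM cabs_real (ger0_norm (ltW W0)) -!mulrA.
    by rewrite ler_wpM2r // !mulr_ge0 ?cabs_ge0 ?(ltW W0) ?(ltW dpn).
  rewrite E; apply: (@le_trans _ _ ((cabs (phi p') + cabs S1 + cabs S2) * d ^+ (p' + n))).
    rewrite ler_wpM2r ?(ltW dpn) //; apply: le_trans (cabsD _ _) _; rewrite cabsN lerD2r.
    by apply: le_trans (cabsD _ _) _; rewrite cabsN.
  rewrite !mulrDl; apply: le_trans (lerD (lerD b3 b1) b2) _.
  rewrite -!mulrDr ler_wpM2l ?(ltW W0) // -addrA -mulrDr -mulrA.
  have h1 := ler_wpM2l K_0 dc.
  have h2 : M' <= c * K / 2.
    rewrite /K mulrDr mulrDl [c * (_ / c)](_ : _ = 2 * M'); last by field; rewrite gt_eqF.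
    have : 0 <= c * K0 / 2 by rewrite divr_ge0 // mulr_ge0 // ltW.
    lra.
  by move: h1 h2; rewrite -/th; lra.
by rewrite -mulrA mulrCA ler_pM2l // ler_pM2l.
Qed.

Lemma expR_le_partial (x S : R) : (forall P, \sum_(p < P) x ^+ p / p`!%:R <= S) -> expR x <= S.
Proof.
move=> h; rewrite /expR; apply: limr_le; first exact: is_cvg_series_exp_coeff.
apply: nearW => P; rewrite /series /= big_mkord.
exact: h P.
Qed.

End Jets.

Lemma pow_unbounded (R : realType) (q x : R) : 1 < q -> exists n, x < q ^+ n.
Proof.
move=> q1; have q0 : 0 < q - 1 by rewrite subr_gt0.
have hn : x / (q - 1) < (Num.truncn (x / (q - 1))).+1%:R by exact: truncnS_gt.
exists (Num.truncn (x / (q - 1))).+1; rewrite ltr_pdivrMr // in hn; apply: lt_le_trans hn _.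
elim: (_.+1) => [|k IH]; first by rewrite mul0r.
rewrite -natr1 mulrDl mul1r exprS.
have : 1 <= q ^+ k by rewrite exprn_ege1 // ltW.
by move: IH q0; move: (q ^+ k) => y; nra.
Qed.

(** * Leibniz rule for delta and enlargement of the radius of convergence *)

Section Leibniz.
Variables (R : realType) (gamma : R).
Local Notation C := R[i].
Local Notation expo := (exponent gamma).
Local Notation expoX := (exponentX gamma).

Lemma expo_add k k' (r r' : int) (i l : nat) : (i <= l)%N ->
  expo (k + k') (r + r') l = expo k r i + expo k' r' (l - i).
Proof.
move=> il; rewrite /expo natrD addrACA -mulrDr -intrD; congr (_ + _ * _%:~R).
by rewrite -{1}(subnKC il) PoszD opprD addrACA.
Qed.

Lemma expoX_shift k (r : int) (d p : nat) (c : nat -> C) :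
  expoX k (r + d%:Z) p (cshift d c) = cshift d (expoX k r p c).
Proof.
apply/funext => l; rewrite /exponentX /cshift; case: ltnP => dl; first by rewrite mulr0.
congr (_ ^+ _ * _); rewrite /exponent; congr (_ + _ * _%:~R).
by rewrite -{1}(subnK dl) PoszD opprD addrACA subrr addr0.
Qed.

Lemma expoX_cprod k k' (r r' : int) p (c c' : nat -> C) l :
  expoX (k + k') (r + r') p (cprod c c') l =
  \sum_(q < p.+1) 'C(p, q)%:R * cprod (expoX k r q c) (expoX k' r' (p - q) c') l.
Proof.
rewrite /exponentX /cprod mulr_sumr.
transitivity (\sum_(i < l.+1) \sum_(q < p.+1) 'C(p, q)%:R *
   (expo k r i ^+ q * c i * (expo k' r' (l - i)%N ^+ (p - q) * c' (l - i)%N))).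
  apply: eq_bigr => i _; have il : (i <= l)%N by rewrite -ltnS.
  rewrite (expo_add _ _ _ _ il) addrC exprDn mulr_suml; apply: eq_bigr => q _.
  by rewrite -mulr_natl; ring.
by rewrite exchange_big /=; apply: eq_bigr => q _; rewrite mulr_sumr.
Qed.

Lemma laurent_leibniz k k' (r r' : int) p (c c' : nat -> C) (rho : R) (t : C) Bq Bq' :
  t != 0 -> cabs t <= rho ->
  (forall q, bdd (expoX k r q c) rho (Bq q)) -> (forall q, bdd (expoX k' r' q c') rho (Bq' q)) ->
  laurent (r + r') (expoX (k + k') (r + r') p (cprod c c')) t =
  \sum_(q < p.+1) 'C(p, q)%:R * (laurent r (expoX k r q c) t * laurent r' (expoX k' r' (p - q) c') t).
Proof.
move=> t0 tr h h'; have r0 : 0 <= rho := le_trans (cabs_ge0 _) tr.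
rewrite /laurent opprD expfzDr //.
have -> : expoX (k + k') (r + r') p (cprod c c') = (fun l => \sum_(q < p.+1)
    'C(p, q)%:R * cprod (expoX k r q c) (expoX k' r' (p - q) c') l).
  by apply/funext => l; rewrite expoX_cprod.
rewrite (ps_sum tr (fun q => bddZ 'C(p, q)%:R (bdd_conv r0 (h q) (h' (p - q)%N)))) mulr_sumr.
apply: eq_bigr => q _; rewrite (psZ _ tr (bdd_conv r0 (h q) (h' (p - q)%N))).
by rewrite (ps_conv tr (h q) (h' (p - q)%N)); ring.
Qed.

Lemma expoX_comp k (r : int) p p' (c : nat -> C) :
  expoX k r p (expoX k r p' c) = expoX k r (p + p') c.
Proof. by apply/funext => l; rewrite /exponentX exprD mulrA. Qed.

Hypothesis gamma0 : gamma != 0.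

(** Representations that agree near 0 differ by a shift, which preserves the exponents l - r and
    hence the action of delta. *)
Lemma jet_inj k (r r' : int) (c c' : nat -> C) (rho rho' B B' e : R) :
  0 < rho -> bdd c rho B -> 0 < rho' -> bdd c' rho' B' -> 0 < e ->
  (forall t, 0 < cabs t < e -> laurent r c t = laurent r' c' t) ->
  forall p t, t != 0 -> cabs t < rho -> cabs t < rho' ->
  laurent r (expoX k r p c) t = laurent r' (expoX k r' p c') t.
Proof.
move=> r0 h r0' h' e0 E p t t0 tr tr'.
have t0' : 0 < cabs t by rewrite cabs_gt0.
have [le|/ltW le] := leP r r'.
  have [d Ed] := le_int_nat le; rewrite (laurent_inj r0 h r0' h' e0 E Ed) Ed expoX_shift.
  have [B1 hB1] := bdd_expoX_ex gamma0 k r p t0' tr h.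
  by rewrite (laurent_shift d r t0 (lexx _) hB1).
have [d Ed] := le_int_nat le.
rewrite (laurent_inj r0' h' r0 h e0 (fun t ht => esym (E t ht)) Ed) Ed expoX_shift.
have [B1 hB1] := bdd_expoX_ex gamma0 k r' p t0' tr' h'.
by rewrite (laurent_shift d r' t0 (lexx _) hB1).
Qed.

Lemma cabs_expo_ge k (r : int) (l : nat) : `|gamma| * (l%:R - `|r|%:~R) <= cabs (expo k r l).
Proof.
apply: le_trans (cabs_ge_Im _).
have -> : complex.Im (expo k r l) = gamma * (l%:Z - r)%:~R.
  rewrite /exponent -(rmorph_nat (real_complex R) k) -(rmorph_int (real_complex R)) -complexiE /=.
  by ring.
rewrite normrM ler_wpM2l // rmorphB /=.
have -> : l%:~R = l%:R :> R by rewrite -pmulrn.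
have -> : `|r|%:~R = `|r%:~R| :> R by rewrite intr_norm.
by apply: le_trans (lerB_normD _ _); rewrite ?normrN ?normr_nat.
Qed.

Section Step.
Variables (n : nat) (A : 'I_n.+1 -> nat -> C) (rhoA BA R1 R2 c : R).
Hypotheses (R10 : 0 < R1) (R1R2 : R1 < R2) (R2A : R2 < rhoA) (hA : forall j, bdd (A j) rhoA BA).
Hypotheses (c0 : 0 < c) (low : forall t, R1 <= cabs t <= R2 -> c <= cabs (ps (A ord_max) t)).

(** On |t| = r1 the equation, differentiated by delta^p, bounds delta^p of the solution by K d^(-p)
    p! with d depending only on the A_j. Cauchy's estimate turns this into bounds on |lambda_l|^p
    |al_l| r1^l for all p, lambda_l being the eigenvalue of delta; as |lambda_l| grows linearly in
    l, the coefficients decay geometrically beyond r1, at a rate independent of k, h and r1. *)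
Lemma extension_step : exists kappa : R, 1 < kappa /\
  forall k (r : int) (al : nat -> C) (rho B u e : R) (h : C -> C),
  bdd al rho B -> nbl rhoA h u -> 0 < e ->
  (forall t, 0 < cabs t < e -> \sum_(j < n.+1) ps (A j) t * laurent r (expoX k r j al) t = h t) ->
  forall r1, R1 <= r1 -> r1 <= R2 -> r1 < rho -> exists B', bdd al (r1 * kappa) B'.
Proof.
have R20 : 0 < R2 := lt_trans R10 R1R2.
have A0 : 0 < rhoA := lt_trans R20 R2A.
have [d0 [d00 hd0]] := expo_room gamma0 R20 R2A.
have BA0 : 0 <= BA := bdd_ge0 (hA ord_max).
pose M := expo_cst gamma 0 0 d0 * BA.
have M0 : 0 <= M by rewrite mulr_ge0 // expR_ge0.
have [d [dp hd]] := @jet_growth R n c M d0 c0 M0 d00.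
have g0 : 0 < `|gamma| by rewrite normr_gt0.
(* Relative to r1^(-l) the coefficients decay like e^(-|gamma| d l / 2); half of this rate enlarges
   the radius, the other half sums the series. *)
exists (expR (`|gamma| * d / 4)); split; first by rewrite expR_gt1 !mulr_gt0.
move=> k r al rho B u e h hal [r' [c' [hc' hh]]] e0 eqn r1 R1r r1R2 r1rho.
have r10 : 0 < r1 := lt_le_trans R10 R1r.
pose sg := Num.min ((r1 + rho) / 2) rhoA.
have r1sg : r1 < sg by rewrite lt_min (le_lt_trans r1R2 R2A) andbT ltr_pdivlMr //; move: r1rho; lra.
have sgrho : sg < rho.
  by apply: (@le_lt_trans _ _ ((r1 + rho) / 2)); [rewrite ge_min lexx | rewrite ltr_pdivrMr //; move: r1rho; lra].
have sgA : sg <= rhoA by rewrite ge_min lexx orbT.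
have sg0 : 0 < sg := lt_trans r10 r1sg.
have hA' j : bdd (A j) sg BA by apply: bddW (hA j) => //; exact: ltW.
have /choice[Bal hBal] : forall p, exists B', bdd (expoX k r p al) sg B'.
  by move=> p; apply: (bdd_expoX_ex gamma0 k r p sg0 sgrho hal).
have Bal0 p : 0 <= Bal p := bdd_ge0 (hBal p).
pose c1 l := \sum_(j < n.+1) cprod (A j) (expoX k r j al) l.
have hc1 : bdd c1 sg (\sum_(j < n.+1) BA * Bal j).
  by apply: bdd_sum => [|j]; [exact: ltW | apply: bdd_conv => //; exact: ltW].
have e0' : 0 < Num.min e sg by rewrite lt_min e0.
have E t : 0 < cabs t < Num.min e sg -> laurent r c1 t = laurent r' c' t.
  rewrite lt_min => /and3P[t0 te tsg]; rewrite -hh; last by rewrite t0 (lt_le_trans tsg).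
  rewrite -eqn ?t0 // /laurent /c1.
  rewrite (ps_sum (ltW tsg) (fun j : 'I_n.+1 => bdd_conv (ltW sg0) (hA' j) (hBal j))) mulr_sumr.
  by apply: eq_bigr => j _; rewrite (ps_conv (ltW tsg) (hA' j) (hBal j)); ring.
(* The equation is given near 0 only, but both sides are Laurent series converging past r1, so it
   and its images under delta^p hold on the circle. *)
have jets t p : cabs t = r1 ->
    \sum_(j < n.+1) \sum_(q < p.+1) 'C(p, q)%:R * (ps (expoX 0 0 q (A j)) t *
      laurent r (expoX k r (p - q + j) al) t) = laurent r' (expoX k r' p c') t.
  move=> tr; have tn0 : t != 0 by rewrite -cabs_gt0 tr.
  rewrite -(jet_inj k sg0 hc1 A0 hc' e0' E p tn0) ?tr //; last exact: lt_le_trans sgA.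
  have /choice[BX hBX] : forall jq : 'I_n.+1 * nat, exists B', bdd (expoX 0 0 jq.2 (A jq.1)) r1 B'.
    by move=> [j q]; apply: (bdd_expoX_ex gamma0 0 0 q r10 (lt_le_trans r1sg sgA) (hA j)).
  have hBal' q : bdd (expoX k r q al) r1 (Bal q) by apply: bddW (hBal q); exact: ltW.
  have trle : cabs t <= r1 by rewrite tr.
  have -> : expoX k r p c1 = (fun l => \sum_(j < n.+1)
      expoX (0 + k) (0 + r) p (cprod (A j) (expoX k r j al)) l).
    by apply/funext => l; rewrite !add0r !add0n /exponentX mulr_sumr.
  have hb j : exists B', bdd (expoX (0 + k) (0 + r) p (cprod (A j) (expoX k r j al))) r1 B'.
    apply: (bdd_expoX_ex gamma0 _ _ p r10 r1sg (bdd_conv (ltW sg0) (hA' j) (hBal j))).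
  have /choice[Bh hBh] := hb.
  rewrite /laurent (ps_sum trle hBh) mulr_sumr; apply: eq_bigr => j _.
  have := @laurent_leibniz 0 k 0 r p (A j) (expoX k r j al) r1 t
    (fun q => BX (j, q)) (fun q => Bal (q + j)%N) tn0 trle.
  rewrite {1}/laurent !add0r => ->.
  - apply: eq_bigr => q _; congr (_ * (_ * _)); last by rewrite expoX_comp.
    by rewrite /laurent oppr0 expr0z mul1r.
  - by move=> q; exact: hBX (j, q).
  - by move=> q; rewrite expoX_comp.
pose M' := r1 ^ (- r') * expo_cst gamma k r' d0 * (u * rhoA ^ r').
pose K0 := \sum_(p < n) r1 ^ (- r) * Bal p.
have r1z z : 0 < r1 ^ z by exact: exprz_gt0.
have K00 : 0 <= K0 by apply: sumr_ge0 => p _; rewrite mulr_ge0 // ltW.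
have hd0' : r1 * expR (d0 * `|gamma|) <= rhoA.
  by apply: le_trans hd0; rewrite ler_wpM2r ?expR_ge0.
pose K := K0 + 2 * M' / c.
have cabs_fact p : cabs (p`!%:R^-1 : C) = p`!%:R^-1 by rewrite cabsV cabs_nat.
have f0 p : 0 < p`!%:R :> R by rewrite ltr0n fact_gt0.
have fC p : p`!%:R != 0 :> C by rewrite pnatr_eq0 -lt0n fact_gt0.
have grow t p : cabs t = r1 -> cabs (laurent r (expoX k r p al) t) <= K * d ^- p * p`!%:R.
  move=> tr; have trle : cabs t <= r1 by rewrite tr.
  suff H' : cabs (p`!%:R^-1 * laurent r (expoX k r p al) t) <= K * d ^- p.
    by rewrite cabsM cabs_fact ler_pdivrMl // mulrC in H'.
  apply: (hd (fun j p => p`!%:R^-1 * ps (expoX 0 0 p (A j)) t)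
    (fun p => p`!%:R^-1 * laurent r (expoX k r p al) t)
    (fun p => p`!%:R^-1 * laurent r' (expoX k r' p c') t) M' K0) => {p} //.
  - rewrite fact0 invr1 mul1r.
    have -> : expoX 0 0 0 (A ord_max) = A ord_max by apply/funext => l; rewrite /exponentX expr0 mul1r.
    by apply: low; rewrite tr R1r.
  - move=> j p; rewrite cabsM cabs_fact ler_pdivrMl //.
    apply: le_trans (cabs_ps trle (bdd_expoX 0 0 p d00 (ltW r10) hd0' (hA j))) _.
    by rewrite /M le_eqVlt; apply/orP; left; apply/eqP; ring.
  - move=> p; rewrite cabsM cabs_fact ler_pdivrMl // /laurent cabsM cabsXz tr.
    apply: le_trans (ler_wpM2l (ltW (r1z _)) (cabs_ps trle (bdd_expoX k r' p d00 (ltW r10) hd0' hc'))) _.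
    by rewrite /M' le_eqVlt; apply/orP; left; apply/eqP; ring.
  - move=> p; rewrite -(jets t p tr) mulr_sumr; apply: eq_bigr => j _.
    rewrite mulr_sumr; apply: eq_bigr => q _; have qp : (q <= p)%N by rewrite -ltnS.
    have e1 : 'C(p, q)%:R * (q`!%:R * (p - q)`!%:R) = p`!%:R :> C by rewrite -!natrM bin_fact.
    have e2 : ((p - q + j) ^_ j)%:R * (p - q)`!%:R = (p - q + j)`!%:R :> C.
      by rewrite -natrM -[X in (_ * X`!)%N](addnK j) ffact_fact ?leq_addl.
    have := fC q; have := fC (p - q)%N; have := fC p; have := fC (p - q + j)%N; rewrite -e1 -e2.
    have C0 : 'C(p, q)%:R != 0 :> C by rewrite pnatr_eq0 -lt0n bin_gt0.
    move: C0; move: ('C(p, q)%:R : C) (q`!%:R : C) ((p - q)`!%:R : C) (((p - q + j) ^_ j)%:R : C) => x1 x2 x3 x4.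
    move=> n1; rewrite !mulf_eq0 !negb_or => /andP[n4 n3] _ _ n2.
    by field; rewrite n1 n2 n3 n4.
  - move=> p pn; rewrite cabsM cabs_fact ler_pdivrMl // /laurent cabsM cabsXz tr.
    apply: (@le_trans _ _ K0); last by rewrite ler_peMl // ler1n fact_gt0.
    rewrite /K0 (bigD1 (Ordinal pn)) //=.
    apply: (@le_trans _ _ (r1 ^ (- r) * Bal p)).
      by rewrite ler_wpM2l ?(ltW (r1z _)) // (cabs_ps _ (hBal p)) // tr ltW.
    by rewrite lerDl sumr_ge0 // => i _; rewrite mulr_ge0 // ltW.
have coefb p l : cabs (expo k r l) ^+ p * cabs (al l) * r1 ^+ l <= r1 ^ r * (K * d ^- p * p`!%:R).
  rewrite -cabsX -cabsM -/(exponentX gamma k r p al l).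
  apply: (@cauchy_estimate R (expoX k r p al) sg (Bal p) r1 _ l r10 (ltW r1sg) (hBal p)).
  move=> t tr; have := grow t p tr; rewrite /laurent cabsM cabsXz tr -ler_pdivlMl //.
  by rewrite invr_expz opprK.
have K_0 : 0 <= K.
  have hu : 0 <= u * rhoA ^ r' := bdd_ge0 hc'.
  rewrite /K addr_ge0 // divr_ge0 ?(ltW c0) // mulr_ge0 // /M' mulr_ge0 //.
  by rewrite mulr_ge0 ?expR_ge0 // ltW.
(* Summing the p-th estimate against (d/2)^p / p! assembles them into one exponential bound; the
   factor 1/2 makes the sum over p converge. *)
have expb l : expR (cabs (expo k r l) * (d / 2)) * (cabs (al l) * r1 ^+ l) <= r1 ^ r * (2 * K).
  have [->|aln0] := eqVneq (al l) 0.
    by rewrite cabs0 mul0r mulr0 !mulr_ge0 // ltW.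
  have a0 : 0 < cabs (al l) * r1 ^+ l by rewrite mulr_gt0 ?exprn_gt0 // cabs_gt0.
  rewrite -ler_pdivlMr //; apply: expR_le_partial => P; rewrite ler_pdivlMr // mulr_suml.
  apply: (@le_trans _ _ (\sum_(p < P) r1 ^ r * (K * (1 / 2) ^+ p))).
    apply: ler_sum => p _; have H := coefb p l.
    have -> : (cabs (expo k r l) * (d / 2)) ^+ p / p`!%:R * (cabs (al l) * r1 ^+ l) =
       cabs (expo k r l) ^+ p * cabs (al l) * r1 ^+ l * (d ^+ p / 2 ^+ p / p`!%:R).
      by rewrite exprMn expr_div_n; ring.
    apply: le_trans (ler_wpM2r _ H) _.
      by rewrite !divr_ge0 ?exprn_ge0 ?ler0n // ltW.
    rewrite expr_div_n expr1n le_eqVlt; apply/orP; left; apply/eqP; field.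
    by rewrite !expf_neq0 ?(lt0r_neq0 dp) ?(lt0r_neq0 (f0 p)).
  rewrite -!mulr_sumr ler_wpM2l ?(ltW (r1z _)) // mulrC ler_wpM2r // sum_pow_le2 //; lra.
pose S := r1 ^ r * (2 * K) * expR (`|gamma| * d / 2 * `|r|%:~R).
exists (\sum_(l < 0) 0 + S / (1 - expR (- (`|gamma| * d / 4)))) => N.
rewrite big_ord0 add0r.
pose th := expR (- (`|gamma| * d / 4)).
have th1 : th < 1 by rewrite expR_lt1 oppr_lt0 !mulr_gt0.
have S0 : 0 <= S by rewrite !mulr_ge0 ?expR_ge0 // ltW.
apply: (@le_trans _ _ (\sum_(l < N) S * th ^+ l)).
  apply: ler_sum => l _; have g1 := cabs_expo_ge k r l.
  have g2 : `|gamma| * (l%:R - `|r|%:~R) * (d / 2) <= cabs (expo k r l) * (d / 2).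
    by rewrite ler_wpM2r // divr_ge0 // ltW.
  rewrite -ler_expR in g2.
  have al0 : 0 <= cabs (al l) * r1 ^+ l by rewrite mulr_ge0 ?cabs_ge0 ?exprn_ge0 // ltW.
  have g3 := le_trans (ler_wpM2r al0 g2) (expb l).
  have {}g3 : cabs (al l) * r1 ^+ l <= r1 ^ r * (2 * K) * expR (- (`|gamma| * (l%:R - `|r|%:~R) * (d / 2))).
    by rewrite expRN ler_pdivlMr ?expR_gt0 // mulrC.
  rewrite exprMn mulrA; apply: le_trans (ler_wpM2r _ g3) _; first by rewrite exprn_ge0 ?expR_ge0.
  rewrite /th /S -!expRM_natr -[leLHS]mulrA -[leRHS]mulrA -!expRD le_eqVlt; apply/orP; left; apply/eqP.
  by congr (_ * expR _); field.
rewrite -mulr_sumr ler_wpM2l // -[leRHS]mul1r ler_pdivlMr ?subr_gt0 //.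
have := subrX1 th N; set T := \sum_(_ < _) _ => G.
have : 0 <= th ^+ N by rewrite exprn_ge0 // expR_ge0.
by rewrite -/th; move: G; move: (th ^+ N) => y G y0; nra.
Qed.

(** A step multiplies the radius by kappa but must start strictly inside the current disc. Starting
    at its radius divided by mu, with 1 < mu < kappa, still gains kappa/mu > 1 each time, so R2 is
    reached in finitely many steps. *)
Lemma analytic_extension k (r : int) (al : nat -> C) (rho B u e : R) (h : C -> C) :
  bdd al rho B -> R1 < rho -> nbl rhoA h u -> 0 < e ->
  (forall t, 0 < cabs t < e -> \sum_(j < n.+1) ps (A j) t * laurent r (expoX k r j al) t = h t) ->
  exists B', bdd al R2 B'.
Proof.
move=> hal R1rho hh e0 eqn; have [kappa [k1 step]] := extension_step.
pose mu := (1 + kappa) / 2.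
have mu1 : 1 < mu by rewrite ltr_pdivlMr //; lra.
have muk : mu < kappa by rewrite ltr_pdivrMr //; lra.
have mu0 : 0 < mu by apply: lt_trans mu1.
have rho0 : 0 < rho := lt_trans R10 R1rho.
have nu1 : 1 < kappa / mu by rewrite ltr_pdivlMr // mul1r.
have claim i : exists sg B', [/\ bdd al sg B', R1 < sg & R2 <= sg \/ rho * (kappa / mu) ^+ i <= sg].
  elim: i => [|i [sg [B' [h1 h2 h3]]]].
    by exists rho, B; split=> //; right; rewrite expr0 mulr1.
  have [le|lt] := leP R2 sg; first by exists sg, B'; split=> //; left.
  have {h3} h3 : rho * (kappa / mu) ^+ i <= sg by case: h3 => // h3; rewrite leNgt lt in h3.
  have sg0 : 0 < sg := lt_trans R10 h2.
  have smu : sg / mu < sg by rewrite ltr_pdivrMr // ltr_pMr.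
  pose r1 := Num.max R1 (sg / mu).
  have r1sg : r1 < sg by rewrite gt_max h2.
  have R1r1 : R1 <= r1 by rewrite le_max lexx.
  have [B'' hB''] := step k r al sg B' u e h h1 hh e0 eqn r1 R1r1 (ltW (lt_trans r1sg lt)) r1sg.
  have r10 : 0 < r1 := lt_le_trans R10 R1r1.
  exists (r1 * kappa), B''; split=> //; first by apply: le_lt_trans R1r1 _; rewrite ltr_pMr.
  right; rewrite exprSr mulrA; apply: (@le_trans _ _ (sg * (kappa / mu))).
    by rewrite ler_wpM2r // ltW // (lt_trans _ nu1).
  rewrite mulrCA mulrC ler_wpM2r //; first by apply: ltW; apply: lt_trans k1.
  by rewrite le_max lexx orbT.
have [i hi] := pow_unbounded (R2 / rho) nu1.
have [sg [B' [h1 h2 h3]]] := claim i.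
exists B'; apply: bddW h1; first by apply: ltW; apply: lt_trans R1R2.
case: h3 => // h3; apply: le_trans h3; rewrite mulrC -ler_pdivrMr //; exact: ltW.
Qed.

End Step.
End Leibniz.

(** * Geometric growth near the origin *)

(** Absorption: iterating u -> u/2 + Q from a finite start forgets [u0], whatever its size, and
    tends to 2 Q. *)
Lemma halving (R : realType) (X : Type) (g : X -> R) (u0 Q : R) :
  (forall x, g x <= u0) -> (forall u, (forall x, g x <= u) -> forall x, g x <= u / 2 + Q) ->
  forall x, g x <= 2 * Q.
Proof.
move=> h0 hs x.
have it i : forall x, g x <= u0 / 2 ^+ i + 2 * Q + `|2 * Q| / 2 ^+ i.
  elim: i => [y|i IH y].
    rewrite expr0 !divr1; have := h0 y; have := ler_norm (- (2 * Q)); rewrite normrN; lra.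
  have := hs _ IH y; rewrite exprS !invfM.
  move: (u0) `|_| (2 ^+ i)^-1 => v w z; lra.
apply/ler_addgt0Pr => e e0.
pose v := `|u0| + `|2 * Q|.
have v0 : 0 <= v by rewrite addr_ge0.
pose N := Num.truncn (v / e); have hN : v / e < N.+1%:R by exact: truncnS_gt.
have := it N.+1 x; have p0 : 0 < 2 ^+ N.+1 :> R by rewrite exprn_gt0.
have : v / 2 ^+ N.+1 <= e.
  rewrite ler_pdivrMr // mulrC -ler_pdivrMr //; apply: le_trans (ltW hN) _.
  by rewrite -natrX ler_nat ltnW // ltn_expl.
have : u0 / 2 ^+ N.+1 + `|2 * Q| / 2 ^+ N.+1 <= v / 2 ^+ N.+1.
  by rewrite -mulrDl ler_wpM2r ?invr_ge0 ?(ltW p0) // lerD2r ler_norm.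
lra.
Qed.

Section StageOne.
Variables (R : realType) (gamma : R).
Local Notation C := R[i].
Local Notation expo := (exponent gamma).
Local Notation expoX := (exponentX gamma).
Hypothesis gamma0 : gamma != 0.
Variables (n : nat) (F : nat -> {ffun 'I_n.+1 -> nat} -> C) (r : nat -> int) (a : nat -> nat -> C).
Hypothesis hF : mps_convergent F.

Lemma cabs_expo_geRe k r' l : k%:R <= cabs (expo k r' l).
Proof.
apply: le_trans (cabs_ge_Re _).
have -> : complex.Re (expo k r' l) = k%:R.
  rewrite /exponent -(rmorph_nat (real_complex R) k) -(rmorph_int (real_complex R)) -complexiE /=.
  by ring.
exact: ler_norm.
Qed.

Lemma poly_lower_bound (p : 'I_n.+1 -> C) : p ord_max != 0 -> exists k1 : nat,
  forall x : C, (0 < k1)%N /\ (k1%:R <= cabs x ->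
    cabs (p ord_max) / 2 * cabs x ^+ n <= cabs (\sum_(j < n.+1) p j * x ^+ j)).
Proof.
move=> pn; have p0 : 0 < cabs (p ord_max) by rewrite cabs_gt0.
pose S := \sum_(j < n) cabs (p (widen_ord (leqnSn n) j)).
have S0 : 0 <= S by apply: sumr_ge0 => j _; exact: cabs_ge0.
pose k1 := (Num.truncn (2 * S / cabs (p ord_max))).+1.
have hk1 : 2 * S / cabs (p ord_max) < k1%:R by exact: truncnS_gt.
exists k1 => x; split=> // kx; have x1 : 1 <= cabs x by apply: le_trans kx; rewrite ler1n.
have x0 : 0 < cabs x by apply: lt_le_trans x1.
rewrite big_ord_recr /= addrC.
set T := \sum_(j < n) _.
have hT : cabs T <= cabs (p ord_max) / 2 * cabs x ^+ n.
  rewrite -(ler_pM2r x0); apply: (@le_trans _ _ (S * cabs x ^+ n)).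
    apply: le_trans (ler_wpM2r (ltW x0) (cabs_sum _ _ _)) _; rewrite !mulr_suml; apply: ler_sum => j _.
    by rewrite cabsM cabsX -mulrA -exprSr ler_wpM2l ?cabs_ge0 // ler_weXn2l.
  rewrite mulrAC ler_wpM2r ?exprn_ge0 ?(ltW x0) //.
  move: (le_trans (ltW hk1) kx); rewrite ler_pdivrMr // => h; lra.
have := cabs_ler_dist (p ord_max * x ^+ n) (- T); rewrite cabsN opprK cabsM cabsX.
by move: hT; lra.
Qed.

Variables (m : nat) (q : int) (A : 'I_n.+1 -> nat -> C) (R' BA : R).
Hypotheses (R'0 : 0 < R') (hA : forall j, bdd (A j) R' BA) (An0 : A ord_max 0%N != 0).
Hypothesis conv_a : forall k rho, (0 < k)%N -> 0 < rho < R' -> exists B, bdd (a k) rho B.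
Hypothesis idF : forall k t, 0 < cabs t < R' -> subst_exotic F gamma r a k t = 0.
Hypothesis iddF : forall j k t, (k < m)%N -> 0 < cabs t < R' ->
  subst_exotic (dpart F j) gamma r a k t = 0.
Hypothesis dFm : forall j t, 0 < cabs t < R' ->
  subst_exotic (dpart F j) gamma r a m t = laurent (- q) (A j) t.

(** Freezing A_j at t = 0 makes the equation diagonal in the Laurent coefficients, with symbol sum_j
    A_j(0) lambda^j; for k large this is at least c |lambda|^n, as |lambda| >= k. The varying part
    A_j - A_j(0) has norm O(eps) and is absorbed. *)
Lemma stage_one (eps0 : R) : 0 < eps0 -> exists eps, [/\ 0 < eps, eps < eps0, eps < R' &
  exists C1 A1 : R, [/\ 0 <= C1, 0 < A1 & forall (j : 'I_n.+1) k, (0 < k)%N ->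
    bdd (expoX k (r k) j (a k)) eps (C1 * A1 ^+ k * eps ^ (r k))]].
Proof.
move=> eps00.
pose c := cabs (A ord_max 0%N) / 2.
have c0 : 0 < c by rewrite divr_gt0 // cabs_gt0.
have [k1 hk1] := @poly_lower_bound (fun j => A j 0%N) An0.
have BA0 : 0 <= BA := bdd_ge0 (hA ord_max).
pose N := maxn m.+2 k1.
(* The last bound makes the n + 1 varying parts together at most c/2, half of the constant in the
   lower bound for the symbol. *)
pose eps := Num.min (eps0 / 2) (Num.min (R' / 2) (c / 2 * R' / (n.+1%:R * BA + 1))).
have D0 : 0 < n.+1%:R * BA + 1 by rewrite ltr_wpDl // mulr_ge0.
have e0 : 0 < eps.
  by rewrite /eps !lt_min; apply/and3P; split; rewrite divr_gt0 // mulr_gt0 // divr_gt0.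
have ee0 : eps < eps0.
  by apply: (@le_lt_trans _ _ (eps0 / 2)); [rewrite /eps ge_min lexx | rewrite ltr_pdivrMr //; lra].
have eR' : eps < R'.
  by apply: (@le_lt_trans _ _ (R' / 2)); [rewrite /eps !ge_min lexx orbT | rewrite ltr_pdivrMr //; move: R'0; lra].
have ec : n.+1%:R * (eps / R' * BA) <= c / 2.
  have : eps <= c / 2 * R' / (n.+1%:R * BA + 1) by rewrite /eps !ge_min lexx !orbT.
  rewrite ler_pdivlMr // mulrDr mulr1 => h.
  have -> : n.+1%:R * (eps / R' * BA) = eps * (n.+1%:R * BA) / R' by ring.
  by rewrite ler_pdivrMr //; move: h e0; lra.
exists eps; split=> //.
pose K0 := 2 / c * eps ^ (- q).
have K00 : 0 <= K0.
  by apply: mulr_ge0; [rewrite divr_ge0 // ltW | rewrite ltW // exprz_gt0].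
pose cc (j : 'I_n.+1) k t := dcoef gamma r a j k t.
have eR'' : (eps + R') / 2 < R' by rewrite ltr_pdivrMr //; move: eR'; lra.
have eR3 : eps < (eps + R') / 2 by rewrite ltr_pdivlMr //; move: eR'; lra.
have eR4 : 0 < (eps + R') / 2 < R' by rewrite (lt_trans e0 eR3).
have hw j k : (0 < k)%N -> exists B, bdd (expoX k (r k) j (a k)) eps B.
  move=> k0; have [B hB] := conv_a k0 eR4.
  exact: (bdd_expoX_ex gamma0 k (r k) j e0 eR3 hB).
have [] := @majorant_growth R C (fun t => 0 < cabs t < eps) (fun _ => nbl eps)
  (fun _ => @nbl_ext R eps) (fun k h u => @nbl_ge0 R eps e0 h u)
  (fun k h u v => @nbl_le R eps e0 h u v) (fun _ => @nbl_cst R eps)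
  (fun k h h' u v => @nblD R eps e0 h h' u v) (fun k k' h h' u v => @nblM R eps e0 h h' u v)
  n F cc m N K0 0 0 hF _ _ K00 (lexx _) (lexx _).
- by [].
- by rewrite /N leq_max ltnSn.
- by move=> k t /andP[t0 te]; apply: idF; rewrite t0 (lt_trans te).
- by move=> j k t /andP[t0 te] km; apply: iddF => //; rewrite t0 (lt_trans te).
- move=> j k; case: (posnP k) => [->|k0].
    exists (cabs (0 : C)); apply: (@nbl_ext _ _ (fun=> 0)); last exact: nbl_cst.
    by move=> t _.
  have [B hB] := conv_a k0 eR4.
  exact: (nbl_dcoef gamma0 r j e0 eR3 hB).
- move=> k f u Nk hf eqn j; rewrite mul0r addr0.
  have k1k : (k1 <= k)%N by apply: leq_trans Nk; rewrite leq_max leqnn orbT.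
  have k0 : (0 < k)%N by apply: leq_trans k1k; exact: (hk1 0).1.
  pose w i := expoX k (r k) i (a k).
  have /choice[Bw hBw] : forall i, exists B, bdd (w i) eps B by move=> i; exact: hw.
  have hA' i : bdd (A i) eps BA by apply: bddW (hA i); exact: ltW.
  pose c1 l := \sum_(i < n.+1) cprod (A i) (w i) l.
  have hc1 : bdd c1 eps (\sum_(i < n.+1) BA * Bw i).
    by apply: bdd_sum => [|i]; [exact: ltW | apply: bdd_conv => //; exact: ltW].
  have fE t : 0 < cabs t < eps -> f t = laurent (- q + r k) c1 t.
    move=> te; have /andP[t0 tle] := te; rewrite -eqn //.
    rewrite /laurent /c1 (ps_sum (ltW tle) (fun i : 'I_n.+1 => bdd_conv (ltW e0) (hA' i) (hBw i))).
    rewrite mulr_sumr; apply: eq_bigr => i _.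
    have := dFm i (t := t); rewrite t0 (lt_trans tle eR') => /(_ isT); rewrite /subst_exotic => ->.
    rewrite /cc dcoefE // /laurent (ps_conv (ltW tle) (hA' i) (hBw i)) opprD expfzDr -?cabs_gt0 //.
    by ring.
  have hc1u := nbl_bdd e0 hf e0 hc1 e0 fE.
  set U := u * _ in hc1u.
  (* The a priori bound [Bw n] depends on k in an unknown way; it only starts the absorption and
     leaves no trace in the result. *)
  have key : forall M, \sum_(l < M) cabs (w n l) * eps ^+ l <= 2 * (U / c).
    apply: (@halving R nat (fun M => \sum_(l < M) cabs (w n l) * eps ^+ l) (Bw n)); first exact: hBw.
    move=> W hW M.
    have hWi (i : 'I_n.+1) : bdd (w i) eps W.
      move=> M'; apply: le_trans (hW M'); apply: ler_sum => l _.
      rewrite ler_wpM2r ?exprn_ge0 ?(ltW e0) // /w /exponentX !cabsM !cabsX.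
      rewrite ler_wpM2r ?cabs_ge0 //; apply: ler_weXn2l; last by rewrite -ltnS.
      by apply: le_trans (cabs_expo_geRe _ _ _); rewrite ler1n.
    pose A' i := cshift 1 (fun l => A i l.+1).
    have hA'' i : bdd (A' i) eps (eps / R' * BA).
      have h1 : bdd (A' i) R' BA.
        move=> M'; apply: le_trans (hA i M'); apply: ler_sum => l _.
        rewrite ler_wpM2r ?exprn_ge0 ?(ltW R'0) //.
        have -> : A' i l = if (l < 1)%N then 0 else A i l.
          by rewrite /A' /cshift; case: (nat_of_ord l) => [|l'] //; rewrite subn1.
        by case: ifP; rewrite ?cabs0 ?cabs_ge0.
      have := bdd_shift 1 (ltW e0) (bddW (ltW e0) (ltW eR') (bdd_unshift R'0 h1)).
      by apply: bdd_leB; rewrite !expr1 mulrA.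
    have hs := bdd_sum (ltW e0) (fun i : 'I_n.+1 => bdd_conv (ltW e0) (hA'' i) (hWi i)).
    have hd := bddD (ltW e0) hc1u (bddZ (-1) hs).
    have := hd M; rewrite cabsN cabs1 mul1r sumr_const card_ord => hd'.
    rewrite -(ler_pM2l c0) mulr_sumr.
    apply: (@le_trans _ _ (U + (eps / R' * BA * W) *+ n.+1)).
      apply: le_trans hd'; apply: ler_sum => l _; rewrite mulrA ler_wpM2r ?exprn_ge0 ?(ltW e0) //.
      (* Once the varying parts are subtracted, the symbol at t = 0 multiplies the single
         coefficient [a k l]. *)
      have -> : c1 l + -1 * \sum_(i < n.+1) cprod (A' i) (w i) l =
         (\sum_(i < n.+1) A i 0%N * expo k (r k) l ^+ i) * a k l.
        rewrite mulN1r /c1 -sumrB mulr_suml; apply: eq_bigr => i _.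
        rewrite /cprod big_ord_recl subn0 [X in _ - X]big_ord_recl {1}/A' /cshift /= mul0r add0r.
        rewrite (eq_bigr (fun i1 : 'I_l => A' i (bump 0 i1) * w i (l - bump 0 i1)%N)) => [|i1 _].
          by rewrite addrK /w /exponentX mulrA.
        by rewrite /A' /cshift /bump /= add1n subSS subn0.
      rewrite cabsM /w /exponentX cabsM cabsX mulrA ler_wpM2r ?cabs_ge0 //.
      apply: (hk1 _).2; apply: le_trans (cabs_expo_geRe _ _ _).
      by rewrite ler_nat.
    have W0 : 0 <= W := bdd_ge0 hW.
    have h := ler_wpM2r W0 ec.
    rewrite mulrDr [c * (U / c)](_ : _ = U); last by field; rewrite gt_eqF.
    by rewrite -mulr_natl; move: h; lra.
  exists (r k), (w j); split; last by move=> t _; rewrite /cc dcoefE.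
  move=> M; apply: (@le_trans _ _ (\sum_(l < M) cabs (w n l) * eps ^+ l)).
    apply: ler_sum => l _.
    rewrite ler_wpM2r ?exprn_ge0 ?(ltW e0) // /w /exponentX !cabsM !cabsX.
    rewrite ler_wpM2r ?cabs_ge0 //; apply: ler_weXn2l; last by rewrite -ltnS.
    by apply: le_trans (cabs_expo_geRe _ _ _); rewrite ler1n.
  apply: le_trans (key M) _.
  rewrite /U /K0 expfzDr ?gt_eqF // le_eqVlt; apply/orP; left; apply/eqP.
  by ring.
move=> C1 [A1 [C10 A10 H]]; exists C1, A1; split=> // j k k0.
have [B hB] := hw j k k0.
by apply: (nbl_bdd e0 (H j k) e0 hB e0) => t _; rewrite /cc dcoefE.
Qed.

End StageOne.

(** * Continuation of the growth bound along paths *)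

Section ExpBounds.
Variable R : realType.
Local Notation C := R[i].
Implicit Types (x y : R) (z : C).

Lemma sin_le_abs y : `|sin y| <= `|y|.
Proof.
wlog y0 : y / 0 <= y.
  move=> W; have [/W//|/ltW y0] := leP 0 y.
  by have := W (- y); rewrite sinN !normrN; apply; rewrite oppr_ge0.
have d1 x : x \in `]0, y[ -> is_derive x 1 (sin : R -> R) (cos x) by move=> _; exact: is_derive_sin.
have d2 : {within `[0, y], continuous (sin : R -> R)}%classic.
  by apply: continuous_subspaceT => x; exact: continuous_sin.
have [c _ E] := MVT_segment y0 d1 d2.
by move: E; rewrite sin0 !subr0 => ->; rewrite normrM ler_piMl // cos_max.
Qed.

Lemma cos_sub1_le y : `|cos y - 1| <= y ^+ 2 /\ `|cos y - 1| <= `|y|.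
Proof.
have E : cos y - 1 = - (2 * sin (y / 2) ^+ 2).
  have {1}-> : y = (y / 2) *+ 2 by rewrite -mulr_natr divfK // pnatr_eq0.
  by rewrite cos_mulr2n cos2sin2 mulr2n; ring.
have s1 := sin_le_abs (y / 2).
have s2 := sin_max (y / 2).
have h : `|y / 2| = `|y| / 2 by rewrite normrM (ger0_norm (_ : 0 <= 2^-1)).
rewrite h in s1.
rewrite E normrN normrM normrX (ger0_norm (_ : 0 <= 2)) //.
have s0 := normr_ge0 (sin (y / 2)); have y0 := normr_ge0 y.
split; last by rewrite expr2; nra.
rewrite -[y ^+ 2]real_normK ?num_real //.
by move: s1 s0 y0; move: `|sin _| `|y| => s w; nra.
Qed.

Lemma sin_sub_le y : `|sin y - y| <= y ^+ 2.
Proof.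
wlog y0 : y / 0 <= y.
  move=> W; have [/W//|/ltW y0] := leP 0 y.
  have := W (- y); rewrite sinN sqrrN.
  have -> : - sin y - - y = - (sin y - y) by ring.
  by rewrite normrN oppr_ge0; apply.
have d1 x : x \in `]0, y[ -> is_derive x 1 (fun x : R => sin x - x) (cos x - 1).
  by move=> _; exact: is_deriveB.
have d2 : {within `[0, y], continuous (fun x : R => sin x - x)}%classic.
  by apply: continuous_subspaceT => x; apply: cvgB; [exact: continuous_sin | exact: cvg_id].
have [c cy E] := MVT_segment y0 d1 d2.
move: E; rewrite sin0 !subr0 => ->; rewrite normrM (ger0_norm y0) expr2 ler_wpM2r //.
apply: le_trans (cos_sub1_le c).2 _.
by move: cy; rewrite in_itv /= => /andP[c0 cy]; rewrite ger0_norm.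
Qed.

Lemma expR_sub1_le x : `|expR x - 1| <= `|x| * expR `|x|.
Proof.
have a := expR_ge1Dx x; have b := expR_ge1Dx (- x).
have e0 := expR_gt0 x; have em : expR x * expR (- x) = 1 by rewrite expRxMexpNx_1.
have [x0|x0] := leP 0 x.
  rewrite (ger0_norm x0) ger0_norm; last by lra.
  by nra.
rewrite (ltr0_norm x0) ler0_norm; last by rewrite subr_le0 -(expR0 R) ler_expR ltW.
have : 1 <= expR (- x) by rewrite -(expR0 R) ler_expR; lra.
by nra.
Qed.

Lemma expR_sub1x_le x : `|expR x - 1 - x| <= x ^+ 2 * expR `|x|.
Proof.
have a := expR_ge1Dx x; have b := expR_ge1Dx (- x).
have e0 := expR_gt0 x; have em : expR x * expR (- x) = 1 by rewrite expRxMexpNx_1.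
rewrite ger0_norm; last by lra.
have [x0|x0] := leP 0 x.
  rewrite (ger0_norm x0) expr2.
  have h1 : expR x * (1 - x) <= 1 by rewrite -[leRHS]em ler_pM2l.
  have h2 : x * (expR x - 1) <= x * (x * expR x) by rewrite ler_wpM2l //; lra.
  by move: h1 h2; lra.
rewrite (ltr0_norm x0) expr2.
have : 1 <= expR (- x) by rewrite -(expR0 R) ler_expR; lra.
by nra.
Qed.

Lemma cexp_sub1x_le z : cabs (cexp z - 1 - z) <= 3 * cabs z ^+ 2 * expR (cabs z).
Proof.
case: z => x y; set z := Complex x y.
have zx : `|x| <= cabs z := cabs_ge_Re z.
have z2 : cabs z ^+ 2 = x ^+ 2 + y ^+ 2.
  by rewrite /z /cabs sqr_sqrtr // addr_ge0 ?sqr_ge0.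
have Ez : expR `|x| <= expR (cabs z) by rewrite ler_expR.
apply: le_trans (cabs_le_ReIm _) _.
have -> : complex.Re (cexp z - 1 - z) = (expR x - 1 - x) + expR x * (cos y - 1).
  by rewrite /z /=; ring.
have -> : complex.Im (cexp z - 1 - z) = expR x * (sin y - y) + (expR x - 1) * y.
  by rewrite /z /=; ring.
have h1 := expR_sub1x_le x; have h2 := (cos_sub1_le y).1; have h3 := sin_sub_le y.
have h4 := expR_sub1_le x.
have Ex : expR x <= expR `|x| by rewrite ler_expR ler_norm.
have ex0 := expR_gt0 x.
set E := expR (cabs z) in Ez *; set e := expR `|x| in Ez Ex h1 h4.
have e0 : 0 < e := expR_gt0 _.
have a1 : `|expR x - 1 - x + expR x * (cos y - 1)| <= x ^+ 2 * e + e * y ^+ 2.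
  apply: le_trans (ler_normD _ _) _; apply: lerD => //.
  by rewrite normrM (gtr0_norm ex0); apply: ler_pM => //; exact: ltW.
have a2 : `|expR x * (sin y - y) + (expR x - 1) * y| <= e * y ^+ 2 + `|x| * e * `|y|.
  apply: le_trans (ler_normD _ _) _; apply: lerD; rewrite normrM.
    by rewrite (gtr0_norm ex0); apply: ler_pM => //; exact: ltW.
  by rewrite ler_wpM2r.
have a3 : `|x| * `|y| <= (x ^+ 2 + y ^+ 2) / 2.
  rewrite -(real_normK (num_real x)) -(real_normK (num_real y)).
  have : 0 <= (`|x| - `|y|) ^+ 2 by exact: sqr_ge0.
  by rewrite !expr2; move: `|x| `|y| => p p'; lra.
have s1 := sqr_ge0 x; have s2 := sqr_ge0 y.
apply: (@le_trans _ _ (3 * cabs z ^+ 2 * e)); last first.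
  by rewrite ler_wpM2l // mulr_ge0 ?exprn_ge0 ?cabs_ge0.
rewrite z2; apply: le_trans (lerD a1 a2) _.
have a4 := ler_wpM2r (ltW e0) a3.
have b1 : 0 <= x ^+ 2 * e by rewrite mulr_ge0 // ltW.
have b2 : 0 <= y ^+ 2 * e by rewrite mulr_ge0 // ltW.
by move: a4 b1 b2; lra.
Qed.

(** Cut the segment into N equal pieces: the linear terms add up to at most |s1 - s0| G, and the N
    quadratic errors to K |s1 - s0|^2 / N. *)
Lemma mean_value_bound (g g' : C -> C) (s0 s1 : C) (G K h0 : R) : 0 < h0 -> 0 <= K ->
  (forall u v : R, 0 <= u <= 1 -> 0 <= v <= 1 ->
    let su := s0 + u%:C%C * (s1 - s0) in let sv := s0 + v%:C%C * (s1 - s0) in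
    cabs (sv - su) <= h0 -> cabs (g sv - g su - (sv - su) * g' su) <= K * cabs (sv - su) ^+ 2) ->
  (forall u : R, 0 <= u <= 1 -> cabs (g' (s0 + u%:C%C * (s1 - s0))) <= G) ->
  cabs (g s1 - g s0) <= cabs (s1 - s0) * G.
Proof.
move=> h00 K0 loc hG; pose D := cabs (s1 - s0); have D0 : 0 <= D := cabs_ge0 _.
apply/ler_addgt0Pr => e e0.
(* The first summand makes the pieces no longer than h0, the second makes the total quadratic error
   at most e. *)
pose N := (Num.truncn (D / h0 + K * D ^+ 2 / e)).+1.
have hN : D / h0 + K * D ^+ 2 / e < N%:R by exact: truncnS_gt.
have N0 : 0 < N%:R :> R by rewrite ltr0n.
have p1 : 0 <= D / h0 by rewrite divr_ge0 // ltW.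
have p2 : 0 <= K * D ^+ 2 / e by rewrite divr_ge0 ?mulr_ge0 ?exprn_ge0 // ltW.
have hD : D / N%:R <= h0.
  by rewrite ler_pdivrMr // mulrC -ler_pdivrMr //; move: hN p2; lra.
have hK : K * D ^+ 2 / N%:R <= e.
  by rewrite ler_pdivrMr // [e * _]mulrC -ler_pdivrMr //; move: hN p1; lra.
pose p (i : nat) := s0 + (i%:R / N%:R)%:C%C * (s1 - s0).
have pd i : p i.+1 - p i = (N%:R^-1)%:C%C * (s1 - s0).
  rewrite /p opprD addrACA subrr add0r -mulrBl -rmorphB /=; congr (_%:C%C * _).
  by rewrite -mulrBl -natr1 addrAC subrr add0r mul1r.
have cpd i : cabs (p i.+1 - p i) = D / N%:R.
  by rewrite pd cabsM cabs_real ger0_norm ?invr_ge0 ?(ltW N0) // mulrC.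
have st i : (i < N)%N -> cabs (g (p i.+1) - g (p i)) <= D / N%:R * G + K * (D / N%:R) ^+ 2.
  move=> iN.
  have u01 (i' : nat) : (i' <= N)%N -> 0 <= (i'%:R / N%:R : R) <= 1.
    by move=> le; rewrite divr_ge0 ?ler0n //= ler_pdivrMr // mul1r ler_nat.
  have l1 := loc _ _ (u01 i (ltnW iN)) (u01 i.+1 iN).
  rewrite /= -/(p i) -/(p i.+1) cpd in l1; have {}l1 := l1 hD.
  have -> : g (p i.+1) - g (p i) = (p i.+1 - p i) * g' (p i) + (g (p i.+1) - g (p i) - (p i.+1 - p i) * g' (p i)).
    by rewrite [RHS]addrC subrK.
  apply: le_trans (cabsD _ _) _; apply: lerD => //.
  rewrite cabsM cpd ler_wpM2l ?divr_ge0 ?(ltW N0) //.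
  exact: hG (u01 i (ltnW iN)).
have tot i : (i <= N)%N -> cabs (g (p i) - g (p 0%N)) <= i%:R * (D / N%:R * G + K * (D / N%:R) ^+ 2).
  elim: i => [_|i IH iN]; first by rewrite subrr cabs0 mul0r.
  have -> : g (p i.+1) - g (p 0%N) = (g (p i.+1) - g (p i)) + (g (p i) - g (p 0%N)).
    by rewrite addrA subrK.
  apply: le_trans (cabsD _ _) _; rewrite -natr1 mulrDl mul1r addrC.
  by apply: lerD; [exact: IH (ltnW iN) | exact: st].
have := tot N (leqnn N).
have -> : p 0%N = s0 by rewrite /p mul0r mul0r addr0.
have -> : p N = s1 by rewrite /p divff ?gt_eqF // mul1r addrC subrK.
move=> h; apply: le_trans h _; rewrite mulrDr.
have -> : N%:R * (D / N%:R * G) = D * G by field; rewrite gt_eqF.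
rewrite lerD2l; have -> : N%:R * (K * (D / N%:R) ^+ 2) = K * D ^+ 2 / N%:R by field; rewrite gt_eqF.
exact: hK.
Qed.

End ExpBounds.

(** * The differential equation in the logarithmic variable *)

Section StageTwo.
Variables (R : realType) (gamma : R).
Local Notation C := R[i].
Local Notation expo := (exponent gamma).
Local Notation expoX := (exponentX gamma).

(* In the variable s = ln x the coefficient functions become t = e^{i gamma s}, x = e^s, and
   delta = d/ds. *)
Definition tvar (s : C) : C := cexp ('i * (gamma%:C)%C * s).

Lemma cabs_tvar s : cabs (tvar s) = expR (- (gamma * complex.Im s)).
Proof.
rewrite /tvar cabs_cexp -complexiE; congr expR.
by case: s => x y /=; ring.
Qed.

Lemma cexp_expo k (z : int) l s : cexp (expo k z l * s) = cexp s ^+ k * (tvar s ^ (- z) * tvar s ^+ l).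
Proof.
have cexpz w : cexp ('i * (gamma%:C)%C * s * w%:~R) = tvar s ^ w.
  case: w => p; first by rewrite -pmulrn mulr_natr cexpMn.
  by rewrite NegzE rmorphN /= mulrN cexpN -pmulrn mulr_natr cexpMn -exprnN.
have -> : expo k z l * s = s *+ k + ('i * (gamma%:C)%C * s * (- z)%:~R + 'i * (gamma%:C)%C * s *+ l).
  rewrite /exponent rmorphB rmorphN /= -pmulrn mulrDl mulr_natl; congr (_ + _).
  by rewrite -mulr_natr; move: ('i * _) (z%:~R) (l%:R) => g zz ll; ring.
by rewrite !cexpD !cexpMn cexpz.
Qed.

Variables (r : nat -> int) (a : nat -> nat -> C).

(** With the factor x^k included, raising j by one is differentiation with respect to s. *)
Definition vcoef j k s := dcoef gamma r a j k (tvar s) * cexp s ^+ k.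

Lemma vcoefE j k s rho B : (0 < k)%N -> cabs (tvar s) <= rho -> bdd (expoX k (r k) j (a k)) rho B ->
  vcoef j k s = csum (fun l => expoX k (r k) j (a k) l * cexp (expo k (r k) l * s)) /\
  abs_bounded (fun l => expoX k (r k) j (a k) l * cexp (expo k (r k) l * s))
    (cabs (cexp s ^+ k * tvar s ^ (- r k)) * B).
Proof.
move=> k0 sr hB; have b := bdd_abs sr hB.
have E : (fun l => expoX k (r k) j (a k) l * cexp (expo k (r k) l * s)) =
   (fun l => (cexp s ^+ k * tvar s ^ (- r k)) * (expoX k (r k) j (a k) l * tvar s ^+ l)).
  by apply/funext => l; rewrite cexp_expo; ring.
rewrite E; split.
  by rewrite (csumZ _ b) /vcoef dcoefE // /laurent /ps; ring.
move=> N; rewrite (eq_bigr (fun l : 'I_N => cabs (cexp s ^+ k * tvar s ^ (- r k)) *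
   cabs (expoX k (r k) j (a k) l * tvar s ^+ l))) => [|l _]; last by rewrite -cabsM.
by rewrite -mulr_sumr ler_wpM2l ?cabs_ge0 //; exact: b.
Qed.

Lemma exprz_bound (t0 t1 : R) (z : int) : 0 < t0 ->
  exists2 Z, 0 <= Z & forall t, t0 <= t <= t1 -> t ^ z <= Z.
Proof.
move=> t00; case: z => p.
  exists (`|t1| ^+ p) => [|t /andP[a1 a2]]; first by rewrite exprn_ge0.
  have tp : 0 <= t := le_trans (ltW t00) a1.
  by rewrite -exprnP lerXn2r ?nnegrE // (le_trans a2) // ler_norm.
exists (t0 ^- p.+1) => [|t /andP[a1 a2]]; first by rewrite invr_ge0 exprn_ge0 // ltW.
have tp : 0 < t by apply: lt_le_trans a1.
by rewrite NegzE -exprnN lef_pV2 ?posrE ?exprn_gt0 // lerXn2r ?nnegrE // ltW.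
Qed.

Hypothesis gamma0 : gamma != 0.
Variable R' : R.
Hypothesis conv_a : forall k rho, (0 < k)%N -> 0 < rho < R' -> exists B, bdd (a k) rho B.

(** Each term is an exponential e^(lambda s), expanded to second order. The factor lambda^2 raises j
    by two, and e^(|lambda| h0) is paid for by a larger radius that is still below [R']; this fixes
    h0. *)
Lemma vcoef_local j k (tmin rho W : R) : (0 < k)%N -> 0 < tmin -> 0 < rho -> rho < R' ->
  exists K h0 : R, [/\ 0 <= K, 0 < h0 & forall s s', tmin <= cabs (tvar s) <= rho ->
     tmin <= cabs (tvar s') <= rho ->
     cabs (cexp s) <= W -> cabs (s' - s) <= h0 ->
     cabs (vcoef j k s' - vcoef j k s - (s' - s) * vcoef j.+1 k s) <= K * cabs (s' - s) ^+ 2].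
Proof.
move=> k0 tm0 rho0 rR.
have l1 : rho < (rho + R') / 2 by rewrite ltr_pdivlMr //; lra.
have l2 : (rho + R') / 2 < R' by rewrite ltr_pdivrMr //; lra.
have [d [d0 hd]] := expo_room gamma0 rho0 l1.
set rho1 := (rho + R') / 2 in l1 l2 hd.
have rho10 : 0 < rho1 by apply: lt_trans l1.
have l3 : rho1 < (rho1 + R') / 2 by rewrite ltr_pdivlMr //; lra.
have l4 : (rho1 + R') / 2 < R' by rewrite ltr_pdivrMr //; lra.
have l5 : 0 < (rho1 + R') / 2 < R' by rewrite (lt_trans rho10 l3).
have [B0 hB0] := conv_a k0 l5.
have ex p : exists B, bdd (expoX k (r k) p (a k)) rho1 B by exact: bdd_expoX_ex hB0.
have [Bj hBj] := ex j; have [Bj1 hBj1] := ex j.+1; have [Bj2 hBj2] := ex j.+2.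
have [Z Z0 hZ] := exprz_bound rho (- r k) tm0.
pose L0 := k%:R + `|gamma| * `|r k|%:~R : R.
have W1 : 0 <= `|W| by [].
pose K := 3 * expR (d * L0) * (`|W| ^+ k * Z) * Bj2.
exists K, d; split => //.
  by rewrite /K !mulr_ge0 ?expR_ge0 ?exprn_ge0 // (bdd_ge0 hBj2).
move=> s s' /andP[s1 s2] /andP[s'1 s'2] sW hd'.
have sr1 : cabs (tvar s) <= rho1 := le_trans s2 (ltW l1).
have sr2 : cabs (tvar s') <= rho1 := le_trans s'2 (ltW l1).
have [E1 b1] := vcoefE k0 sr2 hBj; have [E2 b2] := vcoefE k0 sr1 hBj.
have [E3 b3] := vcoefE k0 sr1 hBj1.
rewrite E1 E2 E3; set h := s' - s.
set f1 := fun l => _ in E1 b1 *; set f2 := fun l => _ in E2 b2 *; set f3 := fun l => _ in E3 b3 *.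
have -> : csum f1 - csum f2 - h * csum f3 =
   csum (fun l => f1 l + (-1 * f2 l + - h * f3 l)).
  have bz2 := abs_boundedZ (-1) b2; have bz3 := abs_boundedZ (- h) b3.
  have bz23 := abs_boundedD bz2 bz3.
  rewrite (csumD b1 bz23) (csumD bz2 bz3) (csumZ _ b2) (csumZ _ b3); ring.
have sd : cabs (tvar s) * expR (d * `|gamma|) <= rho1.
  by apply: le_trans hd; rewrite ler_wpM2r ?expR_ge0.
apply: cabs_csum => N.
pose Kc := 3 * expR (d * L0) * (`|W| ^+ k * Z) * cabs h ^+ 2.
have Kc0 : 0 <= Kc by rewrite /Kc !mulr_ge0 ?expR_ge0 ?exprn_ge0 ?cabs_ge0.
rewrite /K (_ : 3 * _ * _ * Bj2 * cabs h ^+ 2 = Kc * Bj2); last by rewrite /Kc; ring.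
apply: le_trans (ler_wpM2l Kc0 (hBj2 N)); rewrite mulr_sumr; apply: ler_sum => l _.
set lam := expo k (r k) l.
have -> : f1 l + (-1 * f2 l + - h * f3 l) =
    expoX k (r k) j (a k) l * (cexp s ^+ k * (tvar s ^ (- r k) * tvar s ^+ l)) * (cexp (lam * h) - 1 - lam * h).
  rewrite /f1 /f2 /f3 -/lam -cexp_expo -/lam.
  have -> : cexp (lam * s') = cexp (lam * s) * cexp (lam * h).
    by rewrite -cexpD -mulrDr /h addrC subrK.
  by rewrite /exponentX -/lam exprS; ring.
have lamle : cabs (lam * h) <= d * L0 + d * `|gamma| * l%:R.
  rewrite cabsM mulrC -mulrA -mulrDr; apply: ler_pM; rewrite ?cabs_ge0 //.
  exact: cabs_expo_le.
have e2 := cexp_sub1x_le (lam * h).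
have e3 : expR (cabs (lam * h)) <= expR (d * L0) * expR (d * `|gamma|) ^+ l.
  by rewrite -expRM_natr -expRD ler_expR.
rewrite cabsM; apply: le_trans (ler_wpM2l (cabs_ge0 _) e2) _.
have e4 : cabs (cexp s ^+ k * (tvar s ^ (- r k) * tvar s ^+ l)) <= `|W| ^+ k * Z * cabs (tvar s) ^+ l.
  rewrite mulrA cabsM !cabsM !cabsX; rewrite ler_wpM2r ?exprn_ge0 ?cabs_ge0 //.
  apply: ler_pM; rewrite ?exprn_ge0 ?cabs_ge0 //.
    by rewrite lerXn2r ?nnegrE ?cabs_ge0 // (le_trans sW) // ler_norm.
  by rewrite cabsXz; apply: hZ; rewrite s1.
rewrite (cabsM (expoX _ _ _ _ _)) (cabsM lam).
have -> : cabs (expoX k (r k) j.+2 (a k) l) = cabs (expoX k (r k) j (a k) l) * cabs lam ^+ 2.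
  by rewrite /exponentX -/lam -addn2 exprD !cabsM !cabsX; ring.
have x0 := cabs_ge0 (expoX k (r k) j (a k) l).
set x := cabs (expoX k (r k) j (a k) l) in x0 *.
have y0 := cabs_ge0 lam; set y := cabs lam in y0 *.
have z0 := cabs_ge0 h; rewrite cabsM -/y in e3.
set w := cabs (cexp s ^+ k * _) in e4 *.
have w0 : 0 <= w := cabs_ge0 _.
have e5 : w * expR (y * cabs h) <= (`|W| ^+ k * Z * cabs (tvar s) ^+ l) * (expR (d * L0) * expR (d * `|gamma|) ^+ l).
  by apply: ler_pM => //; rewrite ?expR_ge0.
have e6 : (cabs (tvar s) * expR (d * `|gamma|)) ^+ l <= rho1 ^+ l.
  apply: lerXn2r => //; rewrite nnegrE; last exact: ltW.
  by rewrite mulr_ge0 ?cabs_ge0 ?expR_ge0.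
have e7 : w * expR (y * cabs h) <= (`|W| ^+ k * Z * expR (d * L0)) * rho1 ^+ l.
  apply: le_trans e5 _; apply: le_trans (ler_wpM2l _ e6); last by rewrite !mulr_ge0 ?exprn_ge0 ?expR_ge0.
  by rewrite exprMn le_eqVlt; apply/orP; left; apply/eqP; ring.
have q0 : 0 <= 3 * x * y ^+ 2 * cabs h ^+ 2 by rewrite !mulr_ge0 // exprn_ge0.
have := ler_wpM2l q0 e7.
rewrite /Kc exprMn; set E := expR (y * _); set P := _ ^+ k; set Q := rho1 ^+ l.
by congr (_ <= _); ring.
Qed.

Lemma tvar_seg (s0 s1 : C) (tmin rho u : R) : 0 <= u <= 1 -> tmin <= cabs (tvar s0) <= rho ->
  tmin <= cabs (tvar s1) <= rho -> tmin <= cabs (tvar (s0 + u%:C%C * (s1 - s0))) <= rho.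
Proof.
move=> /andP[u0 u1] /andP[a1 a2] /andP[b1 b2].
suff : Num.min (cabs (tvar s0)) (cabs (tvar s1)) <= cabs (tvar (s0 + u%:C%C * (s1 - s0))) <=
   Num.max (cabs (tvar s0)) (cabs (tvar s1)).
  move=> /andP[h1 h2]; apply/andP; split.
    by apply: le_trans h1; rewrite le_min a1 b1.
  by apply: le_trans h2 _; rewrite ge_max a2 b2.
rewrite !cabs_tvar.
have -> : - (gamma * complex.Im (s0 + u%:C%C * (s1 - s0))) =
   - (gamma * complex.Im s0) + u * (- (gamma * complex.Im s1) - - (gamma * complex.Im s0)).
  by case: s0 {a1 a2} => x0 y0; case: s1 {b1 b2} => x1 y1 /=; ring.
set p := - (gamma * complex.Im s0); set p' := - (gamma * complex.Im s1).
rewrite ge_min le_max !ler_expR; apply/andP; split; apply/orP.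
  by have [h|h] := leP p p'; [left | right]; nra.
by have [h|h] := leP p p'; [right | left]; nra.
Qed.

Lemma vcoef_mean j k (s0 s1 : C) (tmin rho W G : R) : (0 < k)%N -> 0 < tmin -> rho < R' ->
  (forall u, 0 <= u <= 1 -> tmin <= cabs (tvar (s0 + u%:C%C * (s1 - s0))) <= rho) ->
  (forall u, 0 <= u <= 1 -> cabs (cexp (s0 + u%:C%C * (s1 - s0))) <= W) ->
  (forall u, 0 <= u <= 1 -> cabs (vcoef j.+1 k (s0 + u%:C%C * (s1 - s0))) <= G) ->
  cabs (vcoef j k s1 - vcoef j k s0) <= cabs (s1 - s0) * G.
Proof.
move=> k0 tm0 rR ht hW hG.
have rho0 : 0 < rho.
  have /andP[h1 h2] := ht 0 (introT andP (conj (lexx 0) ler01)).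
  exact: lt_le_trans tm0 (le_trans h1 h2).
have [K [h0 [K0 h00 loc]]] := vcoef_local j W k0 tm0 rho0 rR.
apply: (@mean_value_bound R (vcoef j k) (vcoef j.+1 k) s0 s1 G K h0 h00 K0) => // u v hu hv su sv le.
by apply: loc => //; [exact: ht | exact: ht | exact: hW].
Qed.

Variables (n : nat) (F : nat -> {ffun 'I_n.+1 -> nat} -> C) (m : nat).
Hypothesis hF : mps_convergent F.
Hypothesis idF : forall k t, 0 < cabs t < R' -> subst_exotic F gamma r a k t = 0.
Hypothesis iddF : forall j k t, (k < m)%N -> 0 < cabs t < R' ->
  subst_exotic (dpart F j) gamma r a k t = 0.

Definition seg (s0 s1 s : C) := exists2 u : R, 0 <= u <= 1 & s = s0 + u%:C%C * (s1 - s0).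

Lemma seg_left s0 s1 : seg s0 s1 s0.
Proof. by exists 0; rewrite ?lexx ?ler01 // mul0r addr0. Qed.

Lemma seg_sub s0 s1 s s' z : seg s0 s1 s -> seg s0 s1 s' -> seg s s' z -> seg s0 s1 z.
Proof.
move=> [u /andP[u0 u1] ->] [v /andP[v0 v1] ->] [w /andP[w0 w1] ->].
exists (u + w * (v - u)); first by apply/andP; split; nra.
by rewrite !(rmorphD, rmorphM, rmorphN) /=; ring.
Qed.

Lemma seg_mul (s0 d : C) (u v w : R) : u * v = w ->
  s0 + u%:C%C * (s0 + v%:C%C * d - s0) = s0 + w%:C%C * d.
Proof. by move=> <-; rewrite [s0 + v%:C%C * d]addrC addrK mulrA rmorphM. Qed.

Lemma seg_dist s0 s1 s : seg s0 s1 s -> cabs (s - s0) <= cabs (s1 - s0).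
Proof.
move=> [u /andP[u0 u1] ->]; rewrite addrAC subrr add0r cabsM cabs_real ger0_norm //.
by rewrite ler_piMl ?cabs_ge0.
Qed.

Section Continuation.
Variables (tmin rho w W Ma ca : R).
Hypotheses (tm0 : 0 < tmin) (rR : rho < R') (w0 : 0 < w) (Ma0 : 0 <= Ma) (ca0 : 0 < ca).

(** None of these bounds depends on k, so that one step length serves for every coefficient. *)
Definition admissible s := [/\ tmin <= cabs (tvar s) <= rho, w <= cabs (cexp s) <= W,
  forall j, cabs (subst_exotic (dpart F j) gamma r a m (tvar s)) <= Ma &
  ca <= cabs (subst_exotic (dpart F ord_max) gamma r a m (tvar s))].

Definition growing (P : C -> Prop) := exists C0 A0 : R, [/\ 0 <= C0, 0 < A0 &
  forall s (j : 'I_n.+1) k, P s -> cabs (dcoef gamma r a j k (tvar s)) <= C0 * A0 ^+ k].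

(** Let M bound all [vcoef j k], j <= n, on the segment, and T be its length. For j < n the mean
    value inequality gives the initial value plus T M; for j = n the equation is solved for the top
    derivative, which costs a factor Q = n Ma / ca. As T (1 + Q) <= 1/2, M is halved up to data, for
    every k at once. *)
Lemma growing_step s0 s1 : (forall s, seg s0 s1 s -> admissible s) ->
  cabs (s1 - s0) * (2 * (1 + n%:R * Ma / ca)) <= 1 ->
  growing (eq s0) -> growing (seg s0 s1).
Proof.
move=> adm short [C0 [A0 [C00 A00 init]]].
have W0 : 0 < W.
  by have [_ /andP[h1 h2] _ _] := adm _ (seg_left s0 s1); apply: lt_le_trans w0 (le_trans h1 h2).
have rho0 : 0 < rho.
  by have [/andP[h1 h2] _ _ _] := adm _ (seg_left s0 s1); apply: lt_le_trans tm0 (le_trans h1 h2).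
pose Q := n%:R * Ma / ca; have Q0 : 0 <= Q by rewrite /Q divr_ge0 ?mulr_ge0 // ltW.
pose K0 := 2 * (W ^+ m / (ca * w ^+ m) + (1 + Q)).
have X0 : 0 <= W ^+ m / (ca * w ^+ m).
  by rewrite divr_ge0 ?exprn_ge0 ?(ltW W0) // mulr_ge0 ?exprn_ge0 ?ltW.
have K00 : 0 <= K0 by rewrite /K0; lra.
(* The weight (|x|/W)^k is at most 1 and multiplicative in k; it makes the seminorm measure [vcoef],
   to which the mean value inequality applies, and not the bare coefficient. *)
pose nb k (h : C -> C) u := 0 <= u /\ forall s, seg s0 s1 s -> cabs (h s) * cabs (cexp s) ^+ k <= u * W ^+ k.
have fin j k : exists u, forall s, seg s0 s1 s -> cabs (dcoef gamma r a j k (tvar s)) <= u.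
  case: (posnP k) => [->|k0]; first by exists 0 => s _; rewrite cabs0.
  have l1 : rho < (rho + R') / 2 by rewrite ltr_pdivlMr //; move: rR; lra.
  have l2 : (rho + R') / 2 < R' by rewrite ltr_pdivrMr //; move: rR; lra.
  have l3 : 0 < (rho + R') / 2 < R' by rewrite (lt_trans rho0 l1).
  have [B0 hB0] := conv_a k0 l3; have [B hB] := bdd_expoX_ex gamma0 k (r k) j rho0 l1 hB0.
  have [Z Z0 hZ] := exprz_bound rho (- r k) tm0.
  exists (Z * B) => s /adm[h _ _ _]; rewrite dcoefE // /laurent cabsM cabsXz.
  by apply: ler_pM; rewrite ?exprz_ge0 ?cabs_ge0 ?hZ // (cabs_ps _ hB) //; case/andP: h.
have [] := @majorant_growth R C (seg s0 s1) nb _ _ _ _ _ _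
  n F (fun j k s => dcoef gamma r a j k (tvar s)) m m.+2 K0 C0 A0 hF _ (leqnn _) K00 C00 (ltW A00).
- move=> k h h' u e [u0 H]; split=> // s hs; rewrite -e //; exact: H.
- by move=> k h u [].
- move=> k h u v uv [u0 H]; split; first exact: le_trans uv.
  by move=> s hs; apply: le_trans (H s hs) _; rewrite ler_wpM2r ?exprn_ge0 // ltW.
- move=> k z; split=> [|s /adm[_ /andP[_ h] _ _]]; first exact: cabs_ge0.
  by rewrite ler_wpM2l ?cabs_ge0 // lerXn2r ?nnegrE ?cabs_ge0 // ltW.
- move=> k h h' u v [u0 H] [v0 H']; split=> [|s hs]; first exact: addr_ge0.
  rewrite mulrDl; apply: le_trans (lerD (H s hs) (H' s hs)).
  by rewrite -mulrDl ler_wpM2r ?exprn_ge0 ?cabs_ge0 // cabsD.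
- move=> k k' h h' u v [u0 H] [v0 H']; split=> [|s hs]; first exact: mulr_ge0.
  rewrite cabsM !exprD mulrACA [u * v * _]mulrACA.
  by apply: ler_pM; rewrite ?mulr_ge0 ?exprn_ge0 ?cabs_ge0 ?H ?H'.
- by [].
- by move=> k s /adm[/andP[h1 h2] _ _ _]; apply: idF; rewrite (lt_le_trans tm0) // (le_lt_trans h2).
- by move=> j k s /adm[/andP[h1 h2] _ _ _] km; apply: iddF => //; rewrite (lt_le_trans tm0) // (le_lt_trans h2).
- move=> j k; have [u hu] := fin j k; exists u.
  have u0 : 0 <= u := le_trans (cabs_ge0 _) (hu _ (seg_left s0 s1)).
  split=> // s hs; have [_ /andP[_ h] _ _] := adm s hs.
  apply: ler_pM; rewrite ?exprn_ge0 ?cabs_ge0 ?hu //.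
  by rewrite lerXn2r ?nnegrE ?cabs_ge0 // ltW.
- move=> k f u mk [u0 hf] eqn; have k0 : (0 < k)%N by apply: leq_trans mk.
  pose g (x : 'I_n.+1 * {s | seg s0 s1 s}) := cabs (vcoef x.1 k (sval x.2)).
  pose I0 := C0 * A0 ^+ k * W ^+ k.
  have I00 : 0 <= I0 by rewrite /I0 !mulr_ge0 ?exprn_ge0 // ltW.
  (* The bound on [f] has grading m + k, but [f] is multiplied by x^k only; the missing |x|^m is at
     least w^m. *)
  pose U := u * W ^+ (m + k) / w ^+ m.
  have gE j s : cabs (vcoef j k s) = cabs (dcoef gamma r a j k (tvar s)) * cabs (cexp s) ^+ k.
    by rewrite /vcoef cabsM cabsX.
  have /choice[uj huj] : forall j : 'I_n.+1, exists u,
      forall s, seg s0 s1 s -> cabs (dcoef gamma r a j k (tvar s)) <= u.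
    by move=> j; exact: fin.
  have key : forall x, g x <= 2 * (U / ca + (1 + Q) * I0).
    apply: (@halving R _ g ((\sum_j `|uj j|) * W ^+ k)).
      move=> [j [s hs]]; rewrite /g /= gE.
      have [_ /andP[_ h] _ _] := adm s hs.
      apply: ler_pM; rewrite ?exprn_ge0 ?cabs_ge0 //.
        apply: le_trans (huj j s hs) _; rewrite (bigD1 j) //= (le_trans (ler_norm _)) // lerDl.
        exact: sumr_ge0.
      by rewrite lerXn2r ?nnegrE ?cabs_ge0 // ltW.
    move=> M hM.
    have M0 : 0 <= M := le_trans (cabs_ge0 _) (hM (ord0, exist _ _ (seg_left s0 s1))).
    pose T := cabs (s1 - s0).
    have T0 : 0 <= T := cabs_ge0 _.
    have low (j : 'I_n.+1) s : (j < n)%N -> seg s0 s1 s -> cabs (vcoef j k s) <= I0 + T * M.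
      move=> jn hs.
      have vI : cabs (vcoef j k s0) <= I0.
        rewrite gE /I0; apply: ler_pM; rewrite ?exprn_ge0 ?cabs_ge0 ?init //.
        have [_ /andP[_ h] _ _] := adm _ (seg_left s0 s1).
        by rewrite lerXn2r ?nnegrE ?cabs_ge0 // ltW.
      have sub v : 0 <= v <= 1 -> seg s0 s1 (s0 + v%:C%C * (s - s0)).
        by move=> hv; apply: (seg_sub (seg_left s0 s1) hs); exists v.
      have mv : cabs (vcoef j k s - vcoef j k s0) <= cabs (s - s0) * M.
        apply: (vcoef_mean k0 tm0 rR (W := W)) => v /sub hv.
        - by have [] := adm _ hv.
        - by have [_ /andP[]] := adm _ hv.
        - have jn' : (j.+1 < n.+1)%N by [].
          exact: hM (Ordinal jn', exist _ _ hv).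
      have := cabsD (vcoef j k s0) (vcoef j k s - vcoef j k s0).
      rewrite addrC subrK => h; apply: le_trans h _; apply: lerD => //.
      by apply: le_trans mv _; rewrite ler_wpM2r // seg_dist.
    have h2 : T * M * (1 + Q) <= M / 2.
      have := ler_wpM2r M0 short; rewrite -/T -/Q mul1r; lra.
    have TM0 : 0 <= T * M by exact: mulr_ge0.
    have h3 : 0 <= T * M * Q by exact: mulr_ge0.
    have h4 : 0 <= Q * I0 by rewrite mulr_ge0.
    have U0 : 0 <= U by rewrite /U divr_ge0 ?mulr_ge0 ?exprn_ge0 // ltW.
    have Uc0 : 0 <= U / ca by rewrite divr_ge0 // ltW.
    move=> [j [s hs]]; rewrite /g /=.
    case: (ltnP j n) => [jn|nj].
      by apply: le_trans (low j s jn hs) _; move: h2 h3 h4; lra.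
    have -> : nat_of_ord j = (ord_max : 'I_n.+1) by apply/eqP; rewrite eqn_leq nj -ltnS ltn_ord.
    have [_ /andP[wl _] hMa hca] := adm s hs.
    pose al j := subst_exotic (dpart F j) gamma r a m (tvar s).
    have E : al ord_max * vcoef n k s = f s * cexp s ^+ k - \sum_(i < n) al (widen_ord (leqnSn n) i) * vcoef i k s.
      rewrite -(eqn s hs) big_ord_recr /= mulrDl mulr_suml /al /vcoef.
      rewrite [\sum_(i < n) _](eq_bigr (fun i : 'I_n =>
        subst_exotic (dpart F (widen_ord (leqnSn n) i)) gamma r a m (tvar s) *
        (dcoef gamma r a i k (tvar s) * cexp s ^+ k))) => [|i _]; last by rewrite mulrA.
      by rewrite [X in _ = X - _]addrC addrK mulrA.
    have b1 : cabs (f s * cexp s ^+ k) <= U.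
      rewrite /U ler_pdivlMr ?exprn_gt0 // cabsM cabsX.
      apply: le_trans (hf s hs); rewrite exprD [_ ^+ m * _]mulrC mulrA.
      rewrite ler_wpM2l ?mulr_ge0 ?exprn_ge0 ?cabs_ge0 // lerXn2r ?nnegrE ?cabs_ge0 // ltW //.
    have b2 : cabs (\sum_(i < n) al (widen_ord (leqnSn n) i) * vcoef i k s) <= n%:R * (Ma * (I0 + T * M)).
      apply: le_trans (cabs_sum _ _ _) _.
      apply: (@le_trans _ _ (\sum_(i < n) Ma * (I0 + T * M))); last by rewrite sumr_const card_ord mulr_natl.
      apply: ler_sum => i _; rewrite cabsM; apply: ler_pM; rewrite ?cabs_ge0 ?hMa //.
      by apply: (low (widen_ord (leqnSn n) i)) => //=.
    have b3 : ca * cabs (vcoef n k s) <= U + n%:R * (Ma * (I0 + T * M)).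
      apply: (@le_trans _ _ (cabs (al ord_max * vcoef n k s))).
        by rewrite cabsM ler_wpM2r ?cabs_ge0.
      rewrite E; apply: le_trans (cabsD _ _) _; rewrite cabsN; exact: lerD.
    have b4 : cabs (vcoef n k s) <= U / ca + Q * (I0 + T * M).
      rewrite -(ler_pM2l ca0); apply: le_trans b3 _.
      by rewrite le_eqVlt; apply/orP; left; apply/eqP; rewrite /Q; field; rewrite gt_eqF.
    apply: le_trans b4 _; by move: h2 TM0 M0 I00; lra.
  move=> j; split=> [|s hs].
    by rewrite mulr_ge0 // addr_ge0 // mulr_ge0 ?exprn_ge0 // ltW.
  rewrite -gE; apply: le_trans (key (j, exist _ s hs)) _.
  have Wk : 0 <= W ^+ k by rewrite exprn_ge0 // ltW.
  pose X := W ^+ m / (ca * w ^+ m); rewrite -/X in X0.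
  have -> : U / ca = X * u * W ^+ k.
    by rewrite /U /X exprD; field; rewrite !gt_eqF ?exprn_gt0.
  rewrite /I0 /K0 -/X.
  have i1 : 0 <= X * (C0 * A0 ^+ k * W ^+ k) by rewrite mulr_ge0.
  have i2 : 0 <= (1 + Q) * (u * W ^+ k) by rewrite !mulr_ge0 //; lra.
  by move: i1 i2; lra.
(* Returning to the coefficients divides by |x|^k >= w^k, whence the ratio W / w. *)
move=> C1 [A1 [C10 A10 H]]; exists C1, (A1 * (W / w)); split=> //; first by rewrite mulr_gt0 // divr_gt0.
move=> s j k hs; have [_ hh] := H j k; have [_ /andP[wl _] _ _] := adm s hs.
have cs0 : 0 < cabs (cexp s) by apply: lt_le_trans wl.
rewrite exprMn exprMn exprVn !mulrA ler_pdivlMr ?exprn_gt0 //.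
apply: le_trans (hh s hs).
by rewrite ler_wpM2l ?cabs_ge0 // lerXn2r ?nnegrE // ltW.
Qed.

Lemma growingU (P Q S : C -> Prop) : growing P -> growing Q -> (forall s, S s -> P s \/ Q s) -> growing S.
Proof.
move=> [C0 [A0 [C00 A00 h]]] [C1 [A1 [C10 A10 h']]] H; exists (C0 + C1), (A0 + A1); split.
- exact: addr_ge0.
- exact: addr_gt0.
move=> s j k /H[] hs.
  apply: le_trans (h s j k hs) _; apply: ler_pM; rewrite ?exprn_ge0 ?(ltW A00) //; first by rewrite lerDl.
  by rewrite lerXn2r ?nnegrE ?addr_ge0 ?(ltW A00) ?(ltW A10) // lerDl ltW.
apply: le_trans (h' s j k hs) _; apply: ler_pM; rewrite ?exprn_ge0 ?(ltW A10) //; first by rewrite lerDr.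
by rewrite lerXn2r ?nnegrE ?addr_ge0 ?(ltW A00) ?(ltW A10) // lerDr ltW.
Qed.

(** The growth constants may deteriorate at each short piece, but the number of pieces depends on
    the length of the segment and not on k. *)
Lemma growing_seg s0 s1 : (forall s, seg s0 s1 s -> admissible s) ->
  growing (eq s0) -> growing (seg s0 s1).
Proof.
move=> adm init.
pose L := cabs (s1 - s0) * (2 * (1 + n%:R * Ma / ca)).
pose N := (Num.truncn L).+1.
have hN : L < N%:R by exact: truncnS_gt.
have N0 : 0 < N%:R :> R by rewrite ltr0n.
pose p (i : nat) := s0 + (i%:R / N%:R)%:C%C * (s1 - s0).
have pS i : (i <= N)%N -> seg s0 s1 (p i).
  move=> iN; exists (i%:R / N%:R) => //.
  by rewrite divr_ge0 ?ler0n //= ler_pdivrMr // mul1r ler_nat.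
have pd i : p i.+1 - p i = (N%:R^-1)%:C%C * (s1 - s0).
  rewrite /p opprD addrACA subrr add0r -mulrBl -rmorphB /=; congr (_%:C%C * _).
  by rewrite -mulrBl -natr1 addrAC subrr add0r mul1r.
have st i : (i < N)%N -> growing (eq (p i)) -> growing (seg (p i) (p i.+1)).
  move=> iN; apply: growing_step.
    by move=> s hs; apply: adm; apply: seg_sub hs; apply: pS => //; exact: ltnW.
  rewrite pd cabsM cabs_real ger0_norm ?invr_ge0 ?(ltW N0) // -mulrA -/L.
  by rewrite mulrC ler_pdivrMr // mul1r ltW.
have it i : (i <= N)%N -> growing (seg s0 (p i)).
  elim: i => [_|i IH iN].
    apply: (growingU init init) => s [u _ ->]; left.
    by rewrite /p mul0r mul0r addr0 subrr mulr0 addr0.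
  have IHi := IH (ltnW iN).
  have h : growing (eq (p i)).
    apply: (growingU IHi IHi) => s <-; left; exists 1; rewrite ?ler01 ?lexx //.
    by rewrite mul1r addrC subrK.
  apply: (growingU IHi (st i iN h)) => s [u /andP[u0 u1] ->].
  have [le|gt] := leP (u * i.+1%:R) i%:R.
    left; case: (posnP i) le => [-> le|i0 le].
      have -> : u = 0 by apply/eqP; rewrite eq_le u0 andbT; move: le; rewrite mulr1.
      by exists 0; rewrite ?lexx ?ler01 //= !mul0r.
    have i0' : i%:R != 0 :> R by rewrite pnatr_eq0 -lt0n.
    exists (u * i.+1%:R / i%:R).
      rewrite divr_ge0 ?mulr_ge0 ?ler0n //= ler_pdivrMr ?mul1r //.
      by rewrite ltr0n.
    rewrite /p (seg_mul _ _ (erefl _)) (@seg_mul _ _ _ _ (u * (i.+1%:R / N%:R))) //.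
    by field; rewrite i0' gt_eqF.
  right; exists (u * i.+1%:R - i%:R).
    apply/andP; split; first by move: gt; lra.
    by rewrite lerBlDr addrC natr1 ler_piMl.
  rewrite pd /p (seg_mul _ _ (erefl _)) -[RHS]addrA; congr (_ + _).
  rewrite mulrA -mulrDl -rmorphM -rmorphD; congr (_%:C%C * _).
  by field; rewrite gt_eqF.
have := it N (leqnn N).
by have -> : p N = s1 by rewrite /p divff ?gt_eqF // mul1r addrC subrK.
Qed.

End Continuation.
End StageTwo.

(** * Convergent Laurent expansions are stable under substitution *)

Section LaurentCoefficients.
Variable R : realType.
Local Notation C := R[i].
Variable rho : R.
Hypothesis rho0 : 0 < rho.
Implicit Types (h : C -> C) (P Q : C -> {poly C}).

Definition has_laurent h := exists u, nbl rho h u.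

Lemma has_laurent_ext h h' : (forall t, 0 < cabs t < rho -> h t = h' t) -> has_laurent h -> has_laurent h'.
Proof. by move=> E [u hu]; exists u; exact: nbl_ext hu. Qed.

Lemma has_laurent_cst z : has_laurent (fun=> z).
Proof. by exists (cabs z); exact: nbl_cst. Qed.

Lemma has_laurentD h h' : has_laurent h -> has_laurent h' -> has_laurent (fun t => h t + h' t).
Proof. by move=> [u hu] [v hv]; exists (u + v); exact: nblD. Qed.

Lemma has_laurentM h h' : has_laurent h -> has_laurent h' -> has_laurent (fun t => h t * h' t).
Proof. by move=> [u hu] [v hv]; exists (u * v); exact: nblM. Qed.

Lemma has_laurentN h : has_laurent h -> has_laurent (fun t => - h t).
Proof.
move=> hh; apply: has_laurent_ext (has_laurentM (has_laurent_cst (-1)) hh) => t _.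
by rewrite mulN1r.
Qed.

Lemma has_laurent_sum (I : Type) (s : seq I) (h : I -> C -> C) :
  (forall i, has_laurent (h i)) -> has_laurent (fun t => \sum_(i <- s) h i t).
Proof.
move=> H; elim: s => [|i s IH].
  by apply: has_laurent_ext (has_laurent_cst 0) => t _; rewrite big_nil.
by apply: has_laurent_ext (has_laurentD (H i) IH) => t _; rewrite big_cons.
Qed.

Lemma has_laurent_exprz (z : int) : has_laurent (fun t => t ^ z).
Proof.
exists (rho ^ z), (- z), (fun l => (l == 0%N)%:R); split.
  case=> [|N]; first by rewrite big_ord0 -expfzDr ?gt_eqF // addrN.
  rewrite big_ord_recl big1 => [|l _]; last by rewrite cabs0 mul0r.
  by rewrite cabs1 mul1r addr0 -expfzDr ?gt_eqF // addrN.
by move=> t _; rewrite /laurent psX opprK mulr1.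
Qed.

Definition poly_laurent P := forall p, has_laurent (fun t => (P t)`_p).

Lemma poly_laurentM P Q : poly_laurent P -> poly_laurent Q -> poly_laurent (fun t => P t * Q t).
Proof.
move=> hP hQ p; have := @has_laurent_sum _ (index_enum 'I_p.+1) (fun i t => (P t)`_i * (Q t)`_(p - i))
  (fun i => has_laurentM (hP i) (hQ (p - i)%N)).
by apply: has_laurent_ext => t _; rewrite coefM.
Qed.

Lemma poly_laurent_cst p : poly_laurent (fun=> p).
Proof. by move=> i; exact: has_laurent_cst. Qed.

Lemma poly_laurent_sum (I : Type) (s : seq I) (P : I -> C -> {poly C}) :
  (forall i, poly_laurent (P i)) -> poly_laurent (fun t => \sum_(i <- s) P i t).
Proof.
move=> H p; have := @has_laurent_sum _ s (fun i t => (P i t)`_p) (fun i => H i p).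
by apply: has_laurent_ext => t _; rewrite coef_sum.
Qed.

Lemma poly_laurentZ h P : has_laurent h -> poly_laurent P -> poly_laurent (fun t => h t *: P t).
Proof.
move=> hh hP p; have := has_laurentM hh (hP p).
by apply: has_laurent_ext => t _; rewrite coefZ.
Qed.

Lemma poly_laurentX P e : poly_laurent P -> poly_laurent (fun t => P t ^+ e).
Proof.
move=> hP; elim: e => [|e IH]; first exact: (poly_laurent_cst 1).
move=> p; have := poly_laurentM hP IH p.
by apply: has_laurent_ext => t _; rewrite exprS.
Qed.

Lemma poly_laurent_prod (I : Type) (s : seq I) (P : I -> C -> {poly C}) :
  (forall i, poly_laurent (P i)) -> poly_laurent (fun t => \prod_(i <- s) P i t).
Proof.
move=> H; elim: s => [|i s IH] p.
  by apply: has_laurent_ext (poly_laurent_cst 1 p) => t _; rewrite big_nil.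
by apply: has_laurent_ext (poly_laurentM (H i) IH p) => t _; rewrite big_cons.
Qed.

Lemma poly_laurent_psubst n (G : nat -> {ffun 'I_n.+1 -> nat} -> C) M (Y : 'I_n.+1 -> C -> {poly C}) :
  (forall j, poly_laurent (Y j)) -> poly_laurent (fun t => psubst G M (Y ^~ t)).
Proof.
move=> hY; apply: poly_laurent_sum => a; apply: poly_laurent_sum => b.
apply: poly_laurentZ; first exact: has_laurent_cst.
apply: poly_laurentM; first exact: poly_laurent_cst.
by apply: poly_laurent_prod => j; exact: poly_laurentX.
Qed.

Lemma poly_laurent_poly K (c : nat -> C -> C) :
  (forall i, (i < K)%N -> has_laurent (c i)) -> poly_laurent (fun t => \poly_(i < K) c i t).
Proof.
move=> h p; case: (ltnP p K) => pK.
  by apply: has_laurent_ext (h p pK) => t _; rewrite coef_poly pK.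
by apply: has_laurent_ext (has_laurent_cst 0) => t _; rewrite coef_poly ltnNge pK.
Qed.

Lemma has_laurent_subst_coef n (G : nat -> {ffun 'I_n.+1 -> nat} -> C) (c : 'I_n.+1 -> nat -> C -> C) k :
  (forall j i, (i <= k)%N -> has_laurent (c j i)) ->
  has_laurent (fun t => subst_coef G (fun j i => c j i t) k).
Proof.
move=> h; have hY j : poly_laurent (fun t => \poly_(i < k.+1) c j i t).
  by apply: poly_laurent_poly => i; exact: h.
have := @poly_laurent_psubst n G k.+1 (fun j t => \poly_(i < k.+1) c j i t) hY k.
by apply: has_laurent_ext => t _; rewrite subst_coefE.
Qed.

End LaurentCoefficients.

(** Finitely many values leave an interval just above x free: z is kept below every value that
    exceeds x. *)
Lemma seq_gap (R : realType) (C : eqType) (f : C -> R) (zs : seq C) (x y : R) : x < y ->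
  exists z, [/\ x < z, z <= y & forall w, w \in zs -> x < f w -> z < f w].
Proof.
move=> xy; elim: zs => [|w zs [z [xz zy IH]]]; first by exists y; split.
have [fx|xf] := leP (f w) x.
  exists z; split=> // w'; rewrite inE => /orP[/eqP ->|]; last exact: IH.
  by move=> /(le_lt_trans fx); rewrite ltxx.
exists (Num.min z ((x + f w) / 2)); split.
- by rewrite lt_min xz ltr_pdivlMr //; lra.
- by rewrite ge_min zy.
- move=> w'; rewrite inE => /orP[/eqP -> _|hw xw]; rewrite gt_min; last by rewrite IH.
  by apply/orP; right; rewrite ltr_pdivrMr //; lra.
Qed.

(** * Induction extending every coefficient beyond the given disc *)

Section Extension.
Variables (R : realType) (gamma : R).
Local Notation C := R[i].
Local Notation expoX := (exponentX gamma).
Hypothesis gamma0 : gamma != 0.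
Variables (n : nat) (F : nat -> {ffun 'I_n.+1 -> nat} -> C) (r : nat -> int) (a : nat -> nat -> C).

Lemma has_laurent_dcoef rho (j k : nat) : 0 < rho ->
  ((0 < k)%N -> exists sigma B, rho < sigma /\ bdd (a k) sigma B) ->
  has_laurent rho (dcoef gamma r a j k).
Proof.
move=> rho0; case: (posnP k) => [->|k0] h.
  by apply: has_laurent_ext (has_laurent_cst _ 0) => t _.
by have [sigma [B [rs hB]]] := h isT; exact: (nbl_dcoef gamma0 r j rho0 rs hB).
Qed.

Lemma has_laurent_subst rho (G : nat -> {ffun 'I_n.+1 -> nat} -> C) k : 0 < rho ->
  (forall i, (0 < i <= k)%N -> exists sigma B, rho < sigma /\ bdd (a i) sigma B) ->
  has_laurent rho (subst_exotic G gamma r a k).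
Proof.
move=> rho0 h; apply: has_laurent_subst_coef => // j i ik.
by apply: has_laurent_dcoef => // i0; apply: h; rewrite i0.
Qed.

(** Identity principle: on a disc containing t and slightly smaller than that of radius [rho] the
    function has a convergent Laurent expansion, and its germ at 0 vanishes. *)
Lemma subst_exotic_eq0 rho (G : nat -> {ffun 'I_n.+1 -> nat} -> C) k :
  (forall i sigma, (0 < i <= k)%N -> 0 < sigma < rho -> exists B, bdd (a i) sigma B) ->
  germ_zero (subst_exotic G gamma r a k) ->
  forall t, 0 < cabs t < rho -> subst_exotic G gamma r a k t = 0.
Proof.
move=> h [e [e0 he]] t /andP[t0 tr].
have s0 : 0 < (cabs t + rho) / 2 by rewrite divr_gt0 //; lra.
have [|u hu] := @has_laurent_subst ((cabs t + rho) / 2) G k s0.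
  move=> i ik; exists ((cabs t + rho) / 2 / 2 + rho / 2).
  have [|B hB] := h i ((cabs t + rho) / 2 / 2 + rho / 2) ik; last by exists B; split=> //; lra.
  by apply/andP; split; lra.
apply: (nbl_eq0 s0 hu e0 he); rewrite t0 /=; lra.
Qed.

Variables (m : nat) (q : int) (A : 'I_n.+1 -> nat -> C) (Rad R' rhoA BA : R).
Hypotheses (Rad0 : 0 < Rad) (RR' : Rad < R') (R'A : R' < rhoA) (hA : forall j, bdd (A j) rhoA BA).
Hypothesis conv : forall k, (0 < k)%N -> exists Rk, Rad < Rk /\ exists B, bdd (a k) Rk B.
Hypothesis conv_m : forall k, (0 < k <= m)%N -> exists B, bdd (a k) R' B.
Hypothesis gF : forall k, germ_zero (subst_exotic F gamma r a k).
Hypothesis gdF : forall j k, (k < m)%N -> germ_zero (subst_exotic (dpart F j) gamma r a k).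
Hypothesis dFm : forall j t, 0 < cabs t < R' ->
  subst_exotic (dpart F j) gamma r a m t = laurent (- q) (A j) t.
Hypothesis An : forall t, Rad < cabs t <= R' -> ps (A ord_max) t != 0.

(** Strong induction on k: the right-hand side involves earlier coefficients only, hence converges
    up to [R'], and A_n has no zero with Rad < |t| <= R', so alpha_k continues through this annulus.
    The linear equation starts at k = m + 1; the finitely many earlier coefficients converge up to
    [R'] by assumption. *)
Lemma coefficient_extension k rho : (0 < k)%N -> 0 < rho < R' -> exists B, bdd (a k) rho B.
Proof.
elim/ltn_ind: k rho => k IH rho k0 /andP[rho0 rR].
have [km|mk] := leqP k m.
  have [|B hB] := conv_m (k := k); first by rewrite k0.
  by exists B; apply: bddW hB; exact: ltW.
have [Rk [RRk [Bk hBk]]] := conv k0.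
(* R1 lies beyond [Rad], where A_n has no zeros, and still inside the disc on which alpha_k is known
   to converge. *)
pose R1 := (Rad + Num.min Rk R') / 2.
have RadR1 : Rad < R1 by rewrite /R1 ltr_pdivlMr // mulr_natr mulr2n ltrD2l lt_min RRk.
have R1k : R1 < Rk.
  rewrite /R1 ltr_pdivrMr // mulr_natr mulr2n; apply: ltr_leD => //; by rewrite ge_min lexx.
have R1R' : R1 < R'.
  rewrite /R1 ltr_pdivrMr // mulr_natr mulr2n; apply: ltr_leD => //; by rewrite ge_min lexx orbT.
pose R2 := (Num.max rho R1 + R') / 2.
have mR : Num.max rho R1 < R' by rewrite gt_max rR.
have R2R' : R2 < R' by rewrite /R2 ltr_pdivrMr //; move: mR; lra.
have R12 : R1 < R2.
  apply: (@le_lt_trans _ _ (Num.max rho R1)); first by rewrite le_max lexx orbT.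
  by rewrite /R2 ltr_pdivlMr //; move: mR; lra.
have rR2 : rho <= R2.
  apply: (@le_trans _ _ (Num.max rho R1)); first by rewrite le_max lexx.
  by rewrite /R2 ler_pdivlMr //; move: mR; lra.
pose rhoh := (R2 + R') / 2.
have l1 : R2 < rhoh by rewrite /rhoh ltr_pdivlMr //; lra.
have l2 : rhoh < R' by rewrite /rhoh ltr_pdivrMr //; lra.
have R10 : 0 < R1 by apply: lt_trans RadR1.
have R20 : 0 < R2 by apply: lt_trans R12.
have rhoh0 : 0 < rhoh by apply: lt_trans l1.
have hA' j : bdd (A j) rhoh BA by apply: bddW (hA j); apply: ltW => //; apply: lt_trans R'A.
have [c [c0 low]] : exists c : R, 0 < c /\ forall z, R1 <= cabs z <= R2 -> c <= cabs (ps (A ord_max) z).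
  apply: (@ps_lower_bound R (A ord_max) rhoh R2 BA (fun z => R1 <= cabs z <= R2) l1 (hA' _)) => z.
  - by move=> /andP[h1 h2]; rewrite h2 (lt_le_trans R10).
  - move=> H; apply/andP; split; apply/ler_addgt0Pr => e e0; have [w /andP[w1 w2] wz] := H e e0.
      by have := cabs_ler_dist w z; move: w1 wz; lra.
    by have := cabs_ler_dist z w; rewrite cabsBC; move: w2 wz; lra.
  - by move=> /andP[h1 h2]; apply: An; rewrite (lt_le_trans RadR1 h1) (le_trans h2 (ltW R2R')).
pose cc t (j : 'I_n.+1) i := dcoef gamma r a j i t.
pose aj (j : 'I_n.+1) t := subst_exotic (dpart F j) gamma r a m t.
have laj j : has_laurent rhoh (aj j).
  apply: has_laurent_subst => // i /andP[i0 im]; exists R'.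
  have [|B hB] := conv_m (k := i); first by rewrite i0.
  by exists B.
have lcc (j : 'I_n.+1) i : (i < k)%N -> has_laurent rhoh (fun t => cc t j i).
  move=> ik; apply: has_laurent_dcoef => // i0; exists ((rhoh + R') / 2).
  have [|B hB] := IH i ik ((rhoh + R') / 2) i0; last first.
    by exists B; split=> //; rewrite ltr_pdivlMr //; move: l2; lra.
  by apply/andP; split; move: rhoh0 l2; lra.
have ltr j : poly_laurent rhoh (fun t => trunc_ser (cc t) k j).
  by apply: poly_laurent_poly => // i; exact: lcc.
pose rhs t := - (psubst F (m + k).+2 (trunc_ser (cc t) k) - \sum_j aj j t *: ('X^m * trunc_ser (cc t) k j))`_(m + k).
have lrhs : has_laurent rhoh rhs.
  apply: has_laurentN => //.
  have p1 := @poly_laurent_psubst R rhoh rhoh0 n F (m + k).+2 (fun j t => trunc_ser (cc t) k j) ltr.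
  have p2 : poly_laurent rhoh (fun t => (-1)%:P * \sum_j aj j t *: ('X^m * trunc_ser (cc t) k j)).
    apply: poly_laurentM => //; first exact: poly_laurent_cst.
    apply: poly_laurent_sum => // j; apply: poly_laurentZ => //.
    by apply: poly_laurentM => //; exact: poly_laurent_cst.
  apply: has_laurent_ext (has_laurentD rhoh0 (p1 (m + k)%N) (p2 (m + k)%N)) => t _.
  by rewrite -coefD polyCN mulN1r.
have [u hu] := has_laurentM rhoh0 (has_laurent_exprz rhoh0 (- q)) lrhs.
have idR (G : nat -> {ffun 'I_n.+1 -> nat} -> C) k' : germ_zero (subst_exotic G gamma r a k') ->
    forall t, 0 < cabs t < Rad -> subst_exotic G gamma r a k' t = 0.
  move=> g; apply: (subst_exotic_eq0 _ g) => i sg /andP[i0 _] /andP[sg0 sgR].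
  have [Ri [RRi [B hB]]] := conv i0; exists B; apply: bddW hB; first exact: ltW.
  by rewrite ltW // (lt_trans sgR).
(* For |t| < Rad all series converge by assumption, so the formal equation is an identity of
   functions there. *)
have eqn t : 0 < cabs t < Rad -> \sum_(j < n.+1) ps (A j) t * laurent (r k) (expoX k (r k) j (a k)) t =
   t ^ (- q) * rhs t.
  move=> tR; have /andP[t0 tle] := tR; have tn0 : t != 0 by rewrite -cabs_gt0.
  have <- : \sum_j aj j t * cc t j k = rhs t.
    apply: (@linearized_eq R n F (cc t) m _ _ _ k (m + k).+2 k mk (leqnn _) (ltnSn _)).
    - by [].
    - by move=> j k' k'm; apply: (idR _ _ (gdF j k'm) t tR).
    - by move=> k'; apply: (idR _ _ (gF k') t tR).
  rewrite mulr_sumr; apply: eq_bigr => j _.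
  rewrite /aj dFm ?t0 ?(lt_trans tle) // /laurent opprK /cc dcoefE // [RHS]mulrA.
  by congr (_ * _); rewrite mulrA -expfzDr // addNr expr0z mul1r.
have [B hB] := analytic_extension gamma0 R10 R12 l1 hA' c0 low hBk R1k hu Rad0 eqn.
by exists B; apply: bddW hB => //; exact: ltW.
Qed.

End Extension.

(** * Growth on a circle *)

Section Directions.
Variable R : realType.
Local Notation C := R[i].

Lemma unit_cis (w : C) : cabs w = 1 ->
  exists2 v : R, 0 <= v <= 1 & w = Complex (cos (2 * pi * v)) (sin (2 * pi * v)).
Proof.
case: w => x y /= /(congr1 (fun z => z ^+ 2)); rewrite expr1n sqr_sqrtr ?addr_ge0 ?sqr_ge0 // => xy.
have p0 := pi_gt0 R.
have x1 : -1 <= x <= 1.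
  by rewrite -ler_norml -(ler_sqr (normr_ge0 _)) ?nnegrE // expr1n real_normK ?num_real // -xy lerDl sqr_ge0.
have x1' : x \in `[(-1), 1] by rewrite in_itv.
have c := acosK x1'; have s := sin_acos x1; have a0 := acos_ge0 x1; have ap := acos_lepi x1.
have s2 : Num.sqrt (1 - x ^+ 2) = `|y| by rewrite -xy addrAC subrr add0r sqrtr_sqr.
have [y0|y0] := leP 0 y.
  exists (acos x / (2 * pi)).
    by rewrite divr_ge0 ?mulr_ge0 ?(ltW p0) //= ler_pdivrMr ?mulr_gt0 // mul1r; lra.
  by rewrite mulrC divfK ?mulf_neq0 ?gt_eqF // c s s2 ger0_norm.
exists (1 - acos x / (2 * pi)).
  rewrite subr_ge0 lerBlDr lerDl divr_ge0 ?mulr_ge0 ?(ltW p0) // andbT.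
  by rewrite ler_pdivrMr ?mulr_gt0 // mul1r; lra.
have -> : 2 * pi * (1 - acos x / (2 * pi)) = - acos x + pi *+ 2.
  by rewrite mulrBr mulr1 [2 * pi * (_ / _)]mulrC divfK ?mulf_neq0 ?gt_eqF // mulr2n; ring.
by rewrite cosD2pi sinD2pi cosN sinN c s s2 ltr0_norm // opprK.
Qed.

(** Pigeonhole: with N one more than the number of points, some N-th root of unity differs from all
    directions z/|z|. *)
Lemma good_direction (zs : seq C) : exists phi : R, forall z, z \in zs -> z != 0 ->
  z != (cabs z)%:C%C * cexp (Complex 0 phi).
Proof.
pose N := (size zs).+1; pose us := [seq z / (cabs z)%:C%C | z <- zs].
have /allPn[w] : ~~ all (mem us) [seq unity R N ^+ d | d <- iota 0 N].
  apply/negP => /allP h.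
  have : (size [seq unity R N ^+ d | d <- iota 0 N] <= size us)%N.
    apply: uniq_leq_size => //.
    rewrite map_inj_in_uniq ?iota_uniq // => d d'; rewrite !mem_iota !add0n /= => dN d'N.
    wlog dd' : d d' dN d'N / (d <= d')%N.
      by move=> W; case: (leqP d d') => [|/ltnW] le E; [exact: W | symmetry; exact: W].
    move=> E; apply/eqP; rewrite eqn_leq dd' leqNgt; apply/negP => lt.
    have := @unity_neq1 R N (d' - d); rewrite subn_gt0 lt (leq_ltn_trans (leq_subr _ _) d'N) => /(_ isT).
    have u0 : unity R N ^+ d != 0 by rewrite expf_neq0 // cexp_neq0.
    by rewrite -(inj_eq (mulfI u0)) -exprD subnKC // -E mulr1 eqxx.
  by rewrite !size_map size_iota ltnn.
move=> /mapP[d _ ->] nin; exists (2 * pi / N%:R * d%:R) => z zzs z0; apply/negP => /eqP E.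
move: nin; rewrite /= => /negP; apply; apply/mapP; exists z => //.
rewrite unityX [X in _ = X / _]E [_%:C%C * _]mulrC mulfK //.
by rewrite (_ : 0 = (0 : R)%:C%C) // (inj_eq (@complexI R)) cabs_eq0.
Qed.

End Directions.

Section CircleGrowth.
Variables (R : realType) (gamma : R).
Local Notation C := R[i].
Local Notation expoX := (exponentX gamma).
Hypothesis gamma0 : gamma != 0.
Variables (n : nat) (F : nat -> {ffun 'I_n.+1 -> nat} -> C) (r : nat -> int) (a : nat -> nat -> C).
Hypothesis hF : mps_convergent F.
Variables (m : nat) (q : int) (A : 'I_n.+1 -> nat -> C) (R' BA : R).
Hypotheses (hA : forall j, bdd (A j) R' BA) (An0 : A ord_max 0%N != 0).
Hypothesis conv_a : forall k rho, (0 < k)%N -> 0 < rho < R' -> exists B, bdd (a k) rho B.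
Hypothesis idF : forall k t, 0 < cabs t < R' -> subst_exotic F gamma r a k t = 0.
Hypothesis iddF : forall j k t, (k < m)%N -> 0 < cabs t < R' ->
  subst_exotic (dpart F j) gamma r a k t = 0.
Hypothesis dFm : forall j t, 0 < cabs t < R' ->
  subst_exotic (dpart F j) gamma r a m t = laurent (- q) (A j) t.
Variables (eps Rc C1 A1 : R).
Hypotheses (eps0 : 0 < eps) (eRc : eps < Rc) (RcR' : Rc < R') (C10 : 0 <= C1) (A10 : 0 < A1).
Hypothesis inner : forall (j : 'I_n.+1) k, (0 < k)%N ->
  bdd (expoX k (r k) j (a k)) eps (C1 * A1 ^+ k * eps ^ (r k)).
Hypothesis AnRc : forall t, cabs t = Rc -> ps (A ord_max) t != 0.

(** Value of Im s at which |t| = rho; |t| depends on Im s only, and gamma Re s is an argument of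
    t. *)
Let height (rho : R) := - ln rho / gamma.

Lemma cabs_tvar_height rho x : 0 < rho -> cabs (tvar gamma (Complex x (height rho))) = rho.
Proof. by move=> r0; rewrite cabs_tvar /= /height mulrC divfK // opprK lnK ?posrE. Qed.

Lemma tvarE (s : C) : tvar gamma s = (cabs (tvar gamma s))%:C%C * cexp (Complex 0 (gamma * complex.Re s)).
Proof.
rewrite cabs_tvar /tvar -complexiE; case: s => x y /=.
by rewrite !(mul0r, mulr0, mul1r, add0r, addr0, subr0, sub0r, oppr0) expR0 rmorph1 mul1r.
Qed.

(** The path in s goes from |t| = eps to |t| = Rc at the fixed argument phi, then runs at fixed Im s
    through a length 2 pi / |gamma|, during which t makes one turn of the circle. Cauchy's estimate
    converts the bound on the circle into one on Laurent coefficients. *)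
Lemma circle_growth : exists C2 A2 : R, [/\ 0 <= C2, 0 < A2 & forall k l, (0 < k)%N ->
  cabs (a k l) * Rc ^+ l <= C2 * A2 ^+ k * Rc ^ (r k)].
Proof.
have Rc0 : 0 < Rc by apply: lt_trans eRc.
have R'0 : 0 < R' by apply: lt_trans RcR'.
have [zs hzs] := zeros_finite Rc0 RcR' (hA ord_max) An0.
have [phi hphi] := good_direction zs.
set u := cexp (Complex 0 phi) in hphi.
have u1 : cabs u = 1 by rewrite cabs_cexp expR0.
pose x0 := phi / gamma.
pose s0 := Complex x0 (height eps); pose s1 := Complex x0 (height Rc).
pose s2 := Complex (x0 + 2 * pi / gamma) (height Rc).
pose P1 z := eps <= cabs z <= Rc /\ z = (cabs z)%:C%C * u.
have ucloses z : (forall e, 0 < e -> exists2 w, eps <= cabs w <= Rc & cabs (w - z) < e) -> eps <= cabs z <= Rc.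
  move=> H; apply/andP; split; apply/ler_addgt0Pr => e e0; have [w /andP[w1 w2] wz] := H e e0.
    by have := cabs_ler_dist w z; move: w1 wz; lra.
  by have := cabs_ler_dist z w; rewrite cabsBC; move: w2 wz; lra.
have [c1 [c10 low1]] : exists c : R, 0 < c /\ forall z, P1 z -> c <= cabs (ps (A ord_max) z).
  apply: (@ps_lower_bound R (A ord_max) R' Rc BA P1 RcR' (hA _)) => z.
  - by move=> [/andP[h1 h2] _]; rewrite h2 (lt_le_trans eps0).
  - move=> H; split.
      by apply: ucloses => e e0; have [w [w1 _] wz] := H e e0; exists w.
    apply/subr0_eq/cabs_eq0_small => e e0.
    have e20 : 0 < e / 2 by rewrite divr_gt0.
    have [w [_ w1] wz] := H (e / 2) e20.
    have -> : z - (cabs z)%:C%C * u = (z - w) + (cabs w - cabs z)%:C%C * u.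
      by rewrite rmorphB mulrBl -w1 addrA subrK.
    apply: le_trans (cabsD _ _) _; rewrite cabsM u1 mulr1 cabs_real cabsBC.
    have : `|cabs w - cabs z| <= cabs (w - z).
      have h1 := cabs_ler_dist w z; have h2 := cabs_ler_dist z w; rewrite cabsBC in h2.
      by rewrite ler_norml; apply/andP; split; lra.
    by move: wz; lra.
  - move=> [/andP[h1 h2] zu]; apply/eqP => fz.
    have z0 : z != 0 by rewrite -cabs_gt0 (lt_le_trans eps0).
    have zin : z \in zs by apply: hzs; rewrite // h2 (lt_le_trans eps0).
    by have := hphi z zin z0; rewrite -zu eqxx.
have [c2 [c20 low2]] : exists c : R, 0 < c /\ forall z, cabs z = Rc -> c <= cabs (ps (A ord_max) z).
  apply: (@ps_lower_bound R (A ord_max) R' Rc BA (fun z => cabs z = Rc) RcR' (hA _)) => z.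
  - by move=> ->; rewrite Rc0 lexx.
  - move=> H; apply/eqP; rewrite eq_le; apply/andP; split; apply/ler_addgt0Pr => e e0; have [w w1 wz] := H e e0.
      by have := cabs_ler_dist z w; rewrite cabsBC; move: w1 wz; lra.
    by have := cabs_ler_dist w z; move: w1 wz; lra.
  - exact: AnRc.
pose c := Num.min c1 c2.
have c0 : 0 < c by rewrite /c lt_min c10.
have [Z Z0 hZ] := exprz_bound Rc q eps0; have [Z' Z'0 hZ'] := exprz_bound Rc (- q) eps0.
have BA0 : 0 <= BA := bdd_ge0 (hA ord_max).
(* X bounds |Re s| on both segments, so that e^(-X) <= |x| <= e^X; x is auxiliary here, since the
   coefficients depend on t alone. *)
pose X := `|x0| + `|2 * pi / gamma|.
have adm s : eps <= cabs (tvar gamma s) <= Rc -> `|complex.Re s| <= X ->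
    c <= cabs (ps (A ord_max) (tvar gamma s)) ->
    admissible gamma r a F m eps Rc (expR (- X)) (expR X) (Z * BA) (c / (Z' + 1)) s.
  move=> ht hX hc; have /andP[t1 t2] := ht; have t0 : 0 < cabs (tvar gamma s) by apply: lt_le_trans t1.
  have tR : 0 < cabs (tvar gamma s) < R' by rewrite t0 (le_lt_trans t2).
  split=> //.
  - by rewrite cabs_cexp !ler_expR; rewrite ler_norml in hX.
  - move=> j; rewrite dFm // /laurent opprK cabsM cabsXz.
    by apply: ler_pM; rewrite ?exprz_ge0 ?cabs_ge0 ?hZ // (cabs_ps _ (hA j)) // ltW //; case/andP: tR.
  - rewrite dFm // /laurent opprK cabsM cabsXz mulrC.
    apply: ler_pM => //; rewrite ?invr_ge0 ?(ltW c0) //; first lra.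
    rewrite -[_ ^ q]invrK invr_expz lef_pV2 ?posrE ?exprz_gt0 //; last by lra.
    by have := hZ' _ ht; lra.
have e1 : eps <= cabs (tvar gamma s0) <= Rc by rewrite cabs_tvar_height // lexx ltW.
have e2 : eps <= cabs (tvar gamma s1) <= Rc by rewrite cabs_tvar_height // lexx ltW.
have e3 : eps <= cabs (tvar gamma s2) <= Rc by rewrite cabs_tvar_height // lexx ltW.
have w0 : 0 < expR (- X) by exact: expR_gt0.
have Ma0 : 0 <= Z * BA by exact: mulr_ge0.
have ca0 : 0 < c / (Z' + 1) by rewrite divr_gt0 //; lra.
have adm1 z : seg s0 s1 z -> admissible gamma r a F m eps Rc (expR (- X)) (expR X) (Z * BA) (c / (Z' + 1)) z.
  move=> [v hv ->]; set s := s0 + _.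
  have Es : complex.Re s = x0 by rewrite /s /s0 /s1 /=; ring.
  apply: adm.
  - exact: tvar_seg hv e1 e2.
  - by rewrite Es /X lerDl.
  - apply: (@le_trans _ _ c1); first by rewrite /c ge_min lexx.
    apply: low1; split; first exact: tvar_seg hv e1 e2.
    by rewrite {1}tvarE Es /x0 [gamma * _]mulrC divfK.
have adm2 z : seg s1 s2 z -> admissible gamma r a F m eps Rc (expR (- X)) (expR X) (Z * BA) (c / (Z' + 1)) z.
  move=> [v hv ->]; set s := s1 + _; have /andP[v0 v1] := hv.
  have Es : complex.Re s = x0 + v * (2 * pi / gamma) by rewrite /s /s2 /s1 /=; ring.
  have Is : complex.Im s = height Rc by rewrite /s /s2 /s1 /=; ring.
  have ct : cabs (tvar gamma s) = Rc.
    by rewrite -[RHS](cabs_tvar_height 0 Rc0) !cabs_tvar Is.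
  apply: adm.
  - by rewrite ct lexx ltW.
  - rewrite Es /X; apply: le_trans (ler_normD _ _) _; rewrite lerD2l normrM (ger0_norm v0).
    by rewrite ler_piMl.
  - by apply: (@le_trans _ _ c2); [rewrite /c ge_min lexx orbT | exact: low2].
have init : growing gamma r a n (eq s0).
  exists C1, A1; split=> // _ j k <-; have ct := cabs_tvar_height x0 eps0.
  case: (posnP k) => [->|k0]; first by rewrite cabs0 expr0 mulr1.
  rewrite dcoefE // /laurent cabsM cabsXz ct.
  have e0z : 0 < eps ^ (r k) by exact: exprz_gt0.
  have -> : C1 * A1 ^+ k = eps ^ (- r k) * (C1 * A1 ^+ k * eps ^ (r k)).
    by rewrite mulrCA -expfzDr ?gt_eqF // addNr expr0z mulr1.
  by rewrite ler_wpM2l ?exprz_ge0 ?(ltW eps0) // (cabs_ps _ (inner j k0)) // ct.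
have g1 : growing gamma r a n (seg s0 s1).
  exact: (growing_seg gamma0 conv_a hF idF iddF eps0 RcR' w0 Ma0 ca0 adm1 init).
have g1' : growing gamma r a n (eq s1).
  apply: (growingU g1 g1) => s <-; left; exists 1; rewrite ?ler01 ?lexx //.
  by rewrite mul1r addrC subrK.
have [C2 [A2 [C20 A20 hg]]] := growing_seg gamma0 conv_a hF idF iddF eps0 RcR' w0 Ma0 ca0 adm2 g1'.
exists C2, A2; split=> // k l k0.
have Rcm : 0 < (Rc + R') / 2 < R'.
  by rewrite divr_gt0 ?addr_gt0 //= ltr_pdivrMr //; move: RcR'; lra.
have [B hB] := conv_a k0 Rcm.
have Rcl : Rc <= (Rc + R') / 2 by rewrite ler_pdivlMr //; move: RcR'; lra.
apply: (cauchy_estimate l Rc0 Rcl hB) => t ct.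
have Rz : 0 < Rc ^ (r k) by exact: exprz_gt0.
have tn0 : t != 0 by rewrite -cabs_gt0 ct.
have [s hs ts] : exists2 s, seg s1 s2 s & tvar gamma s = t.
  have w1 : cabs (t / Rc%:C%C / u) = 1.
    by rewrite !cabsM !cabsV u1 ct cabs_real gtr0_norm // invr1 mulr1 divff ?gt_eqF.
  have [v hv E] := unit_cis w1.
  exists (s1 + v%:C%C * (s2 - s1)); first by exists v.
  rewrite tvarE.
  have -> : complex.Re (s1 + v%:C%C * (s2 - s1)) = x0 + v * (2 * pi / gamma) by rewrite /s2 /s1 /=; ring.
  have -> : cabs (tvar gamma (s1 + v%:C%C * (s2 - s1))) = Rc.
    rewrite -[RHS](cabs_tvar_height 0 Rc0) !cabs_tvar.
    by congr (expR (- (gamma * _))); rewrite /s2 /s1 /=; ring.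
  have -> : Complex 0 (gamma * (x0 + v * (2 * pi / gamma))) = Complex 0 phi + Complex 0 (2 * pi * v) :> C.
    by apply/eqP; rewrite eq_complex /= addr0 eqxx /= /x0; apply/eqP; field.
  rewrite cexpD -/u (cexp_cis (2 * pi * v)) -E [u * _]mulrC divfK ?cexp_neq0 //.
  by rewrite mulrC divfK // (_ : 0 = (0 : R)%:C%C) // (inj_eq (@complexI R)) gt_eqF.
have := hg s ord0 k hs; rewrite ts dcoefE // /laurent cabsM cabsXz ct.
have -> : expoX k (r k) (@ord0 n) (a k) = a k by apply/funext => l'; rewrite /exponentX mul1r.
rewrite -(ler_pM2r Rz) [_ * _ * Rc ^ _]mulrAC -expfzDr ?gt_eqF // addNr expr0z mul1r.
by [].
Qed.

End CircleGrowth.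

Lemma geometric_from (R : realType) (th : R) (z : int) N : 0 <= th -> th < 1 ->
  \sum_(l < N) (if z <= l%:Z then th ^ (l%:Z - z) else 0) <= 1 / (1 - th).
Proof.
move=> th0 th1; have d0 : 0 < 1 - th by lra.
(* For N < z the sum is still empty, and the value 1 makes the bound (1 - e N) / (1 - th) equal to
   0. *)
pose e N := if z <= N%:Z then th ^ (N%:Z - z) else 1.
have e0 N' : 0 <= e N' by rewrite /e; case: ifP => // _; exact: exprz_ge0.
have H : \sum_(l < N) (if z <= l%:Z then th ^ (l%:Z - z) else 0) <= (1 - e N) / (1 - th).
  elim: N => [|N IH].
    rewrite big_ord0 divr_ge0 ?(ltW d0) // subr_ge0 /e; case: ifP => // z0.
    have [d ->] : exists d : nat, 0%:Z - z = d%:Z by exists (absz (0 - z)); lia.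
    by rewrite -exprnP exprn_ile1 // ltW.
  rewrite big_ord_recr /=; apply: le_trans (lerD IH (lexx _)) _.
  rewrite ler_pdivlMr // mulrDl divfK ?gt_eqF // /e.
  case: ifP => zN.
    have -> : z <= N.+1%:Z by lia.
    have [d Ed] : exists d : nat, N%:Z - z = d%:Z by exists (absz (N%:Z - z)); lia.
    have -> : N.+1%:Z - z = d.+1%:Z by lia.
    by rewrite Ed -!exprnP exprS le_eqVlt; apply/orP; left; apply/eqP; ring.
  case: ifP => zN1; last by rewrite mul0r addr0.
  have -> : N.+1%:Z - z = 0 by lia.
  by rewrite expr0z mul0r addr0.
apply: le_trans H _; rewrite ler_wpM2r ?invr_ge0 ?(ltW d0) //.
by have := e0 N; lra.
Qed.

(** Powers t^(l - z) with l < z are largest on the inner circle and are bounded by the norm there;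
    those with l >= z are at most Rad^(l - z) and sum geometrically against the Cauchy bounds at Rc.
    The result does not involve z, so unbounded pole orders do no harm. *)
Lemma annulus_bound (R : realType) (c : nat -> R[i]) (z : int) (eps Rad Rc C1 C2 : R) t :
  0 < eps -> 0 < Rad -> Rad < Rc -> 0 <= C2 ->
  bdd c eps (C1 * eps ^ z) -> (forall l, cabs (c l) * Rc ^+ l <= C2 * Rc ^ z) ->
  eps <= cabs t <= Rad -> cabs (laurent z c t) <= C1 + C2 / (1 - Rad / Rc).
Proof.
move=> e0 R0 RRc C20 h1 h2 /andP[t1 t2].
have Rc0 : 0 < Rc by apply: lt_trans RRc.
have t0 : 0 < cabs t by apply: lt_le_trans t1.
have th1 : Rad / Rc < 1 by rewrite ltr_pdivrMr // mul1r.
have th0 : 0 <= Rad / Rc by rewrite divr_ge0 // ltW.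
rewrite /laurent /ps.
have ez : 0 < eps ^ (- z) by exact: exprz_gt0.
have tz : 0 < cabs t ^ (- z) by exact: exprz_gt0.
have b N : \sum_(l < N) cabs (c l * t ^+ l) * cabs t ^ (- z) <= C1 + C2 / (1 - Rad / Rc).
  apply: (@le_trans _ _ (\sum_(l < N) (eps ^ (- z) * (cabs (c l) * eps ^+ l) +
     C2 * (if z <= l%:Z then (Rad / Rc) ^ (l%:Z - z) else 0)))).
    apply: ler_sum => l _; rewrite cabsM cabsX -mulrA.
    have E (x : R) : 0 < x -> x ^+ l * x ^ (- z) = x ^ (l%:Z - z) by move=> x0; rewrite exprnP -expfzDr ?gt_eqF.
    rewrite E // mulrCA [eps ^ _ * _]mulrC E //.
    have g0 (x : R) : 0 < x -> 0 <= x ^ (l%:Z - z) by move=> x0; rewrite ltW // exprz_gt0.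
    case: ifP => zl.
      rewrite ler_wpDl ?mulr_ge0 ?cabs_ge0 ?g0 //.
      have [d Ed0] := le_int_nat zl; have Ed : l%:Z - z = d%:Z by rewrite Ed0 addrAC subrr add0r.
      have := ler_wpM2r (ltW (exprz_gt0 (- z) Rc0)) (h2 l); rewrite -!mulrA E //.
      rewrite -expfzDr ?gt_eqF // addrN expr0z mulr1 Ed -!exprnP => h.
      apply: (@le_trans _ _ (cabs (c l) * Rad ^+ d)).
        by rewrite ler_wpM2l ?cabs_ge0 // lerXn2r ?nnegrE // ltW.
      rewrite exprMn exprVn mulrA ler_pdivlMr ?exprn_gt0 // mulrAC.
      by rewrite ler_wpM2r // exprn_ge0 // ltW.
    rewrite mulr0 addr0 ler_wpM2l ?cabs_ge0 //.
    move/negbT: zl; rewrite -ltNge => /ltW/le_int_nat[d Ed0].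
    have Ed : l%:Z - z = - d%:Z by rewrite Ed0 opprD addrA subrr add0r.
    by rewrite Ed -!exprnN lef_pV2 ?posrE ?exprn_gt0 // lerXn2r ?nnegrE // ltW.
  rewrite big_split /= -!mulr_sumr; apply: lerD.
    have := ler_wpM2l (ltW ez) (h1 N); rewrite [X in _ <= X -> _]mulrCA -expfzDr ?gt_eqF // addNr expr0z mulr1.
    by [].
  by apply: ler_wpM2l => //; have := geometric_from z N th0 th1; rewrite mul1r.
have b' : abs_bounded (fun l => c l * t ^+ l) ((C1 + C2 / (1 - Rad / Rc)) / cabs t ^ (- z)).
  by move=> N; rewrite ler_pdivlMr // mulr_suml.
rewrite cabsM cabsXz mulrC -ler_pdivlMr //; exact: cabs_csum b'.
Qed.

(** * Convergence *)

Lemma common_radius (R : realType) (a : nat -> nat -> R[i]) (Rad : R) m :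
  (forall k, (0 < k)%N -> exists Rk : R, Rad < Rk /\ exists B, bdd (a k) Rk B) -> 0 < Rad ->
  exists rho0, Rad < rho0 /\ forall k, (0 < k <= m)%N -> exists B, bdd (a k) rho0 B.
Proof.
move=> conv Rad0; elim: m => [|m [rho1 [R1 h1]]].
  by exists (Rad + 1); split; [rewrite ltrDl | case].
have [Rk [Rk1 [Bk hk]]] := conv m.+1 isT.
have mp : Rad < Num.min rho1 Rk by rewrite lt_min R1.
have m0 : 0 <= Num.min rho1 Rk by rewrite ltW // (lt_trans Rad0).
exists (Num.min rho1 Rk); split=> // k /andP[k0].
rewrite leq_eqVlt => /orP[/eqP ->|km].
  by exists Bk; apply: bddW hk => //; rewrite ge_min lexx orbT.
have [|B hB] := h1 k; first by rewrite k0.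
by exists B; apply: bddW hB => //; rewrite ge_min lexx.
Qed.

Lemma annulus_growth (R : realType) (n : nat) (F : nat -> {ffun 'I_n.+1 -> nat} -> R[i])
    (gamma Rad : R) (r : nat -> int) (a : nat -> nat -> R[i]) (m : nat) (q : int) :
  mps_convergent F -> gamma != 0 -> 0 < Rad ->
  (forall k, (0 < k)%N -> exists Rk : R, Rad < Rk /\ exists B, bdd (a k) Rk B) ->
  (forall k, germ_zero (subst_exotic F gamma r a k)) ->
  (forall j k, (k < m)%N -> germ_zero (subst_exotic (dpart F j) gamma r a k)) ->
  ~ ord0_ge (subst_exotic (dpart F ord_max) gamma r a m) (q + 1) ->
  (forall j, ord0_ge (subst_exotic (dpart F j) gamma r a m) q) ->
  forall eps0 : R, 0 < eps0 -> exists C A : R, [/\ 0 <= C, 0 < A &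
    forall k t, eps0 <= cabs t <= Rad -> cabs (dcoef gamma r a 0 k t) <= C * A ^+ k].
Proof.
move=> hF gamma0 Rad0 conv gF gdF nord ord eps0 eps00.
have [rho0 [Rr0 hrho0]] := common_radius m conv Rad0.
pose rhoA := (Rad + rho0) / 2.
have RA : Rad < rhoA by rewrite /rhoA ltr_pdivlMr //; lra.
have Ar0 : rhoA < rho0 by rewrite /rhoA ltr_pdivrMr //; lra.
have rhoA0 : 0 < rhoA by apply: lt_trans RA.
have ldF j : has_laurent rhoA (subst_exotic (dpart F j) gamma r a m).
  by apply: has_laurent_subst => // i im; have [B hB] := hrho0 i im; exists rho0, B.
have exA j : exists AB : (nat -> R[i]) * R, bdd AB.1 rhoA AB.2 /\
    forall t, 0 < cabs t < rhoA -> subst_exotic (dpart F j) gamma r a m t = laurent (- q) AB.1 t.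
  have [u hu] := ldF j; have [A [B hAB]] := nbl_order rhoA0 hu (ord j).
  by exists (A, B).
have /choice[AB hAB] := exA; pose A j := (AB j).1.
pose BA := \sum_j `|(AB j).2|.
have hA j : bdd (A j) rhoA BA.
  apply: bdd_leB (hAB j).1; rewrite /BA (bigD1 j) //= (le_trans (ler_norm _)) // lerDl.
  exact: sumr_ge0.
have dFm j t : 0 < cabs t < rhoA -> subst_exotic (dpart F j) gamma r a m t = laurent (- q) (A j) t.
  by move=> h; rewrite (hAB j).2.
have An0 : A ord_max 0%N != 0 := order_coef0 rhoA0 (hA _) (dFm _) nord.
(* Zeros of A_n are listed up to rho1 < rhoA; [R'] then stops before the first of them beyond [Rad],
   so that Rad < Rc < R' <= rho1 < rhoA < rho0. *)
pose rho1 := (Rad + rhoA) / 2.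
have R1 : Rad < rho1 by rewrite /rho1 ltr_pdivlMr //; lra.
have r1A : rho1 < rhoA by rewrite /rho1 ltr_pdivrMr //; lra.
have rho10 : 0 < rho1 by apply: lt_trans R1.
have [zs hzs] := zeros_finite rho10 r1A (hA _) An0.
have [R' [RR' R'1 gap]] := seq_gap (@cabs R) zs R1.
have R'A : R' < rhoA := le_lt_trans R'1 r1A.
have R'0 : 0 < R' by apply: lt_trans RR'.
have hA' j : bdd (A j) R' BA by apply: bddW (hA j); exact: ltW.
have An t : Rad < cabs t <= R' -> ps (A ord_max) t != 0.
  move=> /andP[t1 t2]; apply/eqP => /hzs zin.
  have h : t \in zs.
    by apply: zin; rewrite (lt_trans Rad0 t1) (le_trans t2).
  by have := gap t h t1; rewrite ltNge t2.
have dFm' j t : 0 < cabs t < R' -> subst_exotic (dpart F j) gamma r a m t = laurent (- q) (A j) t.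
  by move=> /andP[t0 t1]; rewrite dFm // t0 (lt_trans t1).
have conv_m k : (0 < k <= m)%N -> exists B, bdd (a k) R' B.
  move=> hk; have [B hB] := hrho0 k hk; exists B; apply: bddW hB; first exact: ltW.
  by rewrite ltW // (lt_trans R'A).
have conv_a k rho : (0 < k)%N -> 0 < rho < R' -> exists B, bdd (a k) rho B.
  exact: (coefficient_extension gamma0 Rad0 RR' R'A hA conv conv_m gF gdF dFm' An).
have id0 (G : nat -> {ffun 'I_n.+1 -> nat} -> R[i]) k t : germ_zero (subst_exotic G gamma r a k) ->
    0 < cabs t < R' -> subst_exotic G gamma r a k t = 0.
  move=> g; apply: (subst_exotic_eq0 gamma0 _ g) => i sg /andP[i0 _] hs; exact: conv_a.
have idF k t : 0 < cabs t < R' -> subst_exotic F gamma r a k t = 0 by exact: id0.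
have iddF j k t : (k < m)%N -> 0 < cabs t < R' -> subst_exotic (dpart F j) gamma r a k t = 0.
  by move=> km; apply: id0; exact: gdF.
(* Besides eps < eps0, the inner circle must lie below [Rad], hence below Rc. *)
pose e1 := Num.min eps0 Rad.
have e10 : 0 < e1 by rewrite lt_min eps00.
have [eps [ep0 epe _ [C1 [A1 [C10 A10 inner]]]]] :=
  stage_one gamma0 hF R'0 hA' An0 conv_a idF iddF dFm' e10.
pose Rc := (Rad + R') / 2.
have RRc : Rad < Rc by rewrite /Rc ltr_pdivlMr //; lra.
have RcR' : Rc < R' by rewrite /Rc ltr_pdivrMr //; lra.
have epR : eps < Rad by apply: lt_le_trans epe _; rewrite /e1 ge_min lexx orbT.
have epe0 : eps < eps0 by apply: lt_le_trans epe _; rewrite /e1 ge_min lexx.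
have AnRc t : cabs t = Rc -> ps (A ord_max) t != 0.
  by move=> tR; apply: An; rewrite tR RRc ltW.
have [C2 [A2 [C20 A20 outer]]] := circle_growth gamma0 hF hA' An0 conv_a idF iddF dFm'
  ep0 (lt_trans epR RRc) RcR' C10 A10 inner AnRc.
have Rc0 : 0 < Rc by apply: lt_trans RRc.
pose D := 1 / (1 - Rad / Rc).
have D0 : 0 <= D by rewrite divr_ge0 // subr_ge0 ler_pdivrMr // mul1r ltW.
have CD0 : 0 <= C2 * D by exact: mulr_ge0.
have AA : 0 < A1 + A2 by exact: addr_gt0.
exists (C1 + C2 * D), (A1 + A2); split=> //; first exact: addr_ge0.
move=> k t /andP[t1 t2]; case: (posnP k) => [->|k0].
  by rewrite cabs0 expr0 mulr1 addr_ge0.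
have E : exponentX gamma k (r k) 0 (a k) = a k by apply/funext => l; rewrite /exponentX mul1r.
rewrite dcoefE // E.
have C2k : 0 <= C2 * A2 ^+ k by rewrite mulr_ge0 // exprn_ge0 // ltW.
have inn := inner ord0 k k0; rewrite /= E in inn.
have := annulus_bound ep0 Rad0 RRc C2k inn (outer k ^~ k0) (t := t).
rewrite t2 (le_trans (ltW epe0) t1) => /(_ isT) h; apply: le_trans h _.
have p1 : A1 ^+ k <= (A1 + A2) ^+ k by rewrite lerXn2r ?nnegrE ?(ltW A10) ?(ltW AA) // lerDl ltW.
have p2 : A2 ^+ k <= (A1 + A2) ^+ k by rewrite lerXn2r ?nnegrE ?(ltW A20) ?(ltW AA) // lerDr ltW.
rewrite mulrDl; apply: lerD; first exact: ler_wpM2l.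
have -> : C2 * A2 ^+ k / (1 - Rad / Rc) = C2 * D * A2 ^+ k by rewrite /D; ring.
exact: ler_wpM2l.
Qed.

Theorem theorem1 (R : realType) (n : nat)
    (F : nat -> {ffun 'I_n.+1 -> nat} -> R[i])
    (gamma Rad : R) (r : nat -> int) (a : nat -> nat -> R[i]) :
  (1 <= n)%N ->
  (* F is holomorphic near 0 (given by its Taylor coefficients) *)
  mps_convergent F ->
  gamma != 0 ->
  0 < Rad ->
  (* each alpha_k(t) = t^{-r k} sum_l a k l t^l is holomorphic on a
     neighbourhood of the punctured disc 0 < |t| <= Rad *)
  (forall k : nat, (0 < k)%N -> exists Rk : R, Rad < Rk /\ exists B : R,
     forall N : nat, \sum_(l < N) cabs (a k l) * Rk ^+ l <= B) ->
  (* phi is a formal solution: F(x, Phi) = 0 *)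
  (forall k : nat, germ_zero (subst_exotic F gamma r a k)) ->
  (* dF/dy_n (x, Phi) is not identically zero *)
  ~ (forall k : nat, germ_zero (subst_exotic (dpart F ord_max) gamma r a k)) ->
  (* dF/dy_j (x, Phi) = a_j x^m + ..., a_n <> 0, ord_0 a_j >= ord_0 a_n *)
  (exists m : nat,
     (forall (j : 'I_n.+1) (k : nat), (k < m)%N ->
        germ_zero (subst_exotic (dpart F j) gamma r a k)) /\
     ~ germ_zero (subst_exotic (dpart F ord_max) gamma r a m) /\
     exists q : int,
       ord0_eq (subst_exotic (dpart F ord_max) gamma r a m) q /\
       forall j : 'I_n.+1, ord0_ge (subst_exotic (dpart F j) gamma r a m) q) ->
  (* conclusion: uniform convergence on every admissible sector of small radius *)
  forall theta1 theta2 : R,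
    theta1 < theta2 -> theta2 - theta1 < 2 * pi ->
    (0 < gamma -> - (ln Rad) / gamma <= theta1) ->
    (gamma < 0 -> theta2 <= - (ln Rad) / gamma) ->
    exists rho0 : R, 0 < rho0 /\
    exists f : R -> R -> R[i],
      forall e : R, 0 < e -> exists N : nat, forall M : nat, (N <= M)%N ->
        forall rho theta : R, 0 < rho < rho0 -> theta1 < theta < theta2 ->
          cabs (\sum_(k < M) dcoef gamma r a 0 k (sector_t gamma rho theta)
                              * sector_x rho theta ^+ k
                - f rho theta) < e.
Proof.
move=> _ hF gamma0 Rad0 conv gF _ [m [gdF [_ [q [[_ nord] ord]]]]] th1 th2 _ _ hp hn.
(* |t| = e^(-gamma theta) is monotone in theta, so its values at the two ends of the sector bound it
   from below; the position of the sector gives |t| <= Rad. *)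
pose eps0 := Num.min (expR (- (gamma * th1))) (expR (- (gamma * th2))).
have eps00 : 0 < eps0 by rewrite lt_min !expR_gt0.
have [C [A [C0 A0 bnd]]] := annulus_growth hF gamma0 Rad0 conv gF gdF nord ord eps00.
(* At this radius the terms are at most C 2^(-k), uniformly in the sector. *)
exists (1 / (2 * A)); split; first by rewrite divr_gt0 // mulr_gt0.
pose trm rho theta k := dcoef gamma r a 0 k (sector_t gamma rho theta) * sector_x rho theta ^+ k.
exists (fun rho theta => csum (trm rho theta)) => e e0.
have two1 : 1 < 2 :> R by rewrite ltr1n.
have [N hN] := pow_unbounded (2 * C / e) two1.
exists N => M NM rho theta /andP[rho0 rho1] /andP[t1 t2].
have ct : cabs (sector_t gamma rho theta) = expR (- (gamma * theta)) by rewrite cabs_cexp.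
have tin : eps0 <= cabs (sector_t gamma rho theta) <= Rad.
  rewrite ct /eps0 ge_min !ler_expR !lerN2 -ler_ln ?posrE ?expR_gt0 // expRK.
  have [g|g] := ltP 0 gamma.
    rewrite !(ler_pM2l g) (ltW t2) orbT /= lerNl -ler_pdivrMl // mulrC.
    exact: le_trans (hp g) (ltW t1).
  have {}g : gamma < 0 by rewrite lt_neqAle gamma0.
  rewrite !(ler_nM2l g) (ltW t1) /= lerNl -ler_ndivlMl // mulrC.
  exact: le_trans (ltW t2) (hn g).
have cx : cabs (sector_x rho theta) = rho by rewrite cabsM cabs_cis mulr1 cabs_real gtr0_norm.
have trm_le k : cabs (trm rho theta k) <= C * 2^-1 ^+ k.
  rewrite cabsM cabsX cx; apply: (@le_trans _ _ (C * A ^+ k * rho ^+ k)).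
    by rewrite ler_wpM2r ?exprn_ge0 ?(ltW rho0) // bnd.
  rewrite -mulrA -exprMn ler_wpM2l // lerXn2r ?nnegrE ?mulr_ge0 ?(ltW A0) ?(ltW rho0) //.
  by move: rho1; rewrite ltr_pdivlMr ?mulr_gt0 // => h; lra.
have sum_half M' : \sum_(l < M') 2^-1 ^+ l = 2 - 2 * 2^-1 ^+ M' :> R.
  elim: M' => [|M' IH]; first by rewrite big_ord0 expr0; lra.
  by rewrite big_ord_recr /= IH exprS; lra.
(* The bound is the partial sum up to M plus the geometric tail, so that [csum_tail] leaves exactly
   2 C 2^(-M). *)
have ab : abs_bounded (trm rho theta) (\sum_(l < M) cabs (trm rho theta l) + 2 * C * 2^-1 ^+ M).
  move=> M'; have [le|/ltnW le] := leqP M' M.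
    rewrite (sum_ord_split (fun l => cabs (trm rho theta l)) le) -addrA lerDl addr_ge0 ?sumr_ge0 //.
    - by move=> i _; exact: cabs_ge0.
    - by rewrite !mulr_ge0 ?exprn_ge0.
  rewrite (sum_ord_split (fun l => cabs (trm rho theta l)) le) lerD2l.
  apply: (@le_trans _ _ (C * \sum_(M <= l < M') 2^-1 ^+ l)).
    by rewrite mulr_sumr; apply: ler_sum => l _; exact: trm_le.
  rewrite [2 * C]mulrC -mulrA ler_wpM2l //.
  have := sum_ord_split (fun l => 2^-1 ^+ l : R) le; rewrite !sum_half.
  have : 0 <= 2^-1 ^+ M' :> R by rewrite exprn_ge0.
  lra.
have := csum_tail M ab; rewrite cabsBC => h; apply: le_lt_trans h _.
rewrite addrAC subrr add0r exprVn ltr_pdivrMr ?exprn_gt0 // [e * _]mulrC.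
rewrite -ltr_pdivrMr //; apply: lt_le_trans hN _.
by rewrite ler_weXn2l // ler1n.
Qed.
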